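(* Let $\mathbb{D}$ be the open unit disc in $\mathbb{C}$ and let $J$ be the integration operator $Jf(z)=\int_0^z f(\zeta)\,d\zeta$. (1) If $\mathcal{A}=(a_n)_n$ is an increasing sequence of weights on $\mathbb{D}$, then the integration operator $J:\mathcal{A}_0H(\mathbb{D})\to\mathcal{A}_0H(\mathbb{D})$ is continuous, and every proper closed invariant subspace of $J$ on the weighted Fréchet space $\mathcal{A}_0H(\mathbb{D})$ is of the form $$\{f\in\mathcal{A}_0H(\mathbb{D}) \mid f^{(j)}(0)=0,\ 0\le j<K\}$$ for some $K\in\mathbb{N}$. (2) If $\mathcal{V}=(v_n)_n$ is a decreasing sequence of weights on $\mathbb{D}$, then the integration operator $J:\mathcal{V}_0H(\mathbb{D})\to\mathcal{V}_0H(\mathbb{D})$ is continuous, and every proper closed invariant subspace of $J$ on the weighted (LB)-space $\mathcal{V}_0H(\mathbb{D})$ is of the form $$\{f\in\mathcal{V}_0H(\mathbb{D}) \mid f^{(j)}(0)=0,\ 0\le j<K\}$$ for some $K\in\mathbb{N}$.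
   Context: $\mathbb{N}=\{1,2,3,\dots\}$. $H(\mathbb{D})$ is the space of holomorphic functions on $\mathbb{D}$. A weight on $\mathbb{D}$ is a continuous function $v:[0,1[\,\to\,]0,\infty[$ which is decreasing and satisfies $\lim_{r\to1}r^nv(r)=0$ for each $n\in\mathbb{N}$; it is extended radially to $\mathbb{D}$ by $v(z):=v(|z|)$. For a weight $v$, $H^0_v(\mathbb{D})$ is the Banach space of all $f\in H(\mathbb{D})$ with $\max_{|z|=r}|f(z)|=o(1/v(r))$ as $r\to1$, with norm $\|f\|_v=\sup_{|z|<1}v(z)|f(z)|$. Monotonicity of sequences of weights is pointwise ($a_n\le a_{n+1}$, respectively $v_{n+1}\le v_n$, on $\mathbb{D}$). For an increasing sequence $\mathcal{A}=(a_n)_n$ of weights, $\mathcal{A}_0H(\mathbb{D}):=\mathrm{proj}_n H^0_{a_n}(\mathbb{D})$, i.e. $\bigcap_n H^0_{a_n}(\mathbb{D})$ with the Fréchet topology given by the norms $\|\cdot\|_{a_n}$, $n\in\mathbb{N}$. For a decreasing sequence $\mathcal{V}=(v_n)_n$ of weights, $\mathcal{V}_0H(\mathbb{D}):=\mathrm{ind}_n H^0_{v_n}(\mathbb{D})$, i.e. $\bigcup_n H^0_{v_n}(\mathbb{D})$ with the finest locally convex topology making all inclusions $H^0_{v_n}(\mathbb{D})\subset\mathcal{V}_0H(\mathbb{D})$ continuous. A subspace $M$ of a locally convex space $E$ is proper if $\{0\}\ne M\ne E$, and is invariant for a continuous linear operator $T:E\to E$ if $T(M)\subset M$. *)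

(* Defs.v *)
From HB Require Import structures.
From mathcomp Require Import all_boot all_order all_algebra finmap.
From mathcomp Require Import all_classical all_reals all_analysis.
From mathcomp Require Import complex.
Set Implicit Arguments.
Unset Strict Implicit.
Unset Printing Implicit Defensive.
Import Order.TTheory GRing.Theory Num.Theory numFieldNormedType.Exports.
Local Open Scope classical_set_scope.
Local Open Scope ring_scope.

Notation normc := (@Normc.normc _).

(* Packing R[i] as a numClosedFieldType gives it the norm topology of
   MathComp-Analysis, so that derivable, derive1n, etc. are complex derivatives.
   Its norm `|z| lives in R[i]; normc z is the same modulus as an element of R. *)
Definition Cplx (R : realType) : numClosedFieldType := R[i].

Section Holomorphic.
Context {R : realType}.
Local Notation C := (Cplx R).
Implicit Types (f g : C -> C) (r : R).

Definition disc : set C := [set z | normc z < 1].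

Definition circle r : set C := [set z | normc z = r].

(* A function on the disc is represented by its extension by 0 to the whole
   plane, so that equality of functions on the disc is Leibniz equality. *)
Definition holomorphic_disc : set (C -> C) :=
  [set f | (forall z, disc z -> derivable f z 1) /\
           (forall z, ~ disc z -> f z = 0)].

Definition maxmod f r : R := sup [set normc (f z) | z in circle r].

Definition cintegral (g : R -> C) : C :=
  Complex (\int[lebesgue_measure]_(t in `[0, 1]) complex.Re (g t))
          (\int[lebesgue_measure]_(t in `[0, 1]) complex.Im (g t)).

(* The integral from 0 to z is taken along the segment t |-> t z; the value off
   the disc follows the convention of holomorphic_disc. *)
Definition integration f : C -> C :=
  fun z => if normc z < 1 then z * cintegral (fun t => f (real_complex R t * z))
           else 0.

Lemma normCE (z : C) : `|z| = real_complex R (normc z) :> C.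
Proof.
have h (w : R[i]) : `|w| = real_complex R (normc w).
  by case: w => a b; exact: normc_def.
exact: h.
Qed.

Lemma ltcE_real (x y : R) :
  (real_complex R x < real_complex R y :> C) = (x < y).
Proof. exact: ltcR. Qed.

Lemma lecE_real (x y : R) :
  (real_complex R x <= real_complex R y :> C) = (x <= y).
Proof. exact: lecR. Qed.

Lemma normc_ge0 (z : C) : 0 <= normc z.
Proof. by rewrite -lecE_real -normCE; exact: normr_ge0. Qed.

Lemma normcD (z w : C) : normc (z + w) <= normc z + normc w.
Proof. exact: le_normcD. Qed.

Lemma normcB (z w : C) : normc (z - w) = normc (w - z).
Proof. by rewrite -(normcN (w - z)) opprB. Qed.

Lemma continuous_normc : continuous (normc : C -> R).
Proof.
move=> z; apply/(@cvgrPdist_lt R R C (nbhs z) _ normc) => e e0; near=> w.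
have : `|z - w| < real_complex R e.
  near: w; have /(cvgrPdist_lt (FF := nbhs_filter z)) := @cvg_id C (nbhs z).
  by apply; rewrite (ltcE_real 0).
rewrite normCE ltcE_real; apply: le_lt_trans.
have := normcD (z - w) w; have := normcD (w - z) z.
rewrite !subrK [normc (w - z)]normcB ler_norml => h1 h2.
by rewrite lerNl opprB !lerBlDr h1 h2.
Unshelve. all: by end_near. Qed.

Lemma normc_leD (a b : R) : normc (Complex a b) <= `|a| + `|b|.
Proof.
rewrite /Normc.normc -[leRHS]ger0_norm ?addr_ge0// -sqrtr_sqr ler_wsqrtr//.
rewrite -(real_normK (num_real a)) -(real_normK (num_real b)) sqrrD.
by rewrite lerD2r lerDl mulrn_wge0// mulr_ge0.
Qed.

Lemma compact_cball r : compact [set z : C | normc z <= r].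
Proof.
pose h (p : R * R) : C := Complex p.1 p.2.
have hc : continuous h.
  move=> p; apply/(@cvgrPdist_lt C C _ (nbhs p) _ h) => e e0.
  have [e' e'0 ->] : exists2 e' : R, 0 < e' & e = real_complex R e'.
    case: e e0 => a b; rewrite ltcE /= => /andP[/eqP -> a0].
    by exists a.
  near=> q.
  have -> : h p - h q = Complex (p.1 - q.1) (p.2 - q.2) by [].
  rewrite (normCE (Complex _ _)) ltcE_real.
  apply: (le_lt_trans (normc_leD _ _)); rewrite [ltRHS]splitr ltrD//.
  - near: q; apply: (cvgr_dist_lt (FF := nbhs_filter p) fst p.1).
      exact: cvg_fst.
    by rewrite divr_gt0.
  - near: q; apply: (cvgr_dist_lt (FF := nbhs_filter p) snd p.2).
      exact: cvg_snd.
    by rewrite divr_gt0.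
have sq : compact (`[- r, r]%classic `*` `[- r, r]%classic : set (R * R)).
  by apply: compact_setX; exact: segment_compact.
have := continuous_compact (continuous_subspaceT hc) sq.
move=> cK; apply: (subclosed_compact _ cK).
  apply: (@preimage_closed C R normc [set x | x <= r]); last exact: closed_le.
  by move=> z _; exact: continuous_normc.
move=> [a b] /= abr; exists (a, b) => //=.
have cr (x y : R) : `|x| <= Num.sqrt (x ^+ 2 + y ^+ 2).
  by rewrite -sqrtr_sqr ler_wsqrtr // lerDl sqr_ge0.
split; rewrite in_itv /= -ler_norml; first exact: le_trans abr.
by apply: le_trans abr; rewrite addrC.
Unshelve. all: by end_near. Qed.

Lemma holomorphic_bounded f r : holomorphic_disc f -> r < 1 ->
  exists m, forall z, normc z <= r -> normc (f z) <= m.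
Proof.
move=> [df _] r1.
have : compact ((normc \o f) @` [set z : C | normc z <= r]).
  apply: continuous_compact; last exact: compact_cball.
  apply: continuous_in_subspaceT => z; rewrite inE /= => zr.
  apply: continuous_comp; last exact: continuous_normc.
  apply: differentiable_continuous; apply/derivable1_diffP/df.
  exact: le_lt_trans r1.
move=> /compact_bounded [m [_ mP]]; exists (m + 1) => z zr.
have m1 : m < m + 1 by rewrite ltrDl.
have := mP _ m1 (normc (f z)); move=> h.
by apply: le_trans (ler_norm _) (h _); exists z.
Qed.

Lemma holomorphic_submod : submod_closed (mem holomorphic_disc).
Proof.
split=> [|a f g].
  by rewrite inE; split=> // z _; exact: derivable_cst.
rewrite !inE => -[df f0] [dg g0]; split=> z zD.
  by apply: derivableD; [apply: derivableZ; exact: df | exact: dg].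
have -> : (a *: f + g) z = a *: f z + g z by [].
by rewrite f0// g0// scaler0 addr0.
Qed.

End Holomorphic.

(* Only the restriction of the underlying function to [0, 1[ is meaningful.
   "Decreasing" is read in the wide sense. *)
Record weight (R : realType) := Weight {
  weight_fun :> R -> R;
  weight_continuous : {within `[0, 1[%classic, continuous weight_fun};
  weight_gt0 : forall r, 0 <= r < 1 -> 0 < weight_fun r;
  weight_decreasing :
    forall r s, 0 <= r -> r <= s -> s < 1 -> weight_fun s <= weight_fun r;
  weight_cvg0 : forall n, (0 < n)%N ->
    r ^+ n * weight_fun r @[r --> 1^'-] --> 0
}.

Section WeightedSpace.
Context {R : realType}.
Local Notation C := (Cplx R).
Local Notation left1 := ((1 : R)^'-).
Implicit Types (v : weight R) (f g : C -> C).

Definition H0_set v : set (C -> C) :=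
  [set f | holomorphic_disc f /\ maxmod f =o_left1 (fun r => (v r)^-1)].

Definition wnorm v f : R := sup [set v (normc z) * normc (f z) | z in disc].

Lemma has_sup_circle f r : holomorphic_disc f -> 0 <= r -> r < 1 ->
  has_sup [set normc (f z) | z in circle r].
Proof.
move=> hf r0 r1; split.
  exists (normc (f (real_complex R r))), (real_complex R r) => //.
  by rewrite /circle /= expr0n addr0 sqrtr_sqr ger0_norm.
have [m mP] := holomorphic_bounded hf r1.
by exists m => _ [z zr <-]; apply: mP; rewrite zr.
Qed.

Lemma maxmod_ge f z : holomorphic_disc f -> disc z ->
  normc (f z) <= maxmod f (normc z).
Proof.
move=> hf z1; apply: (ub_le_sup (has_sup_circle hf (normc_ge0 z) z1).2).
by exists z.
Qed.

Lemma maxmod_le f r m : holomorphic_disc f -> 0 <= r -> r < 1 ->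
  (forall z, circle r z -> normc (f z) <= m) -> maxmod f r <= m.
Proof.
move=> hf r0 r1 h; apply: ge_sup; first exact: (has_sup_circle hf r0 r1).1.
by move=> _ [z zr <-]; exact: h.
Qed.

Lemma near_left1 : \forall r \near (1 : R)^'-, 0 < r < 1.
Proof.
near=> r; apply/andP; split; near: r; first exact: nbhs_left_gt.
exact: nbhs_left_lt.
Unshelve. all: by end_near. Qed.

Lemma H0_setP v f : H0_set v f <-> holomorphic_disc f /\
  forall e, 0 < e -> \forall r \near (1 : R)^'-,
    forall z, circle r z -> v r * normc (f z) <= e.
Proof.
split=> -[hf fo]; split=> //.
  move=> e e0; move/eqoP: fo => /(_ e e0) h.
  near=> r => z zr.
  have /andP[r0 r1] : 0 < r < 1 by near: r; exact: near_left1.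
  have vr : 0 < v r by apply: weight_gt0; rewrite (ltW r0).
  rewrite mulrC -ler_pdivlMr//.
  have hr : `|maxmod f r| <= e * `|(v r)^-1| by near: r.
  have nv : `|(v r)^-1| = (v r)^-1 by rewrite ger0_norm// invr_ge0 ltW.
  rewrite nv in hr.
  apply: le_trans hr; apply: le_trans (ler_norm _).
  by rewrite -zr; apply: maxmod_ge => //; rewrite /disc /= zr.
apply/eqoP => e e0; have h := fo e e0.
near=> r.
have /andP[r0 r1] : 0 < r < 1 by near: r; exact: near_left1.
have vr : 0 < v r by apply: weight_gt0; rewrite (ltW r0).
have hr z : circle r z -> v r * normc (f z) <= e.
  by move: z; near: r.
have rr : circle r (real_complex R r).
  by rewrite /circle /= expr0n addr0 sqrtr_sqr ger0_norm// ltW.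
have m0 : 0 <= maxmod f r.
  apply: le_trans (normc_ge0 (f (real_complex R r))) _.
  by rewrite -[X in maxmod f X]rr; apply: maxmod_ge => //; exact: (eq_ind_r (fun x => x < 1) r1 rr).
have nv : `|(v r)^-1| = (v r)^-1 by rewrite ger0_norm// invr_ge0 ltW.
rewrite (ger0_norm m0) nv.
apply: maxmod_le => //; first exact: ltW.
by move=> z /hr; rewrite mulrC ler_pdivlMr.
Unshelve. all: by end_near. Qed.

Lemma H0_submod v : submod_closed (mem (H0_set v)).
Proof.
have [h0 hD] := @holomorphic_submod R.
split=> [|a f g].
  rewrite inE; apply/H0_setP; split; first by move: h0; rewrite inE.
  by move=> e e0; near=> r => z _; rewrite Normc.normc0 mulr0 ltW.
rewrite !inE => /H0_setP[hf fo] /H0_setP[hg go]; apply/H0_setP; split.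
  by have := hD a f g; rewrite !inE; apply.
move=> e e0.
have e1 : 0 < e / 2 / (normc a + 1).
  by rewrite !divr_gt0// ltr_wpDl// normc_ge0.
have e2 : 0 < e / 2 by rewrite divr_gt0.
near=> r => z zr.
have /andP[r0 r1] : 0 < r < 1 by near: r; exact: near_left1.
have vr : 0 < v r by apply: weight_gt0; rewrite (ltW r0).
have h1 : forall z, circle r z -> v r * normc (f z) <= e / 2 / (normc a + 1).
  by near: r; exact: fo.
have h2 : forall z, circle r z -> v r * normc (g z) <= e / 2.
  by near: r; exact: go.
have -> : (a *: f + g) z = a * f z + g z by [].
apply: (@le_trans _ _ (v r * (normc a * normc (f z) + normc (g z)))).
  rewrite ler_pM2l//; apply: le_trans (normcD _ _) _.
  by rewrite Normc.normcM.
rewrite mulrDr [leRHS]splitr lerD ?h2//.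
rewrite mulrCA; apply: (@le_trans _ _ (normc a * (e / 2 / (normc a + 1)))).
  by rewrite ler_wpM2l ?normc_ge0// h1.
have a1 : 0 < normc a + 1 by rewrite ltr_wpDl// normc_ge0.
rewrite mulrA ler_pdivrMr// mulrC ler_pM2l//.
by rewrite lerDl.
Unshelve. all: by end_near. Qed.

Lemma H0_bounded v f : H0_set v f ->
  has_ubound [set v (normc z) * normc (f z) | z in disc].
Proof.
move=> /H0_setP[hf /(_ 1 ltr01)].
rewrite near_withinE => /nbhs_ballP [d /= d0 hd].
have d1 : 1 - d < 1 by rewrite ltrBlDr ltrDl.
have [m mP] := holomorphic_bounded hf d1.
exists (Num.max 1 (v 0 * m)) => _ [z z1 <-]; rewrite le_max.
have [zd|zd] := leP (normc z) (1 - d).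
  apply/orP; right; have vz : 0 < v (normc z).
    by apply: weight_gt0; rewrite normc_ge0.
  have v0 : v (normc z) <= v 0 by apply: weight_decreasing; rewrite ?normc_ge0.
  by apply: ler_pM; rewrite ?normc_ge0 ?mP// ltW.
apply/orP; left; apply: (hd (normc z)) => //=.
by rewrite /ball /= ger0_norm ?subr_ge0 1?ltW// ltrBlDr addrC -ltrBlDr.
Qed.

Lemma wnorm_ge v f z : H0_set v f -> disc z ->
  v (normc z) * normc (f z) <= wnorm v f.
Proof.
by move=> /H0_bounded hb z1; apply: ub_le_sup => //; exists z.
Qed.

Lemma disc0 : disc (0 : C).
Proof. by rewrite /disc /= expr0n addr0 sqrtr0. Qed.

Lemma wnorm_le v f m : (forall z, disc z -> v (normc z) * normc (f z) <= m) ->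
  wnorm v f <= m.
Proof.
move=> h; apply: ge_sup; last by move=> _ [z z1 <-]; exact: h.
by exists (v (normc 0) * normc (f 0)), 0 => //; exact: disc0.
Qed.

End WeightedSpace.

Section H0_space.
Context {R : realType} (v : weight R).
Local Notation C := (Cplx R).

Definition H0_pred : {pred C -> C} := mem (H0_set v).
HB.instance Definition _ :=
  GRing.isSubmodClosed.Build C (C -> C) H0_pred (H0_submod v).

Definition H0 : Type := {f : C -> C | f \in H0_pred}.
HB.instance Definition _ := SubType.copy H0 {f : C -> C | f \in H0_pred}.
HB.instance Definition _ := [Choice of H0 by <:].
HB.instance Definition _ := [SubChoice_isSubLmodule of H0 by <:].

Lemma H0P (f : H0) : H0_set v (val f).
Proof. by have := valP f; rewrite inE. Qed.

Definition H0_norm (f : H0) : C := real_complex R (wnorm v (val f)).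

Fact H0_normD (f g : H0) : H0_norm (f + g) <= H0_norm f + H0_norm g.
Proof.
rewrite /H0_norm -[leRHS]raddfD lecE_real; apply: wnorm_le => z z1.
have vz : 0 < v (normc z) by apply: weight_gt0; rewrite normc_ge0.
have -> : val (f + g) z = val f z + val g z by [].
apply: le_trans (lerD (wnorm_ge (H0P f) z1) (wnorm_ge (H0P g) z1)).
by rewrite -mulrDr ler_pM2l// normcD.
Qed.

Fact H0_normZ (a : C) (f : H0) : H0_norm (a *: f) = `|a| * H0_norm f.
Proof.
have le1 (b : C) (g : H0) : wnorm v (val (b *: g)) <= normc b * wnorm v (val g).
  apply: wnorm_le => z z1.
  have -> : val (b *: g) z = b * val g z by [].
  by rewrite Normc.normcM mulrCA ler_wpM2l ?normc_ge0// wnorm_ge//; exact: H0P.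
have ge0 (g : H0) : 0 <= wnorm v (val g).
  apply: le_trans (wnorm_ge (H0P g) (disc0 (R := R))).
  by rewrite mulr_ge0 ?normc_ge0// ltW// weight_gt0// normc_ge0 disc0.
rewrite /H0_norm normCE -rmorphM; congr (real_complex R _).
apply/eqP; rewrite eq_le le1 andTb; have [->|a0] := eqVneq a 0.
  by rewrite Normc.normc0 mul0r; exact: ge0.
have na0 : 0 < normc a.
  rewrite lt_neqAle normc_ge0 andbT eq_sym.
  by apply: contra a0 => /eqP/Normc.eq0_normc ->.
rewrite -ler_pdivlMl// -Normc.normcV.
by have := le1 a^-1 (a *: f); rewrite scalerA mulVf// scale1r.
Qed.

Fact H0_norm_eq0 (f : H0) : H0_norm f = 0 -> f = 0.
Proof.
move=> /complexI f0; apply/val_inj/funext => z.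
have [z1|z1] := pselect (disc z); last by rewrite (H0P f).1.2.
have vz : 0 < v (normc z) by apply: weight_gt0; rewrite normc_ge0.
have := wnorm_ge (H0P f) z1; rewrite f0 pmulr_rle0// => h.
by apply: Normc.eq0_normc; apply/eqP; rewrite eq_le h normc_ge0.
Qed.

HB.instance Definition _ :=
  Lmodule_isNormed.Build C H0 H0_normD H0_normZ H0_norm_eq0.

End H0_space.

Definition increasing_weights (R : realType) (a : nat -> weight R) : Prop :=
  forall n r, 0 <= r < 1 -> a n r <= a n.+1 r.

Definition decreasing_weights (R : realType) (v : nat -> weight R) : Prop :=
  forall n r, 0 <= r < 1 -> v n.+1 r <= v n r.

Section projective.
Context {R : realType} (a : nat -> weight R).
Local Notation C := (Cplx R).

Definition A0H_set : set (C -> C) := \bigcap_n H0_set (a n).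

Lemma A0H_submod : submod_closed (mem A0H_set).
Proof.
split=> [|c f g]; rewrite !inE.
  by move=> n _; have [+ _] := H0_submod (a n); rewrite inE.
move=> hf hg n _; have [_ /(_ c f g)] := H0_submod (a n).
by rewrite !inE; apply; [exact: hf | exact: hg].
Qed.

Definition A0H_pred : {pred C -> C} := mem A0H_set.
HB.instance Definition _ :=
  GRing.isSubmodClosed.Build C (C -> C) A0H_pred A0H_submod.

Definition A0H : Type := {f : C -> C | f \in A0H_pred}.
HB.instance Definition _ := SubType.copy A0H {f : C -> C | f \in A0H_pred}.
HB.instance Definition _ := [Choice of A0H by <:].
HB.instance Definition _ := [SubChoice_isSubLmodule of A0H by <:].

Fact A0H_incl_subproof (f : A0H) n : val f \in H0_pred (a n).
Proof. by have := valP f; rewrite !inE => /(_ n I). Qed.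

Definition A0H_incl n (f : A0H) : H0 (a n) := Sub (val f) (A0H_incl_subproof f n).

HB.instance Definition _ := Topological.copy A0H
  (sup_topology (fun n => Topological.on (initial_topology (@A0H_incl n)))).

End projective.

(* The conditions of PreTopologicalLmod_isTvs, for a topology t on E that is not
   attached to E by a canonical structure. *)
Definition locally_convex_topology {R : realType} (E : lmodType (Cplx R))
    (t : Topological E) : Prop :=
  let Et : topologicalType := Topological.Pack t in
  [/\ continuous (fun x : Et * Et => ((x.1 : E) + (x.2 : E) : E) : Et),
      continuous (fun x : Cplx R * Et => (x.1 *: (x.2 : E) : E) : Et) &
      exists2 B : set (set Et), (forall b, B b -> convex_set (b : set E)) & basis B].

Section inductive.
Context {R : realType} (v : nat -> weight R).
Local Notation C := (Cplx R).

Context (hv : decreasing_weights v).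

Definition V0H_set : set (C -> C) := \bigcup_n H0_set (v n).

Lemma H0_set_mono m n : (m <= n)%N -> H0_set (v m) `<=` H0_set (v n).
Proof.
move=> mn f /H0_setP[hf fo]; apply/H0_setP; split=> // e e0.
have vmn r : 0 <= r < 1 -> v n r <= v m r.
  move=> r01; elim: n mn => [|n IHn]; first by rewrite leqn0 => /eqP ->.
  rewrite leq_eqVlt => /predU1P[-> //|]; rewrite ltnS => /IHn.
  exact/le_trans/hv.
near=> r => z zr.
have r01 : 0 < r < 1 by near: r; exact: near_left1.
have h : forall z, circle r z -> v m r * normc (f z) <= e.
  by near: r; exact: fo.
apply: le_trans (h z zr); rewrite ler_wpM2r ?normc_ge0// vmn//.
by case/andP: r01 => /ltW -> ->.
Unshelve. all: by end_near. Qed.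

Lemma V0H_submod : submod_closed (mem V0H_set).
Proof.
split=> [|c f g]; rewrite !inE.
  by exists 0%N => //; have [+ _] := H0_submod (v 0); rewrite inE.
move=> [m _ hf] [n _ hg]; exists (maxn m n) => //.
have [_ /(_ c f g)] := H0_submod (v (maxn m n)); rewrite !inE; apply.
  exact: H0_set_mono (leq_maxl m n) _ hf.
exact: H0_set_mono (leq_maxr m n) _ hg.
Qed.

Definition V0H_pred of decreasing_weights v : {pred C -> C} := mem V0H_set.
HB.instance Definition _ :=
  GRing.isSubmodClosed.Build C (C -> C) (V0H_pred hv) V0H_submod.

Definition V0H : Type := {f : C -> C | f \in V0H_pred hv}.
HB.instance Definition _ := SubType.copy V0H {f : C -> C | f \in V0H_pred hv}.
HB.instance Definition _ := [Choice of V0H by <:].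
HB.instance Definition _ := [SubChoice_isSubLmodule of V0H by <:].

Fact V0H_incl_subproof n (f : H0 (v n)) : val f \in V0H_pred hv.
Proof. by rewrite inE; exists n => //; exact: H0P. Qed.

Definition V0H_incl n (f : H0 (v n)) : V0H := Sub (val f) (V0H_incl_subproof f).

(* V0H carries the supremum of all locally convex topologies making every
   inclusion continuous. V0H_topology_admissible and V0H_open below show that
   this supremum is itself such a topology, hence the finest one. *)
Definition V0H_admissible (t : Topological V0H) : Prop :=
  locally_convex_topology t /\
  forall n, continuous (@V0H_incl n : H0 (v n) -> Topological.Pack t).

Definition V0H_subbase : set (set V0H) :=
  [set U : set V0H | exists2 t, V0H_admissible t & @open (Topological.Pack t) U].

HB.instance Definition _ := isSubBaseTopological.Build V0H V0H_subbase id.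

Local Notation TV t := (@Topological.Pack V0H t).

Lemma V0H_open t (U : set V0H) :
  V0H_admissible t -> @open (TV t) U -> open (U : set V0H).
Proof.
move=> ht Ut; exists [set U]; last by rewrite bigcup_set1.
move=> _ ->; exists [fset U]%fset; last by rewrite set_fset1 bigcap_set1.
by move=> W; rewrite !inE => /eqP WU; exists t => //; rewrite (eqP WU).
Qed.

Lemma V0H_cvgP (F : set_system V0H) (x : V0H) : Filter F ->
  (forall t, V0H_admissible t -> F --> (x : TV t)) -> F --> x.
Proof.
move=> FF h A; rewrite nbhsE => -[_ [[B sB <-] [C0 BC Cx] sUBA]].
apply: filterS sUBA _; apply: (@filterS _ _ _ C0) => [y Cy|]; first by exists C0.
have /sB [D sD IDeC] := BC; rewrite -IDeC; apply: filter_bigI => E DE.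
have := sD _ DE; rewrite inE => -[t ht Et].
apply: (h t ht); apply: open_nbhs_nbhs; split=> //.
by move: Cx; rewrite -IDeC => /(_ _ DE).
Qed.

Lemma V0H_id_continuous t : V0H_admissible t ->
  continuous (id : V0H -> TV t).
Proof.
move=> ht x A; rewrite nbhsE => -[U [Uo Ux] UA] /=.
apply: (@filterS _ (nbhs (x : V0H)) _ U A UA).
by apply: open_nbhs_nbhs; split=> //; exact: V0H_open Uo.
Qed.

Lemma V0H_topology_admissible : V0H_admissible (Topological.on V0H).
Proof.
split; last first.
  move=> n f; apply: (@V0H_cvgP (@V0H_incl n @ f)) => [|t ht].
    exact: (@fmap_filter _ _ _ _ (nbhs_filter f)).
  exact: (ht.2 n f).
split.
- move=> x; apply: V0H_cvgP => t ht.
  have [+ _ _] := ht.1 => /(_ x).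
  apply: cvg_trans => A [[A1 A2] [h1 h2] hA].
  exists (A1, A2) => //; split; exact: V0H_id_continuous.
- move=> x; apply: V0H_cvgP => t ht.
  have [_ + _] := ht.1 => /(_ x).
  apply: cvg_trans => A [[A1 A2] [h1 h2] hA].
  exists (A1, A2) => //; split=> //; exact: V0H_id_continuous.
exists [set b | open b /\ convex_set (b : set (V0H : lmodType C))].
  by move=> b [].
split=> [b []//|x].
pose G := filter_from
  [set U : set V0H | (open U /\ convex_set (U : set (V0H : lmodType C))) /\ U x] id.
have FG : Filter G.
  apply: filter_from_filter.
    by exists setT; split=> //; split; [exact: openT | move=> *; rewrite inE].
  move=> U W [[Uo Uc] Ux] [[Wo Wc] Wx]; exists (U `&` W) => //.
  split=> //; split; first exact: openI.
  move=> y z l /set_mem[Uy Wy] /set_mem[Uz Wz]; apply/mem_set; split.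
    by apply/set_mem/Uc; exact: mem_set.
  by apply/set_mem/Wc; exact: mem_set.
apply: (V0H_cvgP FG) => t ht A At.
have [_ _ [B Bc [Bo /(_ x)/(_ A At)]]] := ht.1.
move=> [b [Bb bx] bA]; exists b => //; split=> //; split; last exact: Bc.
by apply: V0H_open ht _; exact: Bo.
Qed.

End inductive.

Definition proper_subspace (R : realType) (E : lmodType (Cplx R)) (M : set E) :=
  [/\ submod_closed (mem M), M <> [set 0] & M <> setT].

Definition invariant_subset (T : Type) (J : T -> T) (M : set T) := J @` M `<=` M.

(* Main.v *)
Require Import Defs.
From HB Require Import structures.
From mathcomp Require Import all_boot all_order all_algebra.
From mathcomp Require Import all_classical all_reals all_analysis.
From mathcomp Require Import complex.
From mathcomp Require Import ring lra zify.
Import Order.TTheory GRing.Theory Num.Theory numFieldNormedType.Exports.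
Local Open Scope classical_set_scope.
Local Open Scope ring_scope.
Set Implicit Arguments.
Unset Strict Implicit.
Unset Printing Implicit Defensive.

(* Every space in sight is a union or an intersection of spaces H = H^0_v, so it suffices to
   show for one weight that if f in H has a zero of order exactly K at 0, then the J^n f span a
   dense subspace of the functions in H with a zero of order at least K at 0; the order of an
   invariant subspace is then the least order occurring in it.

   Dilation and Runge approximation make the polynomials dense in H. Write a polynomial as P(J)1;
   then P(J)1 |-> P turns the Duhamel product into the product of polynomials. Splitting the
   convolution integral in the middle and integrating by parts, one finds that
   nu(P) = |P(J) J^K 1|_v satisfies nu(PQ) <= c nu(P) nu(Q). Up to a factor f is close to
   (1 - A)(J) J^K 1 with A(0) = 0. For a fixed such A the factorials in J^n 1 = z^n / n! force
   nu(A^n) to decay faster than geometrically, and this survives, uniformly, as geometric decay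
   under small perturbations of A. Hence the Neumann series of (1 - A)^-1 gives polynomials P
   for which P(J) f approaches any prescribed polynomial with a zero of order K. *)

(** The delicate point is the order of choices in the Neumann series. P(J) magnifies an error in f
    by the sum of the moduli of the coefficients of P, which nu does not control. So A0 first fixes
    the decay constant; an approximant A near A0 then yields P, with nu(P) bounded independently of
    A; a finer A', chosen after P, finally absorbs the magnification. The uniformity of the decay
    near A0 exists for this purpose.

    The factor J^K serves more than the order of f: P(J) J^K 1 vanishes to order K at 0, which
    removes from the integration by parts the boundary terms containing derivatives at z of the
    other factor, derivatives that the weighted norm cannot bound near the unit circle.

    The complex analysis avoids contour integrals over circles. Goursat's theorem for triangles
    gives a primitive along segments; the primitive is interpolated by polynomials at multiples of
    roots of unity; and Cauchy's estimates, proved for polynomials by averaging over roots of unity,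
    carry derivatives to locally uniform limits. *)

(** * Real integrals over the unit interval: bounds, reversal, halving *)

Section RealIntegral.
Context {R : realType}.
Local Notation mu := (@lebesgue_measure R).

Definition cts_on (a b : R) (g : R -> R) :=
  forall t, a <= t <= b -> {for t, continuous g}.

Lemma cts_on_within a b g : cts_on a b g -> {within `[a, b]%classic, continuous g}.
Proof. by move=> h; apply: continuous_in_subspaceT => t; rewrite inE/= in_itv; exact: h. Qed.

Lemma cts_on_integrable a b (g : R -> R) : cts_on a b g ->
  mu.-integrable `[a, b] (EFin \o g).
Proof.
move=> /cts_on_within cg.
by apply: continuous_compact_integrable => //; exact: segment_compact.
Qed.

Lemma Rintegral01_cst (c : R) : \int[mu]_(t in `[0, 1]) c = c.
Proof.
rewrite Rintegral_cst//= lebesgue_measure_itv/= lte_fin ltr01 -EFinB/=.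
by rewrite subr0 mulr1.
Qed.

Lemma Rintegral01_le (g : R -> R) m : cts_on 0 1 g ->
  (forall t, 0 <= t <= 1 -> g t <= m) -> \int[mu]_(t in `[0, 1]) g t <= m.
Proof.
move=> cg h; rewrite -[leRHS]Rintegral01_cst; apply: le_Rintegral => //=.
- exact: cts_on_integrable.
- by apply: (@cts_on_integrable _ _ (cst m)) => x _; exact: cvg_cst.
Qed.

Lemma Rintegral01_rev (g : R -> R) : cts_on 0 1 g ->
  \int[mu]_(t in `[0, 1]) g (1 - t) = \int[mu]_(t in `[0, 1]) g t.
Proof.
move=> /cts_on_within cg.
have := @Rintegration_by_substitution_onem R g 1; rewrite lexx ler01 => /(_ isT cg) ->.
rewrite unstable.onem1.
by apply: eq_Rintegral => t _.
Qed.

Lemma Rintegral_affine (g : R -> R) (a b : R) : 0 < a ->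
  cts_on b (a + b) g ->
  \int[mu]_(t in `[b, a + b]) g t = a * \int[mu]_(t in `[0, 1]) g (a * t + b).
Proof.
move=> a0 cg; pose F := fun x : R => a * x + b.
have dF (x : R) : is_derive x (1 : R) F a.
  have -> : F = (fun x => a * x + b) by [].
  by apply: is_derive_eq; rewrite addr0 ?scaler1 ?mulr1 /GRing.scale/= ?mulr1 ?mulr0 ?addr0.
have F'E : derive1 F = cst a by apply/funext => x; rewrite derive1E; apply: derive_val.
have cF : continuous F by move=> x; apply/differentiable_continuous/derivable1_diffP; case: (dF x).
have := @integration_by_substitution_increasing R F g 0 1.
rewrite F'E /F mulr0 add0r mulr1 => h.
have cga : cts_on 0 1 (fun t => g (a * t + b)).
  move=> x /andP[x0 x1]; apply: (@continuous_comp _ _ _ F g); first exact: cF.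
  apply: (cg (F x)); rewrite /F lerDr mulr_ge0 ?(ltW a0)//=.
  by rewrite lerD2r ler_piMr ?(ltW a0).
rewrite mulrC -RintegralZr//; last exact: cts_on_integrable.
congr fine; rewrite h//.
- by move=> x y _ _ xy; rewrite ltrD2r ltr_pM2l.
- by move=> x _; exact: cvg_cst.
- exact: is_cvg_cst.
- exact: is_cvg_cst.
- split=> [x _||]; first by case: (dF x).
    exact/cvg_at_right_filter/cF.
  exact/cvg_at_left_filter/cF.
- exact: cts_on_within.
Qed.

Lemma Rintegral01_split (g : R -> R) : cts_on 0 1 g ->
  \int[mu]_(t in `[0, 1]) g t =
  2^-1 * \int[mu]_(t in `[0, 1]) g (2^-1 * t) +
  2^-1 * \int[mu]_(t in `[0, 1]) g (2^-1 * t + 2^-1).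
Proof.
move=> cg; have h2 : 0 < 2^-1 :> R by [].
have h21 : 2^-1 <= 1 :> R by rewrite invf_le1// ler1n.
have e : 2^-1 + 2^-1 = 1 :> R by lra.
have := @Rintegral_affine g 2^-1 0 h2.
rewrite addr0; under [X in _ * X]eq_Rintegral do rewrite addr0.
move=> <-; last first.
  by move=> t /andP[t0 t1]; apply: cg; rewrite t0 (le_trans t1).
rewrite -Rintegral_affine//; last first.
  by rewrite e => t /andP[t0 t1]; apply: cg; rewrite t1 andbT (le_trans _ t0).
rewrite e addrC; have i01 := cts_on_integrable cg.
have := @Rintegral_itvB R g (BLeft 0) (BRight 1) 2^-1 i01.
rewrite !bnd_simp => /(_ (ltW h2) h21) h.
rewrite -Rintegral_itv_obnd_cbnd; last first.
  apply: integrableS i01 => //= t /=; rewrite !in_itv/= => /andP[t0 ->].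
  by rewrite andbT ltW// (lt_trans h2).
by rewrite -h subrK.
Qed.

End RealIntegral.

(** * Complex-valued integrals over the unit interval *)

Section ComplexIntegral.
Context {R : realType}.
Local Notation C := (Cplx R).
Local Notation rc := (real_complex R).
Local Notation Re := (@complex.Re R).
Local Notation Im := (@complex.Im R).

Lemma normc_Re (z : C) : `|Re z| <= normc z.
Proof.
case: z => a b /=; rewrite -sqrtr_sqr ler_wsqrtr// lerDl; exact: sqr_ge0.
Qed.

Lemma normc_Im (z : C) : `|Im z| <= normc z.
Proof.
case: z => a b /=; rewrite -sqrtr_sqr ler_wsqrtr// lerDr; exact: sqr_ge0.
Qed.

Lemma normc_real (x : R) : normc (rc x) = `|x|.
Proof. by rewrite /= expr0n addr0 sqrtr_sqr. Qed.

Lemma normc_real_ge0 (x : R) : 0 <= x -> normc (rc x) = x.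
Proof. by move=> x0; rewrite normc_real ger0_norm. Qed.

Lemma normc_gt0 (z : C) : (0 < normc z) = (z != 0).
Proof.
rewrite lt_neqAle normc_ge0 andbT eq_sym; congr negb.
by apply/eqP/eqP => [/Normc.eq0_normc//|->]; rewrite Normc.normc0.
Qed.

Lemma normcX (z : C) n : normc (z ^+ n) = normc z ^+ n.
Proof. by elim: n => [|n IH]; rewrite ?expr0 ?Normc.normc1// !exprS Normc.normcM IH. Qed.

Lemma normc_sum (I : Type) (s : seq I) (P : pred I) (F : I -> C) :
  normc (\sum_(i <- s | P i) F i) <= \sum_(i <- s | P i) normc (F i).
Proof.
elim/big_ind2: _ => [|x1 x2 y1 y2 h1 h2|//]; first by rewrite Normc.normc0.
by apply: le_trans (normcD _ _) _; exact: lerD.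
Qed.

Lemma normc_unit_Re (z : C) : exists2 u : C, normc u = 1 & normc z = Re (u * z).
Proof.
have [->|z0] := eqVneq z 0; first by exists 1; rewrite ?Normc.normc1 ?mulr0 ?Normc.normc0.
have nz : normc z != 0 by rewrite gt_eqF// normc_gt0.
exists (rc (normc z) / z).
  by rewrite Normc.normcM Normc.normcV normc_real_ge0 ?normc_ge0// mulfV.
by rewrite mulfVK.
Qed.

(** Here [s] ranges over all of R, not only over the unit interval: this is two-sided continuity at
    each point of the interval, as in [cts_on]. *)
Definition ccts (g : R -> C) := forall t, 0 <= t <= 1 ->
  forall e, 0 < e -> exists2 d, 0 < d & forall s, `|s - t| < d -> normc (g s - g t) < e.

Lemma ccts_Re g : ccts g -> cts_on 0 1 (fun t => Re (g t)).
Proof.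
move=> h t t01; apply/cvgrPdist_lt => e e0.
have [d d0 hd] := h t t01 e e0; near=> s.
rewrite distrC; have -> : Re (g s) - Re (g t) = Re (g s - g t).
  by case: (g s) (g t) => a b [].
apply: le_lt_trans (normc_Re _) (hd _ _).
rewrite distrC; near: s; exact: (cvgr_dist_lt (FF := nbhs_filter t) id t).
Unshelve. all: by end_near. Qed.

Lemma ccts_Im g : ccts g -> cts_on 0 1 (fun t => Im (g t)).
Proof.
move=> h t t01; apply/cvgrPdist_lt => e e0.
have [d d0 hd] := h t t01 e e0; near=> s.
rewrite distrC; have -> : Im (g s) - Im (g t) = Im (g s - g t).
  by case: (g s) (g t) => a b [].
apply: le_lt_trans (normc_Im _) (hd _ _).
rewrite distrC; near: s; exact: (cvgr_dist_lt (FF := nbhs_filter t) id t).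
Unshelve. all: by end_near. Qed.

Lemma ccts_cst c : ccts (fun=> c).
Proof. by move=> t _ e e0; exists 1 => // s _; rewrite subrr Normc.normc0. Qed.

Lemma ccts_real : ccts rc.
Proof. by move=> t _ e e0; exists e => // s; rewrite -rmorphB normc_real. Qed.

Lemma cctsD f g : ccts f -> ccts g -> ccts (fun t => f t + g t).
Proof.
move=> hf hg t t01 e e0; have e2 : 0 < e / 2 by rewrite divr_gt0.
have [d d0 hd] := hf t t01 _ e2; have [d' d'0 hd'] := hg t t01 _ e2.
exists (Num.min d d'); first by rewrite lt_min d0.
move=> s; rewrite lt_min => /andP[h1 h2].
rewrite opprD addrACA (splitr e); apply: le_lt_trans (normcD _ _) _.
by rewrite ltrD ?hd ?hd'.
Qed.

Lemma cctsZ c f : ccts f -> ccts (fun t => c * f t).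
Proof.
move=> hf t t01 e e0; have c0 := normc_ge0 c.
have e2 : 0 < e / (normc c + 1) by rewrite divr_gt0// ltr_wpDl.
have [d d0 hd] := hf t t01 _ e2; exists d => // s /hd.
rewrite -mulrBr Normc.normcM ltr_pdivlMr ?ltr_wpDl// => h.
apply: le_lt_trans h; rewrite mulrC ler_wpM2l ?normc_ge0// lerDl//.
Qed.

Lemma ccts_sum (I : Type) (s : seq I) (F : I -> R -> C) :
  (forall i, ccts (F i)) -> ccts (fun t => \sum_(i <- s) F i t).
Proof.
move=> h; elim: s => [|i s IH].
  by under eq_fun do rewrite big_nil; exact: ccts_cst.
under eq_fun do rewrite big_cons; exact: cctsD.
Qed.

Lemma cintegralD f g : ccts f -> ccts g ->
  cintegral (fun t => f t + g t) = cintegral f + cintegral g.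
Proof.
move=> hf hg; rewrite /cintegral; congr Complex.
  rewrite -RintegralD//; try exact/cts_on_integrable/ccts_Re.
  by apply: eq_Rintegral => t _; case: (f t) (g t) => a b [].
rewrite -RintegralD//; try exact/cts_on_integrable/ccts_Im.
by apply: eq_Rintegral => t _; case: (f t) (g t) => a b [].
Qed.

Lemma cintegralZ c f : ccts f -> cintegral (fun t => c * f t) = c * cintegral f.
Proof.
move=> hf; have iR := cts_on_integrable (ccts_Re hf).
have iI := cts_on_integrable (ccts_Im hf).
have iZ (h : R -> R) k : (@lebesgue_measure R).-integrable `[0, 1] (EFin \o h) ->
  (@lebesgue_measure R).-integrable `[0, 1] (EFin \o (fun t => k * h t)).
  move=> ih; have -> : (EFin \o (fun t => k * h t)) = (fun t => k%:E * (EFin \o h) t)%E.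
    by apply/funext => t; rewrite /= EFinM.
  exact: integrableZl.
case: c => a b; rewrite /cintegral; congr Complex.
- rewrite -RintegralZl// -RintegralZl// -RintegralB//; try exact: iZ.
  by apply: eq_Rintegral => t _; case: (f t).
- rewrite -RintegralZl// -RintegralZl// -RintegralD//; try exact: iZ.
  by apply: eq_Rintegral => t _; case: (f t).
Qed.

Lemma cintegral_cst c : cintegral (fun=> c : C) = c.
Proof. by case: c => a b; rewrite /cintegral/= !Rintegral01_cst. Qed.

Lemma eq_cintegral (f g : R -> C) : (forall t, 0 <= t <= 1 -> f t = g t) ->
  cintegral f = cintegral g.
Proof.
move=> h; rewrite /cintegral; congr Complex; apply: eq_Rintegral => t;
by rewrite inE/= in_itv/= => /h ->.
Qed.

Lemma cintegral_sum (I : Type) (s : seq I) (F : I -> R -> C) :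
  (forall i, ccts (F i)) ->
  cintegral (fun t => \sum_(i <- s) F i t) = \sum_(i <- s) cintegral (F i).
Proof.
move=> h; elim: s => [|i s IH].
  by rewrite big_nil; under eq_fun do rewrite big_nil; exact: cintegral_cst.
rewrite big_cons -IH -cintegralD//; last exact: ccts_sum.
by apply: eq_cintegral => t _; rewrite big_cons.
Qed.

(** Multiplying by a unit [u] turns the modulus of the integral into the real part of an integral,
    for which monotonicity of real integrals is available. *)
Lemma normc_cintegral_le f m : ccts f ->
  (forall t, 0 <= t <= 1 -> normc (f t) <= m) -> normc (cintegral f) <= m.
Proof.
move=> hf hm; have [u u1 ->] := normc_unit_Re (cintegral f).
rewrite -cintegralZ// /cintegral/=; apply: Rintegral01_le => [|t t01].
  exact/ccts_Re/cctsZ.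
apply: le_trans (ler_norm _) (le_trans (normc_Re _) _).
by rewrite Normc.normcM u1 mul1r hm.
Qed.

Lemma cintegral_rev f : ccts f -> cintegral (fun t => f (1 - t)) = cintegral f.
Proof.
move=> hf; rewrite /cintegral.
rewrite (Rintegral01_rev (ccts_Re hf)).
by rewrite (Rintegral01_rev (ccts_Im hf)).
Qed.

Lemma cintegral_split f : ccts f -> cintegral f =
  2^-1 * (cintegral (fun t => f (2^-1 * t)) + cintegral (fun t => f (2^-1 * t + 2^-1))).
Proof.
move=> hf; rewrite {1}/cintegral (Rintegral01_split (ccts_Re hf)).
rewrite (Rintegral01_split (ccts_Im hf)).
have -> : 2^-1 = rc 2^-1 :> C by rewrite fmorphV rmorph_nat.
rewrite /cintegral; set a := Rintegral _ _ _; set b := Rintegral _ _ _.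
set c := Rintegral _ _ _; set d := Rintegral _ _ _.
by rewrite -!mulrDr; apply/eqP; rewrite eq_complex/= !mul0r subr0 addr0 !eqxx.
Qed.

End ComplexIntegral.

(** * Explicit epsilon-delta form of complex differentiability *)

Section ComplexDerivative.
Context {R : realType}.
Local Notation C := (Cplx R).
Local Notation rc := (real_complex R).

Lemma Cplx_gt0P (e : C) : 0 < e -> exists2 e' : R, 0 < e' & e = rc e'.
Proof. by case: e => a b; rewrite ltcE /= => /andP[/eqP -> a0]; exists a. Qed.

Definition cts_at (f : C -> C) z := forall e, 0 < e ->
  exists2 d, 0 < d & forall w, normc (w - z) < d -> normc (f w - f z) < e.

(** The difference quotient is multiplied out, so that [w = z] needs no exception and estimates can
    be added directly. *)
Definition has_deriv (f : C -> C) z L := forall e, 0 < e ->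
  exists2 d, 0 < d & forall w, normc (w - z) < d ->
    normc (f w - f z - L * (w - z)) <= e * normc (w - z).

Lemma has_deriv_cts f z L : has_deriv f z L -> cts_at f z.
Proof.
move=> h e e0; have [d d0 hd] := h 1 ltr01.
have L0 : 0 < normc L + 1 by rewrite ltr_wpDl// normc_ge0.
exists (Num.min d (e / (normc L + 1))); first by rewrite lt_min d0 divr_gt0.
move=> w; rewrite lt_min ltr_pdivlMr// => /andP[/hd h1].
apply: le_lt_trans; rewrite -(subrK (L * (w - z)) (f w - f z)).
apply: le_trans (normcD _ _) _; rewrite [in normc (L * _)]Normc.normcM.
have -> : normc (w - z) * (normc L + 1) = 1 * normc (w - z) + normc L * normc (w - z) by ring.
by rewrite lerD2r.
Qed.

Lemma derivable_has_deriv (f : C -> C) z : derivable f z 1 -> has_deriv f z (derive1 f z).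
Proof.
move=> df e e0; have : (h^-1 *: (f (h + z) - f z)) @[h --> 0^'] --> derive1 f z.
  by rewrite derive1E /derive; move: df; rewrite /derivable => /cvg_ex[l hl];
     move: (hl) => /cvg_lim -> //; move: hl; under eq_fun do rewrite scaler1.
move/cvgrPdist_lt => /(_ (rc e)); rewrite (ltcE_real 0) => /(_ e0).
rewrite near_withinE => /nbhs_ballP[d' /= /Cplx_gt0P[d d0 ->] hd].
exists d => // w wd; have [->|wz] := eqVneq w z.
  by rewrite !subrr mulr0 subr0 Normc.normc0 mulr0.
have wz0 : w - z != 0 by rewrite subr_eq0.
have := hd (w - z); rewrite /ball/= sub0r normrN normCE ltcE_real wd => /(_ isT wz0).
rewrite subrK normCE ltcE_real normcB => h.
have -> : f w - f z - derive1 f z * (w - z) =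
   ((w - z)^-1 *: (f w - f z) - derive1 f z) * (w - z).
  by rewrite mulrBl /GRing.scale/= [_^-1 * _]mulrC mulfVK.
by rewrite Normc.normcM ler_wpM2r ?normc_ge0// ltW.
Qed.

Lemma has_deriv_derivable (f : C -> C) (z L : C) : has_deriv f z L ->
  derivable f z 1 /\ derive1 f z = L.
Proof.
move=> h; have hL : (h^-1 *: (f (h *: 1 + z) - f z)) @[h --> (0 : C)^'] --> L.
  apply/cvgrPdist_lt => _ /Cplx_gt0P[e e0 ->].
  have [d d0 hd] := h _ (divr_gt0 e0 (ltr0n _ 2)).
  rewrite near_withinE; apply/nbhs_ballP; exists (rc d) => /=; first by rewrite (ltcE_real 0).
  move=> k; rewrite /ball/= sub0r normrN normCE ltcE_real => kd k0.
  have := hd (k + z); rewrite addrK => /(_ kd) hk.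
  rewrite scaler1 normCE ltcE_real normcB.
  have -> : k^-1 *: (f (k + z) - f z) - L = (f (k + z) - f z - L * k) * k^-1.
    by rewrite [RHS]mulrBl mulfK// /GRing.scale/= mulrC.
  have k1 : 0 < normc k by rewrite normc_gt0.
  rewrite Normc.normcM Normc.normcV ltr_pdivrMr//; apply: le_lt_trans hk _.
  by rewrite ltr_pM2r// ltr_pdivrMr// ltr_pMr// ltr1n.
split; first by apply/cvg_ex; exists L.
by rewrite derive1E; apply: cvg_lim.
Qed.

End ComplexDerivative.

(** * Limits of sequences with geometrically small increments *)

Section GeometricLimits.
Context {R : realType}.
Local Notation C := (Cplx R).

(** The intervals centred at [u n] of radius 2K/2^n, the sum of all later increments, are nested;
    the supremum of their left ends lies in each of them. *)
Lemma geometric_limit_real (u : nat -> R) K : 0 <= K ->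
  (forall n, `|u n.+1 - u n| <= K / 2 ^+ n) ->
  exists p, forall n, `|p - u n| <= 2 * K / 2 ^+ n.
Proof.
move=> K0 hu; pose r n : R := 2 * K / 2 ^+ n.
have r0 n : 0 <= r n by rewrite /r !mulr_ge0// invr_ge0 exprn_ge0.
have rS n : r n = 2 * r n.+1 by rewrite /r exprS invfM; field; rewrite expf_neq0.
have KE n : K / 2 ^+ n = r n.+1 by rewrite /r exprS invfM; field; rewrite expf_neq0.
have inc m n : (m <= n)%N -> u m - r m <= u n - r n /\ u n + r n <= u m + r m.
  elim: n => [|n IH]; first by rewrite leqn0 => /eqP ->.
  rewrite leq_eqVlt => /predU1P[->//|]; rewrite ltnS => /IH[h1 h2].
  have := hu n; rewrite KE ler_norml => /andP[h3 h4]; have := rS n.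
  by split; lra.
have bd m n : u m - r m <= u n + r n.
  have /inc[h1 _] := leq_maxl m n; have /inc[_ h2] := leq_maxr m n.
  by have := r0 (maxn m n); lra.
have hs : has_sup (range (fun n => u n - r n)).
  by split; [exists (u 0%N - r 0%N), 0%N | exists (u 0%N + r 0%N) => _ [n _ <-]].
exists (sup (range (fun n => u n - r n))) => n; rewrite -/(r n) ler_norml.
apply/andP; split.
  rewrite lerBrDr addrC; apply: (ub_le_sup hs.2); by exists n.
rewrite lerBlDr addrC; apply: ge_sup; first exact: hs.1.
by move=> _ [m _ <-].
Qed.

Lemma geometric_limit (u : nat -> C) K : 0 <= K ->
  (forall n, normc (u n.+1 - u n) <= K / 2 ^+ n) ->
  exists p, forall n, normc (p - u n) <= 4 * K / 2 ^+ n.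
Proof.
move=> K0 hu.
have [a ha] : exists p, forall n, `|p - complex.Re (u n)| <= 2 * K / 2 ^+ n.
  apply: geometric_limit_real => // n; apply: le_trans (hu n).
  by apply: le_trans (normc_Re _); case: (u n) (u n.+1) => ? ? [].
have [b hb] : exists p, forall n, `|p - complex.Im (u n)| <= 2 * K / 2 ^+ n.
  apply: geometric_limit_real => // n; apply: le_trans (hu n).
  by apply: le_trans (normc_Im _); case: (u n) (u n.+1) => ? ? [].
exists (Complex a b) => n; have := ha n; have := hb n.
have -> : 4 * K / 2 ^+ n = 2 * K / 2 ^+ n + 2 * K / 2 ^+ n.
  by field; rewrite expf_neq0.
case: (u n) => c d /= h1 h2.
by apply: le_trans (normc_leD _ _) _; exact: lerD.
Qed.

End GeometricLimits.

(** * Goursat's theorem and the primitive of a holomorphic function *)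

Section Goursat.
Context {R : realType}.
Local Notation C := (Cplx R).
Local Notation rc := (real_complex R).
Implicit Types (f : C -> C) (a b c z w : C).

Lemma cvx_normc a b (t r : R) : 0 <= t <= 1 -> normc a <= r -> normc b <= r ->
  normc (a + rc t * (b - a)) <= r.
Proof.
move=> /andP[t0 t1] ar br.
have -> : a + rc t * (b - a) = rc (1 - t) * a + rc t * b.
  by rewrite rmorphB rmorph1 /=; ring.
apply: le_trans (normcD _ _) _; rewrite !Normc.normcM !normc_real_ge0 ?subr_ge0//.
have -> : r = (1 - t) * r + t * r by ring.
by rewrite lerD// ler_wpM2l// subr_ge0.
Qed.

Lemma cvx_normcB a b p (t r : R) : 0 <= t <= 1 ->
  normc (a - p) <= r -> normc (b - p) <= r ->
  normc (a + rc t * (b - a) - p) <= r.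
Proof.
move=> t01 h1 h2; have := @cvx_normc (a - p) (b - p) t r t01 h1 h2.
by congr (normc _ <= _); ring.
Qed.

Lemma cvx_disc a b (t : R) : 0 <= t <= 1 -> disc a -> disc b ->
  disc (a + rc t * (b - a)).
Proof.
rewrite /disc/= => t01 a1 b1.
have : normc (a + rc t * (b - a)) <= Num.max (normc a) (normc b).
  by apply: cvx_normc => //; rewrite le_max lexx ?orbT.
by move/le_lt_trans; apply; rewrite gt_max a1.
Qed.

(** The path integral of [f] along the segment from [a] to [b]. *)
Definition seg f a b := (b - a) * cintegral (fun t => f (a + rc t * (b - a))).

Definition cts_disc f := forall z, disc z -> cts_at f z.

Lemma ccts_path f a b : (forall t, 0 <= t <= 1 -> cts_at f (a + rc t * (b - a))) ->
  ccts (fun t => f (a + rc t * (b - a))).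
Proof.
move=> h t t01 e e0; have [d d0 hd] := h t t01 e e0.
have n0 : 0 < normc (b - a) + 1 by rewrite ltr_wpDl// normc_ge0.
exists (d / (normc (b - a) + 1)); first by rewrite divr_gt0.
move=> s; rewrite ltr_pdivlMr// => hs; apply: hd; apply: le_lt_trans hs.
have -> : a + rc s * (b - a) - (a + rc t * (b - a)) = rc (s - t) * (b - a).
  by rewrite rmorphB; ring.
by rewrite Normc.normcM normc_real ler_wpM2l// lerDl.
Qed.

Lemma ccts_seg f a b : cts_disc f -> disc a -> disc b ->
  ccts (fun t => f (a + rc t * (b - a))).
Proof. by move=> cf a1 b1; apply: ccts_path => t t01; apply/cf/cvx_disc. Qed.

Lemma seg_rev f a b : cts_disc f -> disc a -> disc b -> seg f b a = - seg f a b.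
Proof.
move=> cf a1 b1; rewrite /seg -(cintegral_rev (ccts_seg cf a1 b1)) -mulNr opprB.
congr (_ * _); apply: eq_cintegral => t _; congr f.
by rewrite rmorphB rmorph1; ring.
Qed.

Definition mid a b := 2^-1 * (a + b).

Lemma rcM (x y : R) : rc (x * y) = rc x * rc y :> C. Proof. exact: rmorphM. Qed.

Lemma rcD (x y : R) : rc (x + y) = rc x + rc y :> C. Proof. exact: rmorphD. Qed.

Lemma rcB (x y : R) : rc (x - y) = rc x - rc y :> C. Proof. exact: rmorphB. Qed.

Lemma rc2V : rc 2^-1 = 2^-1 :> C. Proof. by rewrite fmorphV rmorph_nat. Qed.

Lemma midE a b : mid a b = a + rc 2^-1 * (b - a).
Proof. by rewrite rc2V /mid; field. Qed.

Lemma disc_mid a b : disc a -> disc b -> disc (mid a b).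
Proof. by move=> a1 b1; rewrite midE; apply: cvx_disc => //; apply/andP; split; lra. Qed.

Lemma normc_mid a b r : normc a <= r -> normc b <= r -> normc (mid a b) <= r.
Proof. by move=> a1 b1; rewrite midE; apply: cvx_normc => //; apply/andP; split; lra. Qed.

Lemma seg_mid f a b : cts_disc f -> disc a -> disc b ->
  seg f a b = seg f a (mid a b) + seg f (mid a b) b.
Proof.
move=> cf a1 b1; rewrite /seg (cintegral_split (ccts_seg cf a1 b1)).
have e1 : mid a b - a = 2^-1 * (b - a) by rewrite /mid; field.
have e2 : b - mid a b = 2^-1 * (b - a) by rewrite /mid; field.
rewrite e1 e2 -mulrDr mulrCA mulrA; congr (_ * (_ + _)).
  by apply: eq_cintegral => t _; congr f; rewrite rcM rc2V; ring.
by apply: eq_cintegral => t _; congr f; rewrite rcD rcM rc2V /mid; field.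
Qed.

(** The substitution of 1 - t for t shows that the integral I satisfies I = 1 - I. *)
Lemma cintegral_id : cintegral rc = 2^-1.
Proof.
have c1 := @ccts_real R; have := cintegral_rev c1.
have -> : cintegral (fun t => rc (1 - t)) = cintegral (fun t => 1 + (-1) * rc t).
  by apply: eq_cintegral => t _; rewrite rmorphB rmorph1 mulN1r.
rewrite cintegralD; [|exact: ccts_cst|exact: cctsZ].
rewrite cintegral_cst cintegralZ// => h.
have : 2 * cintegral rc = 1 by rewrite mulr_natl mulr2n -{1}h mulN1r subrK.
by move=> e; apply: (mulfI (x := 2)); rewrite ?pnatr_eq0// e mulfV// pnatr_eq0.
Qed.

Lemma seg_affine (u v a b : C) :
  seg (fun z => u + v * z) a b = u * (b - a) + v * (b ^+ 2 - a ^+ 2) / 2.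
Proof.
rewrite /seg; have c1 := @ccts_real R.
have -> : cintegral (fun t => u + v * (a + rc t * (b - a))) =
   cintegral (fun t => (u + v * a) + (v * (b - a)) * rc t).
  by apply: eq_cintegral => t _; ring.
rewrite cintegralD; [|exact: ccts_cst|exact: cctsZ].
by rewrite cintegral_cst cintegralZ// cintegral_id; field.
Qed.

Lemma seg_near_affine f (u v a b : C) e : cts_disc f -> disc a -> disc b ->
  (forall t, 0 <= t <= 1 ->
     normc (f (a + rc t * (b - a)) - (u + v * (a + rc t * (b - a)))) <= e) ->
  normc (seg f a b - seg (fun z => u + v * z) a b) <= normc (b - a) * e.
Proof.
move=> cf a1 b1 h; rewrite /seg -mulrBr Normc.normcM ler_wpM2l ?normc_ge0//.
have c1 := @ccts_real R.
have c2 : ccts (fun t => (-1) * (u + v * (a + rc t * (b - a)))).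
  apply: cctsZ; have -> : (fun t => u + v * (a + rc t * (b - a))) =
     (fun t => (u + v * a) + (v * (b - a)) * rc t) by apply/funext => t; ring.
  by apply: cctsD; [exact: ccts_cst|exact: cctsZ].
have -> : - cintegral (fun t => u + v * (a + rc t * (b - a))) =
   cintegral (fun t => (-1) * (u + v * (a + rc t * (b - a)))).
  rewrite [RHS]cintegralZ ?mulN1r//.
  have := cctsZ (-1) c2; congr ccts; apply/funext => t; ring.
rewrite -cintegralD//; last exact: ccts_seg.
apply: normc_cintegral_le => [|t t01]; first by apply: cctsD => //; exact: ccts_seg.
by rewrite mulN1r; exact: h.
Qed.

Definition tri f (T : C * C * C) :=
  seg f T.1.1 T.1.2 + seg f T.1.2 T.2 + seg f T.2 T.1.1.

Definition perim (T : C * C * C) : R :=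
  normc (T.1.2 - T.1.1) + normc (T.2 - T.1.2) + normc (T.1.1 - T.2).

Definition tri_in (r : R) (T : C * C * C) :=
  [/\ normc T.1.1 <= r, normc T.1.2 <= r & normc T.2 <= r].

(** The midpoints of the sides cut the triangle into four. Their inner sides cancel in pairs, so the
    four integrals add up to that over [T], and at least one of them has a quarter of its modulus.
    The bound on the displacement of the first vertex makes the iterated subdivision converge. *)
Lemma tri_step f r T : cts_disc f -> r < 1 -> tri_in r T ->
  exists T', [/\ tri_in r T', perim T' = perim T / 2,
    normc (T'.1.1 - T.1.1) <= perim T & normc (tri f T) / 4 <= normc (tri f T')].
Proof.
case: T => [[a b] c] cf r1 [/= ha hb hc].
have [a1 b1 c1] : [/\ disc a, disc b & disc c] by split; exact: le_lt_trans r1.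
have hab := normc_mid ha hb; have hbc := normc_mid hb hc; have hca := normc_mid hc ha.
have dab := disc_mid a1 b1; have dbc := disc_mid b1 c1; have dca := disc_mid c1 a1.
have E : tri f (a, b, c) = tri f (a, mid a b, mid c a) + tri f (b, mid b c, mid a b) +
   tri f (c, mid c a, mid b c) + tri f (mid a b, mid b c, mid c a).
  rewrite /tri/= (seg_mid cf a1 b1) (seg_mid cf b1 c1) (seg_mid cf c1 a1).
  rewrite (seg_rev cf dca dab) (seg_rev cf dab dbc) (seg_rev cf dbc dca); ring.
have half (x : C) : normc (2^-1 * x) = normc x / 2.
  by rewrite Normc.normcM -rc2V normc_real_ge0 ?invr_ge0// mulrC.
have n2 : 2 != 0 :> C by rewrite pnatr_eq0.
have na := normc_ge0 (b - a); have nb := normc_ge0 (c - b); have nc := normc_ge0 (a - c).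
have [h|h1] := leP (normc (tri f (a, b, c)) / 4) (normc (tri f (a, mid a b, mid c a))).
  exists (a, mid a b, mid c a); split=> //; rewrite /perim/=.
    rewrite (_ : mid a b - a = 2^-1 * (b - a)); last by rewrite /mid; field.
    rewrite (_ : mid c a - mid a b = 2^-1 * (c - b)); last by rewrite /mid; field.
    rewrite (_ : a - mid c a = 2^-1 * (a - c)); last by rewrite /mid; field.
    rewrite !half; lra.
  by rewrite subrr Normc.normc0 !addr_ge0.
have [h|h2] := leP (normc (tri f (a, b, c)) / 4) (normc (tri f (b, mid b c, mid a b))).
  exists (b, mid b c, mid a b); split=> //; rewrite /perim/=.
    rewrite (_ : mid b c - b = 2^-1 * (c - b)); last by rewrite /mid; field.
    rewrite (_ : mid a b - mid b c = 2^-1 * (a - c)); last by rewrite /mid; field.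
    rewrite (_ : b - mid a b = 2^-1 * (b - a)); last by rewrite /mid; field.
    rewrite !half; lra.
  by rewrite -addrA lerDl addr_ge0.
have [h|h3] := leP (normc (tri f (a, b, c)) / 4) (normc (tri f (c, mid c a, mid b c))).
  exists (c, mid c a, mid b c); split=> //; rewrite /perim/=.
    rewrite (_ : mid c a - c = 2^-1 * (a - c)); last by rewrite /mid; field.
    rewrite (_ : mid b c - mid c a = 2^-1 * (b - a)); last by rewrite /mid; field.
    rewrite (_ : c - mid b c = 2^-1 * (c - b)); last by rewrite /mid; field.
    rewrite !half; lra.
  by rewrite normcB lerDr addr_ge0.
have [h|h4] := leP (normc (tri f (a, b, c)) / 4) (normc (tri f (mid a b, mid b c, mid c a))).
  exists (mid a b, mid b c, mid c a); split=> //; rewrite /perim/=.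
    rewrite (_ : mid b c - mid a b = 2^-1 * (c - a)); last by rewrite /mid; field.
    rewrite (_ : mid c a - mid b c = 2^-1 * (a - b)); last by rewrite /mid; field.
    rewrite (_ : mid a b - mid c a = 2^-1 * (b - c)); last by rewrite /mid; field.
    rewrite !half (normcB c a) (normcB a b) (normcB b c); lra.
  by rewrite (_ : mid a b - a = 2^-1 * (b - a)); [rewrite half; lra|rewrite /mid; field].
(* All four pieces strictly below a quarter would contradict [E]. *)
have := normcD (tri f (a, mid a b, mid c a)) (tri f (b, mid b c, mid a b)).
have := normcD (tri f (a, mid a b, mid c a) + tri f (b, mid b c, mid a b))
               (tri f (c, mid c a, mid b c)).
have := normcD (tri f (a, mid a b, mid c a) + tri f (b, mid b c, mid a b) +
               tri f (c, mid c a, mid b c)) (tri f (mid a b, mid b c, mid c a)).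
by rewrite -E; lra.
Qed.

(** Iterated subdivision shrinks to a point [p]. Near [p] the function is affine up to an error of
    order e' times the diameter, and affine functions integrate to 0 over a triangle. *)
Lemma goursat f T r : (forall z, disc z -> exists L, has_deriv f z L) ->
  r < 1 -> tri_in r T -> tri f T = 0.
Proof.
move=> df r1 hT.
have cf : cts_disc f by move=> z /df[L]; exact: has_deriv_cts.
have /choice[nxt nxtP] T1 : exists T', tri_in r T1 -> [/\ tri_in r T', perim T' = perim T1 / 2,
    normc (T'.1.1 - T1.1.1) <= perim T1 & normc (tri f T1) / 4 <= normc (tri f T')].
  have [h|h] := pselect (tri_in r T1); last by exists T1.
  by have [T' h'] := tri_step cf r1 h; exists T'.
pose S n := iter n nxt T.
have Sin n : tri_in r (S n) by elim: n => //= n IH; case: (nxtP _ IH).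
have Sper n : perim (S n) = perim T / 2 ^+ n.
  elim: n => [|n IH]; first by rewrite expr0 divr1.
  by have [_ /= -> _ _] := nxtP _ (Sin n); rewrite -/(S n) IH exprS invfM mulrAC mulrA.
have Stri n : normc (tri f T) / 4 ^+ n <= normc (tri f (S n)).
  elim: n => [|n IH]; first by rewrite expr0 divr1.
  have [_ _ _] := nxtP _ (Sin n); apply: le_trans.
  by rewrite exprS invfM mulrA mulrAC ler_wpM2r ?invr_ge0.
have P0 : 0 <= perim T by rewrite /perim !addr_ge0// normc_ge0.
have [p hp] : exists p, forall n, normc (p - (S n).1.1) <= 4 * perim T / 2 ^+ n.
  apply: geometric_limit => // n.
  by have [_ _ + _] := nxtP _ (Sin n); rewrite -Sper.
have small e : 0 < e -> exists n, 5 * perim T / 2 ^+ n < e.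
  move=> e0; have := @cvg_geometric R (5 * perim T) 2^-1.
  rewrite ger0_norm ?invr_ge0// invf_lt1 ?ltr1n// => /(_ isT) /cvgrPdist_lt/(_ e e0).
  case=> n _ /(_ n (leqnn n)); rewrite sub0r normrN /geometric/= exprVn => h.
  by exists n; apply: le_lt_trans (ler_norm _) h.
have dp : disc p.
  have pr : normc p <= r.
    apply/ler_addgt0Pr => e e0; have [n hn] := small e e0.
    have [h1 _ _] := Sin n; rewrite -(subrK (S n).1.1 p) addrC.
    apply: le_trans (normcD _ _) (lerD h1 (le_trans (hp n) _)).
    apply: le_trans (ltW hn); rewrite ler_wpM2r ?invr_ge0 ?exprn_ge0//.
    by rewrite ler_wpM2r// ler_nat.
  exact: le_lt_trans r1.
have [L hL] := df p dp.
apply: Normc.eq0_normc; apply/eqP; rewrite eq_le normc_ge0 andbT.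
apply/ler_addgt0Pr => e e0; rewrite add0r.
(* The n-th triangle has perimeter q = perim T / 2^n and its vertices lie within 5q of [p]: the
   first within 4q, the others at most q further. Its integral is thus at most q e' 5q, and the
   factor 4^n lost in the subdivisions turns this into 5 e' (perim T)^2. *)
pose e' := e / (5 * perim T ^+ 2 + 1).
have D0 : 0 < 5 * perim T ^+ 2 + 1 by rewrite ltr_wpDl// mulr_ge0// sqr_ge0.
have e'0 : 0 < e' by rewrite divr_gt0.
have [d d0 hd] := hL _ e'0; have [n hn] := small _ d0.
have := Stri n; have := Sin n; have := Sper n; have := hp n.
case: (S n) => [[a b] c] /= ha hper [na nb nc] ht.
have [a1 b1 c1] : [/\ disc a, disc b & disc c] by split; exact: le_lt_trans r1.
set q := perim T / 2 ^+ n in hper.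
have q0 : 0 <= q by rewrite divr_ge0// exprn_ge0.
have q5 : 5 * q < d by rewrite /q mulrA.
have {}ha : normc (a - p) <= 4 * q by rewrite normcB /q mulrA.
have := hper; rewrite /perim/= => hper'.
have sab := normc_ge0 (b - a); have sbc := normc_ge0 (c - b); have sca := normc_ge0 (a - c).
have hb : normc (b - p) <= 5 * q.
  by have := normcD (b - a) (a - p); rewrite addrA subrK; lra.
have hc : normc (c - p) <= 5 * q.
  by have := normcD (c - a) (a - p); rewrite addrA subrK (normcB c a); lra.
have {}ha : normc (a - p) <= 5 * q by lra.
pose u := f p - L * p.
have key x y : disc x -> disc y -> normc (x - p) <= 5 * q -> normc (y - p) <= 5 * q ->
   normc (seg f x y - seg (fun z => u + L * z) x y) <= normc (y - x) * (e' * (5 * q)).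
  move=> x1 y1 hx hy; apply: seg_near_affine => // t t01; set z := x + _.
  have zp : normc (z - p) <= 5 * q by exact: cvx_normcB.
  have -> : f z - (u + L * z) = f z - f p - L * (z - p) by rewrite /u; ring.
  apply: le_trans (hd z (le_lt_trans zp q5)) _.
  by rewrite ler_wpM2l// ltW.
have A0 : tri (fun z => u + L * z) (a, b, c) = 0 by rewrite /tri/= !seg_affine; field.
have : normc (tri f (a, b, c)) <= q * (e' * (5 * q)).
  rewrite -[tri f _]subr0 -A0 /tri/=.
  have -> : seg f a b + seg f b c + seg f c a -
     (seg (fun z => u + L * z) a b + seg (fun z => u + L * z) b c + seg (fun z => u + L * z) c a)
    = (seg f a b - seg (fun z => u + L * z) a b) + (seg f b c - seg (fun z => u + L * z) b c)
      + (seg f c a - seg (fun z => u + L * z) c a) by ring.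
  rewrite -[X in X * (e' * _)]hper' 2!mulrDl; apply: le_trans (normcD _ _) _.
  apply: lerD; last exact: key.
  by apply: le_trans (normcD _ _) _; apply: lerD; apply: key.
move=> /(le_trans ht); rewrite ler_pdivrMr ?exprn_gt0//.
have -> : q * (e' * (5 * q)) * 4 ^+ n = 5 * perim T ^+ 2 * e'.
  have -> : 4 ^+ n = 2 ^+ n * 2 ^+ n :> R by rewrite -exprMn -natrM.
  rewrite /q; field.
  by rewrite expf_neq0.
move=> h; apply: le_trans h _; rewrite /e' mulrA ler_pdivrMr// mulrC ler_pM2l//.
by rewrite lerDl.
Qed.

(** Goursat's theorem on the triangle 0, z, w replaces the detour through 0 by the direct
    segment. *)
Lemma integration_seg f z w : (forall z, disc z -> exists L, has_deriv f z L) ->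
  disc z -> disc w -> integration f w - integration f z = seg f z w.
Proof.
move=> df z1 w1; have cf : cts_disc f by move=> x /df[L]; exact: has_deriv_cts.
have d0 := @disc0 R.
have E x : disc x -> integration f x = seg f 0 x.
  move=> x1; rewrite /integration x1 /seg subr0; congr (_ * _).
  by apply: eq_cintegral => t _; rewrite add0r.
have := @goursat f (0, z, w) (Num.max (normc z) (normc w)) df.
rewrite gt_max z1 w1 => /(_ isT); rewrite /tri_in/tri/=.
have -> : seg f w 0 = - seg f 0 w by exact: seg_rev.
rewrite !E// => h; apply/eqP; rewrite subr_eq addrC eq_sym -subr_eq0; apply/eqP/h.
by rewrite expr0n addr0 sqrtr0 !le_max normc_ge0 !lexx orbT.
Qed.

Lemma seg_near_cst f z w (v : C) e : cts_disc f -> disc z -> disc w ->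
  (forall t, 0 <= t <= 1 -> normc (f (z + rc t * (w - z)) - v) <= e) ->
  normc (seg f z w - v * (w - z)) <= normc (w - z) * e.
Proof.
move=> cf z1 w1 h; have := @seg_near_affine f v 0 z w e cf z1 w1.
rewrite seg_affine !mul0r addr0; apply => t t01.
by rewrite mul0r addr0; exact: h.
Qed.

Lemma integration_has_deriv f z : (forall z, disc z -> exists L, has_deriv f z L) ->
  disc z -> has_deriv (integration f) z (f z).
Proof.
move=> df z1 e e0; have cf : cts_disc f by move=> x /df[L]; exact: has_deriv_cts.
have [d d0 hd] := cf z z1 e e0.
exists (Num.min d (1 - normc z)); first by rewrite lt_min d0 subr_gt0.
move=> w; rewrite lt_min => /andP[wd wz].
have w1 : disc w.
  rewrite /disc/= -(subrK z w); apply: le_lt_trans (normcD _ _) _.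
  by rewrite -ltrBrDr.
rewrite integration_seg// mulrC [e * _]mulrC mulrC; apply: seg_near_cst => // t t01.
apply/ltW/hd; apply: le_lt_trans wd; apply: cvx_normcB => //.
by rewrite subrr Normc.normc0 normc_ge0.
Qed.

End Goursat.

(** * Roots of unity close to 1, and uniform continuity on closed discs *)

Section RootsOfUnity.
Context {R : realType}.
Local Notation C := (Cplx R).
Local Notation rc := (real_complex R).
Implicit Types (f : C -> C) (z w : C).

Lemma normc_sq z : normc z ^+ 2 = complex.Re z ^+ 2 + complex.Im z ^+ 2.
Proof. by case: z => a b /=; rewrite sqr_sqrtr// addr_ge0// sqr_ge0. Qed.

(** Of the two square roots of [w], take the one [s] with nonnegative real part. Then |s + 1|^2 is
    at least 2, and |s - 1| |s + 1| = |w - 1|, so |s - 1|^2 is at most half of |w - 1|^2. *)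
Lemma small_root_step m w : w ^+ (2 ^ m) = -1 -> normc (w - 1) ^+ 2 <= 4 / 2 ^+ m ->
  exists2 s : C, s ^+ (2 ^ m.+1) = -1 & normc (s - 1) ^+ 2 <= 4 / 2 ^+ m.+1.
Proof.
move=> wm w1; have [s s2 Res] : exists2 s : C, s ^+ 2 = w & 0 <= complex.Re s.
  have [h|h] := leP 0 (complex.Re (sqrtC w)); first by exists (sqrtC w); rewrite ?sqrtCK.
  exists (- sqrtC w); first by rewrite sqrrN sqrtCK.
  by case: (sqrtC w) h => a b /=; rewrite oppr_ge0; exact: ltW.
have sm : s ^+ (2 ^ m.+1) = -1 by rewrite expnS exprM s2.
exists s => //.
have ns : normc s = 1.
  have : normc s ^+ (2 ^ m.+1) = 1 by rewrite -normcX sm normcN Normc.normc1.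
  by move/eqP; rewrite pexpr_eq1 ?normc_ge0 ?expn_gt0// => /eqP.
have h1 : 2 <= normc (s + 1) ^+ 2.
  have := normc_sq s; rewrite ns normc_sq; case: (s) Res => a b /= a0.
  by rewrite addr0 !expr2; nra.
have h2 : normc (s - 1) ^+ 2 * normc (s + 1) ^+ 2 = normc (w - 1) ^+ 2.
  by rewrite -exprMn -Normc.normcM -s2; congr (normc _ ^+ 2); ring.
have h3 : normc (s - 1) ^+ 2 * 2 <= 4 / 2 ^+ m.
  by apply: le_trans w1; rewrite -h2 ler_wpM2l ?sqr_ge0.
have -> : 4 / 2 ^+ m.+1 = 4 / 2 ^+ m / 2 :> R by rewrite exprS invfM; ring.
by rewrite ler_pdivlMr.
Qed.

(** Starting from -1, repeated square roots stay on the unit circle and tend to 1; no exponential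
    function is involved. Large order is needed to recover coefficients, closeness to 1 to have fine
    Riemann sums. *)
Lemma small_root n e : 0 < e ->
  exists N (w : C), [/\ (n.+1 < N)%N, N.-primitive_root w, normc w = 1 & normc (w - 1) <= e].
Proof.
move=> e0; have H m : exists2 w : C, w ^+ (2 ^ m) = -1 & normc (w - 1) ^+ 2 <= 4 / 2 ^+ m.
  elim: m => [|m [w h1 h2]]; last exact: small_root_step h1 h2.
  exists (-1); rewrite ?expr1// -opprD normcN expr0 divr1.
  by rewrite -[1 + 1]/(2%:R : C) -(rmorph_nat rc) normc_real_ge0// -natrX.
have [m nm hm] : exists2 m, (n <= m)%N & 4 / 2 ^+ m <= e ^+ 2.
  have := @cvg_geometric R 4 2^-1.
  rewrite ger0_norm ?invr_ge0// invf_lt1 ?ltr1n// => /(_ isT) /cvgrPdist_lt.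
  move=> /(_ (e ^+ 2) (exprn_gt0 _ e0)).
  case=> k _ /(_ (maxn n k) (leq_maxr n k)); rewrite sub0r normrN /geometric/= exprVn => h.
  exists (maxn n k); rewrite ?leq_maxl//; apply: ltW; apply: le_lt_trans (ler_norm _) h.
have [w wm w1] := H m.
have wN : w ^+ (2 ^ m.+1) = 1 by rewrite expnS mulnC exprM wm sqrrN expr1n.
exists (2 ^ m.+1)%N, w; split.
- by rewrite (leq_ltn_trans _ (ltn_expl m.+1 (ltnSn 1))).
(* The order of [w] divides 2^(m+1); a smaller power of 2 would give w^(2^m) = 1 instead of -1. *)
- have [k pk] := prim_order_exists (expn_gt0 2 m.+1 : (0 < 2 ^ m.+1)%N) wN.
  move=> /(dvdn_pfactor _ _ (isT : prime 2))[j jm kj]; move: jm; rewrite leq_eqVlt => /predU1P[jE|].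
    by rewrite -jE -kj.
  rewrite ltnS => jm; have : w ^+ (2 ^ m) == 1.
    by rewrite -(prim_order_dvd pk) kj dvdn_exp2l.
  by rewrite wm eq_sym -addr_eq0 -[1 + 1]/(2%:R : C) pnatr_eq0.
- have : normc w ^+ (2 ^ m.+1) = 1 by rewrite -normcX wN Normc.normc1.
  by move/eqP; rewrite pexpr_eq1 ?normc_ge0 ?expn_gt0// => /eqP.
- by rewrite -(@ler_pXn2r _ 2) ?nnegrE ?normc_ge0 ?(ltW e0)// (le_trans w1).
Qed.

Lemma prim_root_sum N w j : N.-primitive_root w ->
  \sum_(k < N) (w ^+ k) ^+ j = if (N %| j)%N then N%:R else 0 :> C.
Proof.
move=> pw; have -> : \sum_(k < N) (w ^+ k) ^+ j = \sum_(k < N) (w ^+ j) ^+ k.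
  by apply: eq_bigr => k _; rewrite exprAC.
rewrite (prim_order_dvd pw); case: eqP => [->|/eqP wj].
  by under eq_bigr do rewrite expr1n; rewrite sumr_const card_ord.
have : (w ^+ j - 1) * \sum_(k < N) (w ^+ j) ^+ k = 0.
  by rewrite -subrX1 exprAC (prim_expr_order pw) expr1n subrr.
by move/eqP; rewrite mulf_eq0 subr_eq0 (negPf wj) => /eqP.
Qed.

(** Compactness of the closed disc of radius [r]. The point [y] may leave that disc, as it does in
    the comparison of neighbouring values near its boundary. *)
Lemma uniformly_cts f r e : cts_disc f -> r < 1 -> 0 < e ->
  exists2 d, 0 < d & forall x y, normc x <= r -> normc (y - x) < d -> normc (f y - f x) <= e.
Proof.
move=> cf r1 e0; have /compact_near_coveringP/near_covering_withinP cov := @compact_cball R r.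
have := cov _ ((0 : R)^'+) (fun d x => forall y, normc (y - x) < d -> normc (f y - f x) <= e).
case.
  move=> x xr; have [d d0 hd] := cf x (le_lt_trans xr r1) _ (divr_gt0 e0 (ltr0n _ 2)).
  have d2 : 0 < d / 2 by rewrite divr_gt0.
  exists ([set x' : C | normc (x' - x) < d / 2], [set k : R | k < d / 2]) => /=.
    split; last exact: nbhs_right_lt.
    apply/nbhs_ballP; exists (rc (d / 2)) => /=; first by rewrite (ltcE_real 0).
    by move=> y; rewrite /ball/= normCE ltcE_real normcB.
  move=> [x' k] /= [hx' hk] _ y hy.
  have h1 : normc (f x' - f x) < e / 2 by apply: hd; lra.
  have h2 : normc (f y - f x) < e / 2.
    by apply: hd; have := normcD (y - x') (x' - x); rewrite addrA subrK; lra.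
  have := normcD (f y - f x) (f x - f x'); rewrite addrA subrK.
  by rewrite (normcB (f x) (f x')); lra.
move=> d /= d0 hd; exists (d / 2); first by rewrite divr_gt0.
move=> x y xr; have := hd (d / 2).
rewrite /ball/= sub0r normrN ger0_norm; last by rewrite ltW// divr_gt0.
have : d / 2 < d by rewrite ltr_pdivrMr// ltr_pMr// ltr1n.
by move=> dd /(_ dd); rewrite divr_gt0// => /(_ isT _ xr y).
Qed.

End RootsOfUnity.

(** * Runge approximation of a primitive by interpolation at roots of unity *)

Section Interpolation.
Context {R : realType}.
Local Notation C := (Cplx R).
Local Notation rc := (real_complex R).
Implicit Types (f : C -> C) (z w : C).

(* The polynomial interpolating F at the points r w^k, w a primitive N-th root of unity. *)
Definition interp (F : C -> C) (r : R) N w : {poly C} :=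
  \poly_(j < N) (N%:R^-1 * \sum_(k < N) F (rc r * w ^+ k) * (rc r * w ^+ k) ^- j).

Lemma prim_root_neq0 N w : N.-primitive_root w -> w != 0.
Proof.
move=> pw; apply/eqP => w0; have := prim_expr_order pw.
by rewrite w0 expr0n gtn_eqF ?(prim_order_gt0 pw)// => /eqP; rewrite eq_sym oner_eq0.
Qed.

Lemma prim_root_node_neq0 (r : R) N w k : 0 < r -> N.-primitive_root w ->
  rc r * w ^+ k != 0.
Proof.
move=> r0 pw; rewrite mulf_neq0//.
  by apply: contraTneq r0 => /(@complexI R) ->; rewrite ltxx.
by rewrite expf_neq0// (prim_root_neq0 pw).
Qed.

(** The kernels attached to the nodes sum to N, because all powers of index 0 < j < N cancel over
    the roots of unity. Hence interpolation reproduces constants and [F z] can be moved inside the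
    sum. *)
Lemma interp_subE F (r : R) N w z : 0 < r -> N.-primitive_root w ->
  (interp F r N w).[z] - F z =
  N%:R^-1 * \sum_(k < N) (\sum_(j < N) (z / (rc r * w ^+ k)) ^+ j) * (F (rc r * w ^+ k) - F z).
Proof.
move=> r0 pw; have N0 := prim_order_gt0 pw; have nN : N%:R != 0 :> C by rewrite pnatr_eq0 -lt0n.
have S1 : \sum_(k < N) \sum_(j < N) (z / (rc r * w ^+ k)) ^+ j = N%:R.
  rewrite exchange_big/= (bigD1 (Ordinal N0))//= [X in _ + X]big1 ?addr0.
    by rewrite (eq_bigr (fun=> 1)) ?sumr_const ?card_ord// => k _; exact: expr0.
  move=> j j0; have pV : N.-primitive_root w^-1.
    have wV : w^-1 ^+ N = 1 by rewrite exprVn (prim_expr_order pw) invr1.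
    have [k pk kd] := prim_order_exists N0 wV.
    suff : (N %| k)%N by move=> d; have /eqP <- : k == N by rewrite eqn_dvd kd.
    by rewrite (prim_order_dvd pw) -invr_eq1 -exprVn (prim_expr_order pk).
  transitivity (\sum_(k < N) (z / rc r) ^+ j * (w^-1 ^+ k) ^+ j).
    apply: eq_bigr => k _; rewrite -exprMn; congr (_ ^+ _).
    by rewrite invfM exprVn mulrA.
  rewrite -mulr_sumr (prim_root_sum j pV); case: ifP; rewrite ?mulr0//.
  rewrite gtnNdvd//; last by rewrite lt0n; apply: contra j0 => /eqP h; apply/eqP/val_inj.
rewrite horner_poly.
have -> : \sum_(k < N) (\sum_(j < N) (z / (rc r * w ^+ k)) ^+ j) * (F (rc r * w ^+ k) - F z) =
  \sum_(k < N) (\sum_(j < N) (z / (rc r * w ^+ k)) ^+ j) * F (rc r * w ^+ k) - N%:R * F z.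
  by rewrite -S1 mulr_suml -sumrB; apply: eq_bigr => k _; rewrite mulrBr.
rewrite mulrBr mulKf//; congr (_ - _).
under eq_bigr do rewrite -mulrA mulr_suml; rewrite -mulr_sumr; congr (_ * _).
rewrite exchange_big/=; apply: eq_bigr => k _; rewrite mulr_suml.
by apply: eq_bigr => j _; rewrite [(z / _) ^+ j]exprMn exprVn; ring.
Qed.

(* Shrinking the nodes towards z turns the sum into a Riemann sum of [f] over a
   closed polygon, which is almost 0 because [f] has a primitive. *)
Lemma node_sum_small f (r t d e : R) N w z :
  (forall z, disc z -> exists L, has_deriv f z L) ->
  0 < r -> r < 1 -> (1 < N)%N -> N.-primitive_root w -> normc w = 1 -> normc (w - 1) < d ->
  (forall x y, normc x <= r -> normc (y - x) < d -> normc (f y - f x) <= e) ->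
  normc z <= r -> 0 <= t <= 1 ->
  normc (\sum_(k < N) rc r * w ^+ k * f (z + rc t * (rc r * w ^+ k - z))) <= N%:R * e.
Proof.
move=> df r0 r1 N1 pw w1 wd hd zr t01.
have cf : cts_disc f by move=> x /df[L]; exact: has_deriv_cts.
have w10 : 0 < normc (w - 1).
  rewrite normc_gt0 subr_eq0; apply: contraTneq N1 => w1'; move: pw; rewrite w1' => pw.
  by rewrite -leqNgt; apply: dvdn_leq => //; rewrite (prim_order_dvd pw).
have e0 : 0 <= e.
  by have := hd 0 0; rewrite !subrr Normc.normc0 => h; apply: h; rewrite ?ltW// (lt_trans w10).
(* At t = 0 all shrunken nodes collapse to [z] and the sum is a multiple of the sum of all N-th
   roots of unity, which is 0 as N > 1. *)
have [t00|t0] := eqVneq t 0.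
  have -> : \sum_(k < N) rc r * w ^+ k * f (z + rc t * (rc r * w ^+ k - z)) =
     rc r * f z * \sum_(k < N) (w ^+ k) ^+ 1.
    rewrite mulr_sumr; apply: eq_bigr => k _; rewrite t00 mul0r addr0 expr1; ring.
  rewrite (prim_root_sum _ pw) gtnNdvd// mulr0 Normc.normc0 mulr_ge0//.
have {}t0 : 0 < t by case/andP: t01 => t0'; rewrite lt_def t0 t0'.
pose p k := rc r * w ^+ k; pose q k := z + rc t * (p k - z).
have pr k : normc (p k) = r.
  by rewrite /p Normc.normcM normcX w1 expr1n mulr1 normc_real_ge0 ?(ltW r0).
have qr k : normc (q k) <= r by apply: cvx_normc => //; rewrite pr.
have q1 k : disc (q k) by exact: le_lt_trans r1.
(* The edges of the polygon are the nodes times the common factor t (w - 1). Multiplying the sum by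
   this factor makes it a Riemann sum, and dividing by it at the end leaves N e. *)
have dq k : q k.+1 - q k = rc t * (w - 1) * p k by rewrite /q /p exprS; ring.
pose F := integration f.
have term k : normc (f (q k) * (q k.+1 - q k) - (F (q k.+1) - F (q k))) <= t * normc (w - 1) * e.
  rewrite normcB /F integration_seg//.
  have nd : normc (q k.+1 - q k) <= t * normc (w - 1).
    rewrite dq Normc.normcM pr Normc.normcM normc_real_ge0 ?(ltW t0)// ler_piMr ?(ltW r1)//.
    by rewrite mulr_ge0 ?(ltW t0)// ltW.
  apply: (le_trans (@seg_near_cst _ f _ _ (f (q k)) e cf (q1 k) (q1 k.+1) _)).
    move=> u u01; apply: hd => //; rewrite addrC addKr Normc.normcM.
    case/andP: u01 => u0 u1; rewrite normc_real_ge0//.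
    apply: le_lt_trans wd; apply: le_trans (ler_wpM2l u0 nd) _.
    case/andP: t01 => _ t1; rewrite mulrA ler_piMl ?normc_ge0//.
    by rewrite mulr_ile1// ltW.
  by rewrite ler_wpM2r.
have tel : \sum_(k < N) (F (q k.+1) - F (q k)) = 0.
  rewrite -(big_mkord xpredT (fun k => F (q k.+1) - F (q k))) telescope_sumr//.
  by rewrite /q /p (prim_expr_order pw) expr0 subrr.
have tw : 0 < t * normc (w - 1) by rewrite mulr_gt0.
rewrite -(ler_pM2l tw).
have -> : t * normc (w - 1) = normc (rc t * (w - 1)).
  by rewrite Normc.normcM normc_real_ge0 ?ltW.
rewrite -Normc.normcM mulr_sumr.
have -> : \sum_(k < N) rc t * (w - 1) * (rc r * w ^+ k * f (z + rc t * (rc r * w ^+ k - z))) =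
   \sum_(k < N) (f (q k) * (q k.+1 - q k) - (F (q k.+1) - F (q k))).
  rewrite sumrB tel subr0; apply: eq_bigr => k _; rewrite dq -/(p k) -/(q k).
  by rewrite mulrA mulrC.
apply: le_trans (normc_sum _ _ _) _.
apply: (@le_trans _ _ (\sum_(k < N) t * normc (w - 1) * e)); first exact: ler_sum.
rewrite sumr_const card_ord -[_ *+ _]mulr_natl Normc.normcM normc_real_ge0 ?(ltW t0)//.
by rewrite mulrCA.
Qed.

(** The difference of the primitive between a node p and z is (p - z) times a mean of [f] over the
    segment. The factor p - z = p (1 - z/p) closes the geometric sum to 1 - (z/p)^N, which equals 1
    - (z/r)^N for every node. It leaves the sum, costs a factor 2, and the remaining sum is
    small. *)
Lemma interp_primitive_close f (r d e : R) N w z :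
  (forall z, disc z -> exists L, has_deriv f z L) ->
  0 < r -> r < 1 -> (1 < N)%N -> N.-primitive_root w -> normc w = 1 -> normc (w - 1) < d ->
  (forall x y, normc x <= r -> normc (y - x) < d -> normc (f y - f x) <= e) ->
  normc z <= r -> normc ((interp (integration f) r N w).[z] - integration f z) <= 2 * e.
Proof.
move=> df r0 r1 N1 pw w1 wd hd zr; have cf : cts_disc f by move=> x /df[L]; exact: has_deriv_cts.
have N0 := prim_order_gt0 pw; have nN : N%:R != 0 :> C by rewrite pnatr_eq0 -lt0n.
have z1 : disc z by exact: le_lt_trans r1.
pose p k := rc r * w ^+ k.
have p1 k : disc (p k).
  by rewrite /disc/= /p Normc.normcM normcX w1 expr1n mulr1 normc_real_ge0 ?(ltW r0).
have p0 k : p k != 0 by exact: prim_root_node_neq0 pw.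
rewrite interp_subE//.
have -> : \sum_(k < N) (\sum_(j < N) (z / (rc r * w ^+ k)) ^+ j) *
    (integration f (rc r * w ^+ k) - integration f z) =
  (1 - (z / rc r) ^+ N) * cintegral (fun t => \sum_(k < N) p k * f (z + rc t * (p k - z))).
  rewrite cintegral_sum => [|k]; last exact/cctsZ/ccts_seg.
  rewrite mulr_sumr; apply: eq_bigr => k _; rewrite -/(p k) integration_seg//.
  rewrite /seg cintegralZ; last exact: ccts_seg.
  set I := cintegral _.
  have -> : (z / rc r) ^+ N = (z / p k) ^+ N.
    by rewrite /p invfM mulrA [RHS]exprMn -exprVn -exprM mulnC exprM exprVn
       (prim_expr_order pw) invr1 expr1n mulr1.
  have -> : 1 - (z / p k) ^+ N = (1 - z / p k) * \sum_(j < N) (z / p k) ^+ j.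
    by rewrite -[LHS]opprB subrX1 -mulNr opprB.
  have -> : p k - z = p k * (1 - z / p k) by rewrite mulrBr mulr1 mulrCA mulfV// mulr1.
  ring.
rewrite !Normc.normcM; have NR : normc (N%:R^-1 : C) = N%:R^-1.
  by rewrite Normc.normcV -(rmorph_nat rc) normc_real_ge0.
have h1 : normc (cintegral (fun t => \sum_(k < N) p k * f (z + rc t * (p k - z)))) <= N%:R * e.
  apply: normc_cintegral_le => [|t t01].
    by apply: ccts_sum => k; exact/cctsZ/ccts_seg.
  exact: (@node_sum_small f r t d e).
have h2 : normc (1 - (z / rc r) ^+ N) <= 2.
  apply: le_trans (normcD _ _) _; rewrite normcN Normc.normc1 normcX Normc.normcM Normc.normcV.
  rewrite normc_real_ge0 ?(ltW r0)// -[2]/(1 + 1) lerD2l.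
  rewrite exprn_ile1 ?divr_ge0 ?normc_ge0 ?(ltW r0)//.
  by rewrite ler_pdivrMr// mul1r.
rewrite NR mulrCA; apply: ler_pM; rewrite ?normc_ge0 ?mulr_ge0 ?invr_ge0 ?normc_ge0//.
by rewrite mulrC ler_pdivrMr ?ltr0n// mulrC.
Qed.

Lemma runge_primitive f (r e : R) :
  (forall z, disc z -> exists L, has_deriv f z L) -> 0 < r -> r < 1 -> 0 < e ->
  exists P : {poly C}, forall z, normc z <= r -> normc (P.[z] - integration f z) <= e.
Proof.
move=> df r0 r1 e0; have cf : cts_disc f by move=> x /df[L]; exact: has_deriv_cts.
have [d d0 hd] := uniformly_cts cf r1 (divr_gt0 e0 (ltr0n _ 2)).
have [N [w [N1 pw w1 wd]]] := @small_root R 0 (d / 2) (divr_gt0 d0 (ltr0n _ 2)).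
exists (interp (integration f) r N w) => z zr.
have -> : e = 2 * (e / 2) by field.
apply: interp_primitive_close => //; last exact: hd.
by apply: le_lt_trans wd _; rewrite ltr_pdivrMr// ltr_pMr// ltr1n.
Qed.

End Interpolation.

(** * Cauchy's estimates for polynomials *)

Section PolynomialEstimates.
Context {R : realType}.
Local Notation C := (Cplx R).
Local Notation rc := (real_complex R).
Implicit Types (P : {poly C}) (z w : C) (r rho M : R).

Lemma normc_nat n : normc (n%:R : C) = n%:R.
Proof. by rewrite -(rmorph_nat rc) normc_real_ge0. Qed.

Lemma geometric_sum_le (x : R) n : 0 <= x -> x < 1 -> \sum_(i < n) x ^+ i <= (1 - x)^-1.
Proof.
move=> x0 x1; rewrite -[leRHS]div1r ler_pdivlMr ?subr_gt0// mulrC.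
by rewrite -[1 - x]opprB mulNr -subrX1 opprB lerBlDr lerDl exprn_ge0.
Qed.

(** Cauchy's coefficient formula with the circle replaced by N equidistant points. Since N exceeds
    the degree, no other coefficient contributes to the average. *)
Lemma coef_bound P r M j : 0 < r -> (forall z, normc z = r -> normc P.[z] <= M) ->
  normc P`_j <= M / r ^+ j.
Proof.
move=> r0 hM; have [Pj|jP] := leqP (size P) j.
  rewrite nth_default// Normc.normc0 divr_ge0 ?exprn_ge0 ?(ltW r0)//.
  by apply: le_trans (hM (rc r) _); rewrite ?normc_ge0// normc_real_ge0 ?ltW.
have [N [w [N1 pw w1 _]]] := @small_root R (size P) 1 ltr01.
have PN : (size P <= N)%N by rewrite ltnW// ltnW.
have jN : (j < N)%N by exact: leq_trans PN.
have N0 : (0 < N)%N by rewrite (leq_trans _ N1).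
(* The exponent N - j plays the part of -j, as w^N = 1. *)
have E : \sum_(k < N) P.[rc r * w ^+ k] * (w ^+ k) ^+ (N - j) = N%:R * (P`_j * rc r ^+ j).
  transitivity (\sum_(k < N) \sum_(i < N) P`_i * rc r ^+ i * (w ^+ k) ^+ (i + (N - j))).
    apply: eq_bigr => k _; rewrite (horner_coef_wide _ PN) mulr_suml.
    by apply: eq_bigr => i _; rewrite exprMn exprD; ring.
  rewrite exchange_big/= (bigD1 (Ordinal jN))//= [X in _ + X]big1 ?addr0.
    rewrite -mulr_sumr (prim_root_sum _ pw) subnKC ?dvdnn; last exact: ltnW.
    by rewrite mulrC.
  move=> i ij; rewrite -mulr_sumr (prim_root_sum _ pw); case: ifP; rewrite ?mulr0//.
  have iN := ltn_ord i; have {}ij : (i != j :> nat).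
    by apply: contra ij => /eqP h; apply/eqP/val_inj.
  move=> /dvdnP[q]; case: q => [|[|q]]; rewrite ?mulSn; lia.
have E2 : N%:R * (normc P`_j * r ^+ j) <= N%:R * M.
  have -> : N%:R * (normc P`_j * r ^+ j) = normc (N%:R * (P`_j * rc r ^+ j)).
    by rewrite !Normc.normcM normc_nat normcX normc_real_ge0 ?(ltW r0).
  rewrite -E; apply: le_trans (normc_sum _ _ _) _.
  rewrite mulr_natl -[X in _ *+ X](card_ord N) -sumr_const; apply: ler_sum => k _.
  rewrite Normc.normcM !normcX w1 !expr1n mulr1; apply: hM.
  by rewrite Normc.normcM normcX w1 expr1n mulr1 normc_real_ge0 ?ltW.
by rewrite ler_pdivlMr ?exprn_gt0// -(@ler_pM2l _ N%:R) ?ltr0n.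
Qed.

(** The left side is at most r^n - rho^n, by the factorisation of a difference of powers. It lets
    derivatives on radius [rho] be dominated by powers of a slightly larger radius. *)
Lemma powB_bound (rho r : R) n : 0 <= rho -> rho < r ->
  n%:R * rho ^+ n.-1 * (r - rho) <= r ^+ n.
Proof.
move=> rho0 rr; apply: (@le_trans _ _ (r ^+ n - rho ^+ n)); last first.
  by rewrite lerBlDr lerDl exprn_ge0.
rewrite subrXX mulrC ler_wpM2l ?subr_ge0 ?(ltW rr)//.
rewrite mulr_natl -[X in _ *+ X](card_ord n) -sumr_const; apply: ler_sum => k _.
have kn : (k <= n.-1)%N by have := ltn_ord k; lia.
rewrite -{1}(subnK kn) exprD ler_wpM2r ?exprn_ge0// lerXn2r ?nnegrE ?(ltW rr)//.
by rewrite (le_trans rho0)// ltW.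
Qed.

Lemma normc_powB z w rho n : normc z <= rho -> normc w <= rho ->
  normc (z ^+ n - w ^+ n) <= n%:R * rho ^+ n.-1 * normc (z - w).
Proof.
move=> zr wr; have rho0 := le_trans (normc_ge0 z) zr.
rewrite subrXX Normc.normcM mulrC ler_wpM2r ?normc_ge0//.
apply: le_trans (normc_sum _ _ _) _.
rewrite mulr_natl -[X in _ *+ X](card_ord n) -sumr_const; apply: ler_sum => k _.
have kn : (k <= n.-1)%N by have := ltn_ord k; lia.
rewrite Normc.normcM !normcX -[in leRHS](subnK kn) exprD.
by apply: ler_pM; rewrite ?exprn_ge0 ?normc_ge0// lerXn2r ?nnegrE ?normc_ge0.
Qed.

(** With s halfway between the radii, coefficients are at most M / r^j and j rho^(j-1) is at most
    s^j / (s - rho), so everything is dominated by a geometric series of ratio s/r. The constant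
    depends on the radii alone, not on the degree, which is what lets it pass to limits. *)
Lemma cauchy_estimate rho r : 0 <= rho -> rho < r -> exists2 K, 0 <= K &
  forall P M, (forall z, normc z = r -> normc P.[z] <= M) ->
  (forall z w, normc z <= rho -> normc w <= rho ->
     normc (P.[z] - P.[w]) <= K * M * normc (z - w)) /\
  (forall z, normc z <= rho -> normc (P^`()).[z] <= K * M).
Proof.
move=> rho0 rr; have r0 := le_lt_trans rho0 rr.
pose s := (rho + r) / 2; have [rs sr] : rho < s /\ s < r by rewrite /s; split; lra.
have x0 : 0 <= s / r by rewrite divr_ge0// ltW// (le_lt_trans rho0).
have x1 : s / r < 1 by rewrite ltr_pdivrMr// mul1r.
exists ((s - rho)^-1 * (1 - s / r)^-1).
  by rewrite mulr_ge0// invr_ge0 subr_ge0 ltW.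
move=> P M hM; have M0 : 0 <= M.
  by apply: le_trans (hM (rc r) _); rewrite ?normc_ge0// normc_real_ge0 ?ltW.
have T j : normc P`_j * (j%:R * rho ^+ j.-1) <= (s - rho)^-1 * M * (s / r) ^+ j.
  have h1 := coef_bound j r0 hM; have h2 := powB_bound j rho0 rs.
  rewrite -mulrA ler_pdivlMl ?subr_gt0//; apply: (@le_trans _ _ (M / r ^+ j * s ^+ j)); last first.
    suff -> : M / r ^+ j * s ^+ j = M * (s / r) ^+ j by [].
    by rewrite [(s / r) ^+ j]expr_div_n; ring.
  rewrite mulrCA [(s - rho) * _]mulrC.
  apply: ler_pM => //; rewrite ?normc_ge0//.
    by rewrite mulr_ge0 ?mulr_ge0 ?exprn_ge0// subr_ge0 ltW.
have S n : \sum_(j < n) normc P`_j * (j%:R * rho ^+ j.-1) <=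
    (s - rho)^-1 * (1 - s / r)^-1 * M.
  apply: (@le_trans _ _ (\sum_(j < n) (s - rho)^-1 * M * (s / r) ^+ j)); first exact: ler_sum.
  rewrite -mulr_sumr mulrAC ler_wpM2r// ler_wpM2l ?geometric_sum_le//.
  by rewrite invr_ge0 subr_ge0 ltW.
split=> [z w zr wr|z zr].
  rewrite !horner_coef -sumrB; apply: le_trans (normc_sum _ _ _) _.
  apply: le_trans (ler_wpM2r (normc_ge0 _) (S (size P))).
  rewrite mulr_suml; apply: ler_sum => j _; rewrite -mulrBr Normc.normcM -mulrA.
  by rewrite ler_wpM2l ?normc_ge0// normc_powB.
rewrite (@horner_coef_wide _ (size P).-1); last exact: size_poly.
apply: le_trans (normc_sum _ _ _) _; apply: le_trans (S (size P)).
case: (size P) => [|n]; first by rewrite !big_ord0.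
rewrite big_ord_recl/= mul0r mulr0 add0r; apply: ler_sum => j _.
rewrite /bump/= ?add1n ?add0n.
rewrite coef_deriv -[_`__ *+ _]mulr_natr 2!Normc.normcM normc_nat normcX -!mulrA.
rewrite ler_wpM2l ?normc_ge0// ler_wpM2l//=.
by rewrite lerXn2r ?nnegrE ?normc_ge0.
Qed.

Lemma horner_taylor2 P z : exists Q : {poly C}, forall w,
  P.[w] = P.[z] + P^`().[z] * (w - z) + Q.[w] * (w - z) ^+ 2.
Proof.
elim/poly_ind: P => [|P c [Q hQ]].
  by exists 0 => w; rewrite deriv0 !horner0; ring.
exists (P^`().[z]%:P + Q * 'X) => w.
by rewrite derivD derivC addr0 derivM derivX mulr1 !hornerD !hornerM !hornerX !hornerC (hQ w); ring.
Qed.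

Lemma horner_bounded P r : exists2 B, 0 <= B & forall z, normc z <= r -> normc P.[z] <= B.
Proof.
exists (\sum_(i < size P) normc P`_i * `|r| ^+ i).
  by rewrite sumr_ge0// => i _; rewrite mulr_ge0 ?normc_ge0 ?exprn_ge0.
move=> z zr; rewrite horner_coef; apply: le_trans (normc_sum _ _ _) _.
apply: ler_sum => i _; rewrite Normc.normcM normcX ler_wpM2l ?normc_ge0//.
by rewrite lerXn2r ?nnegrE ?normc_ge0// (le_trans zr)// ler_norm.
Qed.

Lemma horner_has_deriv P z : has_deriv (horner P) z (P^`()).[z].
Proof.
move=> e e0; have [Q hQ] := horner_taylor2 P z.
have [B B0 hB] := horner_bounded Q (normc z + 1).
have B1 : 0 < B + 1 by rewrite ltr_wpDl.
exists (Num.min 1 (e / (B + 1))); first by rewrite lt_min ltr01 divr_gt0.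
move=> w; rewrite lt_min ltr_pdivlMr// => /andP[w1 we].
have -> : P.[w] - P.[z] - P^`().[z] * (w - z) = Q.[w] * (w - z) * (w - z) by rewrite (hQ w); ring.
rewrite Normc.normcM ler_wpM2r ?normc_ge0// Normc.normcM.
have : normc Q.[w] <= B.
  by apply: hB; have := normcD (w - z) z; rewrite subrK; lra.
have := normc_ge0 (w - z); have := normc_ge0 Q.[w]; nra.
Qed.

End PolynomialEstimates.

(** * Locally uniform limits of polynomials: derivatives and the identity theorem *)

Section LocallyUniformLimits.
Context {R : realType}.
Local Notation C := (Cplx R).
Local Notation rc := (real_complex R).
Implicit Types (f g : C -> C) (P : {poly C}) (z w : C) (r rho e : R).

Definition close_on r e P f := forall z, normc z <= r -> normc (P.[z] - f z) <= e.

Definition poly_limit f := forall r e, 0 < r -> r < 1 -> 0 < e -> exists P, close_on r e P f.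

(** For a much better approximant [P'], the polynomial [P' - P] is bounded by nearly [e] on the
    circle of radius [r]; Cauchy's estimate applies to it, and then [P'] tends to [f]. *)
Lemma poly_limit_lipschitz rho r : 0 <= rho -> rho < r -> r < 1 -> exists2 K, 0 <= K &
  forall f P e, poly_limit f -> close_on r e P f ->
  forall z w, normc z <= rho -> normc w <= rho ->
  normc ((f w - P.[w]) - (f z - P.[z])) <= K * e * normc (w - z).
Proof.
move=> rho0 rr r1; have r0 := le_lt_trans rho0 rr.
have [K K0 hK] := @cauchy_estimate R rho r rho0 rr; exists K => // f P e lf hP z w zr wr.
apply/ler_addgt0Pr => e' e'0.
(* The error d enters twice by replacing f with [P'] and once through the Cauchy bound, times K |w -
   z|. *)
pose d := e' / (K * normc (w - z) + 2).
have D0 : 0 < K * normc (w - z) + 2 by rewrite ltr_wpDl// mulr_ge0// normc_ge0.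
have d0 : 0 < d by rewrite divr_gt0.
have [P' hP'] := lf r d r0 r1 d0.
have le_r x : normc x <= rho -> normc x <= r by move=> h; rewrite (le_trans h)// ltW.
have hM x : normc x = r -> normc (P' - P).[x] <= d + e.
  move=> xr; rewrite hornerD hornerN -[P'.[x]](subrK (f x)) -addrA.
  apply: le_trans (normcD _ _) _; apply: lerD; first by apply: hP'; rewrite xr.
  by rewrite normcB; apply: hP; rewrite xr.
have [h _] := hK _ _ hM.
have {h} := h w z wr zr; rewrite !hornerD !hornerN => h.
have -> : f w - P.[w] - (f z - P.[z]) =
  (f w - P'.[w]) + ((P'.[w] - P.[w] - (P'.[z] - P.[z])) + (P'.[z] - f z)) by ring.
apply: le_trans (normcD _ _) _.
apply: le_trans (lerD (lexx _) (normcD _ _)) _.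
have h1 := hP' w (le_r _ wr); have h2 := hP' z (le_r _ zr).
rewrite normcB in h1.
have E : e' = d * (K * normc (w - z) + 2) by rewrite /d mulfVK// gt_eqF.
by rewrite E; lra.
Qed.

Lemma has_deriv_lipschitz f P z L K rho : normc z < rho ->
  (forall w, normc w <= rho -> normc ((f w - P.[w]) - (f z - P.[z])) <= K * normc (w - z)) ->
  has_deriv f z L -> normc (L - P^`().[z]) <= K.
Proof.
move=> zr hL df; apply/ler_addgt0Pr => e e0; have e2 : 0 < e / 2 by rewrite divr_gt0.
have [d d0 hd] := df _ e2; have [d' d'0 hd'] := horner_has_deriv P z e2.
pose h := Num.min (rho - normc z) (Num.min (d / 2) (d' / 2)).
have h0 : 0 < h by rewrite !lt_min subr_gt0 zr !divr_gt0.
have hr : h <= rho - normc z by rewrite ge_min lexx.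
have hdd : h < d by rewrite (@le_lt_trans _ _ (d / 2)) ?ge_min ?lexx ?orbT//; lra.
have hdd' : h < d' by rewrite (@le_lt_trans _ _ (d' / 2)) ?ge_min ?lexx ?orbT//; lra.
have nh : normc (z + rc h - z) = h by rewrite addrC addKr normc_real_ge0 ?ltW.
have wr : normc (z + rc h) <= rho.
  by apply: le_trans (normcD _ _) _; rewrite normc_real_ge0 ?(ltW h0)//; lra.
have := hL _ wr; have := hd (z + rc h); have := hd' (z + rc h).
rewrite nh => /(_ hdd') h1 /(_ hdd) h2 h3; rewrite -(ler_pM2r h0).
have -> : normc (L - P^`().[z]) * h = normc ((L - P^`().[z]) * (z + rc h - z)).
  by rewrite Normc.normcM nh.
move: h1 h2 h3; set w := z + rc h => h1 h2 h3.
have -> : (L - P^`().[z]) * (w - z) = (f w - P.[w] - (f z - P.[z])) +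
   ((P.[w] - P.[z] - P^`().[z] * (w - z)) + - (f w - f z - L * (w - z))) by ring.
apply: le_trans (normcD _ _) _; apply: le_trans (lerD (lexx _) (normcD _ _)) _.
by rewrite normcN; lra.
Qed.

(** Weierstrass's argument: approximants with error 2^-n have derivatives at [z] with geometrically
    small increments, and their limit is the derivative because [f - P n] is Lipschitz with a
    constant of order 2^-n. *)
Lemma poly_limit_has_deriv f z : poly_limit f -> disc z -> exists L, has_deriv f z L.
Proof.
move=> lf z1; have n0 := normc_ge0 z; rewrite /disc/= in z1.
pose rho := (1 + normc z) / 2; pose r := (1 + rho) / 2.
have [zr rr r1] : [/\ normc z < rho, rho < r & r < 1] by rewrite /r /rho; split; lra.
have rho0 : 0 <= rho by lra.
have r0 : 0 < r by lra.
have [K K0 hK] := poly_limit_lipschitz rho0 rr r1.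
have [K' K'0 hK'] := @cauchy_estimate R rho r rho0 rr.
have /choice[P hP] n : exists P, close_on r (2 ^- n) P f.
  by apply: lf => //; rewrite invr_gt0 exprn_gt0.
pose u n := (P n)^`().[z].
have [L hL] : exists L, forall n, normc (L - u n) <= 4 * (K' * 2) / 2 ^+ n.
  apply: geometric_limit => [|n]; first by rewrite mulr_ge0.
  have hM x : normc x = r -> normc (P n.+1 - P n).[x] <= 2 / 2 ^+ n.
    move=> xr; rewrite hornerD hornerN -[(P n.+1).[x]](subrK (f x)) -addrA.
    apply: le_trans (normcD _ _) _.
    have h1 := hP n x; have h2 := hP n.+1 x; rewrite xr in h1 h2.
    have {}h1 := h1 (lexx _); have {}h2 := h2 (lexx _); rewrite normcB in h1.
    have : 2 ^- n.+1 <= 2 ^- n :> R by rewrite lef_pV2 ?posrE ?exprn_gt0// ler_eXn2l// ?ltr1n.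
    lra.
  have [_ /(_ z (ltW zr))] := hK' _ _ hM.
  by rewrite derivB hornerD hornerN mulrA.
exists L => e e0.
(* K bounds the Lipschitz error of [f - P n], and 8 K' = 4 (2 K') the distance from [L] to [u n],
   both in units of 2^-n. *)
pose c := K + 8 * K' + 1.
have c0 : 0 < c by rewrite /c; lra.
have [n hn] : exists n, 2 ^- n < e / 2 / c.
  have := @cvg_geometric R 1 2^-1.
  rewrite ger0_norm ?invr_ge0// invf_lt1 ?ltr1n// => /(_ isT) /cvgrPdist_lt/(_ (e / 2 / c)).
  rewrite !divr_gt0// => /(_ isT) [n _ /(_ n (leqnn n))].
  rewrite sub0r normrN /geometric/= exprVn mul1r => h.
  by exists n; apply: le_lt_trans (ler_norm _) h.
have [d d0 hd] := @horner_has_deriv R (P n) z (e / 2) (divr_gt0 e0 (ltr0n _ 2)).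
exists (Num.min d (rho - normc z)); first by rewrite lt_min d0 subr_gt0.
move=> w; rewrite lt_min => /andP[/hd h1 wz].
have wr : normc w <= rho by have := normcD (w - z) z; rewrite subrK; lra.
have h2 := hK f (P n) _ lf (hP n) z w (ltW zr) wr.
have h3 := hL n.
have -> : f w - f z - L * (w - z) = (f w - (P n).[w] - (f z - (P n).[z])) +
  (((P n).[w] - (P n).[z] - u n * (w - z)) + - ((L - u n) * (w - z))) by ring.
apply: le_trans (normcD _ _) _; apply: le_trans (lerD (lexx _) (normcD _ _)) _.
rewrite normcN [normc ((L - _) * _)]Normc.normcM.
have h4 : normc (L - u n) * normc (w - z) <= 4 * (K' * 2) / 2 ^+ n * normc (w - z).
  by rewrite ler_wpM2r ?normc_ge0.
have h5 : c * 2 ^- n <= e / 2 by rewrite mulrC -ler_pdivlMr// ltW.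
have w0 := normc_ge0 (w - z).
have h6 : c * 2 ^- n * normc (w - z) <= e / 2 * normc (w - z) by rewrite ler_wpM2r.
have h7 : 0 <= 2 ^- n * normc (w - z) by rewrite mulr_ge0// invr_ge0 exprn_ge0.
rewrite /c in h6.
have -> : e * normc (w - z) = e / 2 * normc (w - z) + e / 2 * normc (w - z) by field.
apply: le_trans (lerD h2 (lerD h1 h4)) _.
lra.
Qed.

Lemma poly_limit_derivable f z : poly_limit f -> disc z -> has_deriv f z (derive1 f z).
Proof.
move=> lf z1; have [L hL] := poly_limit_has_deriv lf z1.
by have [_ ->] := has_deriv_derivable hL.
Qed.

Lemma derive1_close rho r : 0 <= rho -> rho < r -> r < 1 -> exists2 K, 0 <= K &
  forall f P e, poly_limit f -> close_on r e P f -> close_on rho (K * e) P^`() (derive1 f).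
Proof.
move=> rho0 rr r1; pose s := (rho + r) / 2.
have [rs sr] : rho < s /\ s < r by rewrite /s; split; lra.
have [K K0 hK] := poly_limit_lipschitz (le_trans rho0 (ltW rs)) sr r1.
exists K => // f P e lf hP z zr; rewrite normcB.
have zs : normc z < s by exact: le_lt_trans rs.
apply: (has_deriv_lipschitz zs) => [w ws|].
  by apply: (hK f) => //; exact: ltW.
by apply: poly_limit_derivable => //; rewrite /disc/=; lra.
Qed.

Lemma poly_limit_derive1 f : poly_limit f -> poly_limit (derive1 f).
Proof.
move=> lf rho e rho0 rho1 e0; pose r := (rho + 1) / 2.
have [rr r1] : rho < r /\ r < 1 by rewrite /r; split; lra.
have [K K0 hK] := derive1_close (ltW rho0) rr r1.
have K1 : 0 < K + 1 by lra.
have [P hP] := lf r (e / (K + 1)) (lt_trans rho0 rr) r1 (divr_gt0 e0 K1).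
exists P^`() => z /(hK _ _ _ lf hP); move=> h; apply: le_trans h _.
by rewrite mulrA ler_pdivrMr// mulrC ler_pM2l// lerDl.
Qed.

Lemma poly_limit_derive1n f n : poly_limit f -> poly_limit (derive1n n f).
Proof. by move=> lf; elim: n => // n IH; rewrite derive1nS; exact: poly_limit_derive1. Qed.

Lemma derive1n_close n rho : 0 <= rho -> rho < 1 -> exists r K, [/\ rho <= r, r < 1, 0 <= K &
  forall f P e, poly_limit f -> close_on r e P f ->
    close_on rho (K * e) P^`(n) (derive1n n f)].
Proof.
elim: n rho => [|n IH] rho rho0 rho1.
  by exists rho, 1; split=> // f P e _; rewrite mul1r.
pose r := (rho + 1) / 2.
have [rr r1] : rho < r /\ r < 1 by rewrite /r; split; lra.
have [K K0 hK] := derive1_close rho0 rr r1.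
have [r' [K' [rr' r'1 K'0 hK']]] := IH r (le_trans rho0 (ltW rr)) r1.
exists r', (K * K'); split=> //; first by lra.
  exact: mulr_ge0.
move=> f P e lf hP; rewrite derive1nS derivnS -mulrA; apply: hK.
  exact: poly_limit_derive1n.
exact: hK'.
Qed.

Lemma coef_close n : exists r K, [/\ 0 < r, r < 1, 0 <= K &
  forall f P e, poly_limit f -> close_on r e P f ->
    normc (P`_n *+ n`! - derive1n n f 0) <= K * e].
Proof.
have [r [K [r0 r1 K0 hK]]] := @derive1n_close n (1/2) ltac:(lra) ltac:(lra).
exists r, K; split=> //; first by lra.
move=> f P e lf hP; have := hK f P e lf hP 0; rewrite Normc.normc0 => /(_ ltac:(lra)).
by rewrite horner_coef0 coef_derivn addn0 ffactnn.
Qed.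

(** By induction on n, the next coefficient is removed. An approximant with error d on a large
    enough disc has this coefficient at most K d, because the derivative of [f] vanishes, so
    removing it raises the error to at most (K + 1) d. *)
Lemma poly_limit_vanish f n r e : poly_limit f ->
  (forall j, (j < n)%N -> derive1n j f 0 = 0) -> 0 < r -> r < 1 -> 0 < e ->
  exists2 P : {poly C}, (forall j, (j < n)%N -> P`_j = 0) & close_on r e P f.
Proof.
move=> lf; elim: n r e => [|n IH] r e hn r0 r1 e0.
  by have [P hP] := lf r e r0 r1 e0; exists P.
have [s [K [s0 s1 K0 hK]]] := coef_close n.
pose r' := Num.max r s; pose d := e / (K + 1).
have K1 : 0 < K + 1 by lra.
have d0 : 0 < d by rewrite divr_gt0.
have [||||P P0 hP] := IH r' d.
- by move=> j jn; apply: hn; exact: leqW.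
- by rewrite lt_max r0.
- by rewrite gt_max r1.
- by [].
have hPn : normc P`_n <= K * d.
  have hPs : close_on s d P f by move=> z zs; apply: hP; rewrite le_max zs orbT.
  have := hK f P d lf hPs; rewrite hn// subr0; apply: le_trans.
  by rewrite -[P`_n *+ _]mulr_natr Normc.normcM normc_nat ler_peMr ?normc_ge0// ler1n fact_gt0.
exists (P - P`_n *: 'X^n).
  move=> j; rewrite coefB coefZ coefXn ltnS leq_eqVlt => /predU1P[->|jn].
    by rewrite eqxx mulr1 subrr.
  by rewrite (P0 _ jn) (ltn_eqF jn) mulr0 subrr.
move=> z zr; rewrite hornerD hornerN hornerZ hornerXn addrAC.
apply: le_trans (normcD _ _) _; rewrite normcN Normc.normcM normcX.
have h1 : normc (P.[z] - f z) <= d by apply: hP; rewrite le_max zr.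
have h2 : normc P`_n * normc z ^+ n <= K * d.
  apply: le_trans hPn; rewrite ler_piMr ?normc_ge0// exprn_ile1 ?normc_ge0//.
  by rewrite (le_trans zr)// ltW.
have -> : e = d * (K + 1) by rewrite /d mulfVK// gt_eqF.
by lra.
Qed.

(* Cauchy's estimates make a function vanishing to high order at 0 small. *)
Lemma poly_limit_eq0 f : poly_limit f -> (forall j, derive1n j f 0 = 0) ->
  forall z, disc z -> f z = 0.
Proof.
move=> lf hf z z1; rewrite /disc/= in z1; have n0 := normc_ge0 z.
apply: Normc.eq0_normc; apply/eqP; rewrite eq_le normc_ge0 andbT.
apply/ler_addgt0Pr => e e0; rewrite add0r.
pose r := (1 + normc z) / 2.
have [zr r1] : normc z < r /\ r < 1 by rewrite /r; split; lra.
have r0 : 0 < r by lra.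
have [P0 hP0] := lf r 1 r0 r1 ltr01.
have [B B0 hB] := horner_bounded P0 r.
pose x := normc z / r; have x0 : 0 <= x by rewrite divr_ge0// ltW.
have x1 : x < 1 by rewrite ltr_pdivrMr// mul1r.
(* B + 2 will bound on the circle of radius r the final approximant [P]: at most 1 for P - f, 1 for
   P0 - f and B for P0. Then c x^m bounds a polynomial starting at degree m. *)
pose c := (B + 2) * (1 - x)^-1.
have c0 : 0 < c by rewrite mulr_gt0 ?invr_gt0 ?subr_gt0//; lra.
have [m hm] : exists m, x ^+ m * c <= e / 2.
  have := @cvg_geometric R c x; rewrite ger0_norm// => /(_ x1) /cvgrPdist_lt/(_ (e / 2)).
  rewrite divr_gt0// => /(_ isT) [n _ /(_ n (leqnn n))].
  rewrite sub0r normrN /geometric/= mulrC => h.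
  by exists n; apply: ltW; apply: le_lt_trans (ler_norm _) h.
pose d := Num.min 1 (e / 2).
have d0 : 0 < d by rewrite lt_min ltr01 divr_gt0.
have [P hP1 hP2] := @poly_limit_vanish f m r d lf (fun j _ => hf j) r0 r1 d0.
have [d1 d2] : d <= 1 /\ d <= e / 2 by split; rewrite ge_min lexx ?orbT.
have PB y : normc y = r -> normc P.[y] <= B + 2.
  move=> yr; have h1 := hP2 y; have h2 := hP0 y; have h3 := hB y.
  rewrite yr in h1 h2 h3; have {}h1 := h1 (lexx _); have {}h2 := h2 (lexx _).
  have {}h3 := h3 (lexx _).
  have -> : P.[y] = (P.[y] - f y) + (- (P0.[y] - f y) + P0.[y]) by ring.
  apply: le_trans (normcD _ _) _; apply: le_trans (lerD (lexx _) (normcD _ _)) _.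
  by rewrite normcN; lra.
have Pz : normc P.[z] <= e / 2.
  apply: le_trans hm; rewrite (@horner_coef_wide _ (m + size P)) ?leq_addl//.
  rewrite big_split_ord/= [X in X + _]big1 ?add0r; last first.
    by move=> i _; rewrite hP1 ?mul0r.
  apply: le_trans (normc_sum _ _ _) _.
  apply: (@le_trans _ _ (\sum_(i < size P) x ^+ m * (B + 2) * x ^+ i)).
    apply: ler_sum => i _; have := @coef_bound R P r (B + 2) (m + i) r0 PB.
    rewrite Normc.normcM normcX => h.
    apply: le_trans (ler_wpM2r _ h) _; first by rewrite exprn_ge0.
    have -> : x ^+ m * (B + 2) * x ^+ i = (B + 2) * x ^+ (m + i) by rewrite exprD; ring.
    by rewrite mulrAC [x ^+ _]expr_div_n mulrA.
  rewrite -mulr_sumr /c mulrA ler_wpM2l ?geometric_sum_le//.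
  by rewrite mulr_ge0 ?exprn_ge0//; lra.
have := hP2 z (ltW zr) => h; have -> : f z = P.[z] + - (P.[z] - f z) by ring.
by apply: le_trans (normcD _ _) _; rewrite normcN; lra.
Qed.

(** Interpolation only approximates a primitive; [f] itself is reached because derivatives of
    locally uniform limits of polynomials are again such limits. *)
Lemma primitive_poly_limit f : (forall z, disc z -> exists L, has_deriv f z L) -> poly_limit f.
Proof.
move=> df; have lF : poly_limit (integration f).
  by move=> r e r0 r1 e0; exact: runge_primitive.
have := poly_limit_derive1 lF => h r e r0 r1 e0; have [P hP] := h r e r0 r1 e0.
exists P => z zr; have z1 : disc z by exact: le_lt_trans r1.
by have [_ <-] := has_deriv_derivable (integration_has_deriv df z1); exact: hP.
Qed.

Lemma holomorphic_has_deriv f z : holomorphic_disc f -> disc z -> exists L, has_deriv f z L.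
Proof. by move=> [df _] /df/derivable_has_deriv h; exists (derive1 f z). Qed.

Lemma holomorphic_poly_limit f : holomorphic_disc f -> poly_limit f.
Proof. by move=> hf; apply: primitive_poly_limit => z; exact: holomorphic_has_deriv. Qed.

Lemma holomorphic_integration f : holomorphic_disc f -> holomorphic_disc (integration f).
Proof.
move=> hf; split=> z z1.
  have df x : disc x -> exists L, has_deriv f x L by exact: holomorphic_has_deriv.
  by have [] := has_deriv_derivable (integration_has_deriv df z1).
by rewrite /integration; case: ifP.
Qed.

End LocallyUniformLimits.

(** * Integration of polynomials and the correspondence between P and P(J)1 *)

Section PolynomialIntegration.
Context {R : realType}.
Local Notation C := (Cplx R).
Local Notation rc := (real_complex R).
Implicit Types (f g : C -> C) (P Q : {poly C}) (z w : C).

Lemma Rintegral01_expn n :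
  \int[@lebesgue_measure R]_(t in `[0, 1]) (t ^+ n) = n.+1%:R^-1.
Proof.
pose p : {poly R} := n.+1%:R^-1 *: 'X ^+ n.+1.
have dp x : derive1 (horner p) x = x ^+ n.
  by rewrite -derivE derivZ derivXn hornerZ hornerMn hornerXn/= -[x ^+ n *+ _]mulr_natl mulKf.
have cp : continuous (horner p).
  by move=> x; apply/differentiable_continuous/derivable1_diffP/derivable_horner.
rewrite /Rintegral (@continuous_FTC2 _ _ (horner p))//=.
- by rewrite !hornerZ !hornerXn expr1n expr0n/= mulr1 mulr0 subr0.
- by apply: continuous_subspaceT => x; exact: exprn_continuous.
- split=> [x _||]; first exact: derivable_horner.
    exact/cvg_at_right_filter/cp.
  exact/cvg_at_left_filter/cp.
Qed.

Lemma ccts_poly P (b : C) : ccts (fun t => P.[rc t * b]).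
Proof.
have -> : (fun t => P.[rc t * b]) = (fun t => P.[0 + rc t * (b - 0)]).
  by apply/funext => t; rewrite add0r subr0.
by apply: ccts_path => t _; apply: has_deriv_cts; exact: horner_has_deriv.
Qed.

Lemma cintegral_expn n : cintegral (fun t => rc t ^+ n) = n.+1%:R^-1 :> C.
Proof.
rewrite -(rmorph_nat rc) -fmorphV /cintegral.
have -> : (fun t => complex.Re (rc t ^+ n)) = (fun t => t ^+ n).
  by apply/funext => t; rewrite -rmorphXn.
have -> : (fun t => complex.Im (rc t ^+ n)) = (fun=> 0).
  by apply/funext => t; rewrite -rmorphXn.
by rewrite Rintegral01_expn Rintegral01_cst.
Qed.

Lemma cintegral_poly n P (b : C) : (size P <= n)%N ->
  cintegral (fun t => P.[rc t * b]) = \sum_(i < n) P`_i / i.+1%:R * b ^+ i.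
Proof.
move=> Pn; have cX (i : nat) : ccts (fun t => rc t ^+ i).
  have := @ccts_poly ('X ^+ i) 1; congr ccts; apply/funext => t.
  by rewrite hornerXn mulr1.
transitivity (cintegral (fun t => \sum_(i < n) (P`_i * b ^+ i) * rc t ^+ i)).
  apply: eq_cintegral => t _; rewrite (horner_coef_wide _ Pn); apply: eq_bigr => i _.
  by rewrite exprMn; ring.
rewrite cintegral_sum => [|i]; last exact: cctsZ.
by apply: eq_bigr => i _; rewrite cintegralZ// cintegral_expn; ring.
Qed.

Lemma horner_ftc P (b : C) : P.[b] - P.[0] = b * cintegral (fun t => P^`().[rc t * b]).
Proof.
rewrite (@cintegral_poly (size P).-1); last exact: size_poly.
rewrite mulr_sumr horner_coef0 horner_coef.
case E : (size P) => [|n]; first by rewrite !big_ord0 nth_default ?E// subrr.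
rewrite big_ord_recl/= expr0 mulr1 addrC addKr; apply: eq_bigr => i _.
rewrite /bump/= add1n coef_deriv -[P`_i.+1 *+ _]mulr_natr mulfK ?pnatr_eq0//.
by rewrite mulrCA exprS.
Qed.

Lemma horner_increment_le P (b : C) m : (forall t, 0 <= t <= 1 -> normc P^`().[rc t * b] <= m) ->
  normc (P.[b] - P.[0]) <= normc b * m.
Proof.
move=> h; rewrite horner_ftc Normc.normcM ler_wpM2l ?normc_ge0//.
by apply: normc_cintegral_le => //; exact: ccts_poly.
Qed.

(* [egf P] is [P(J) 1]; under [egf] the operator [J] becomes multiplication by ['X]. *)
Definition egf P : {poly C} := \poly_(i < size P) (P`_i / i`!%:R).

Lemma coef_egf P i : (egf P)`_i = P`_i / i`!%:R.
Proof. by rewrite coef_poly; case: ltnP => // /(nth_default 0) ->; rewrite mul0r. Qed.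

Lemma egf_is_linear : linear egf.
Proof.
by move=> c P Q; apply/polyP => i; rewrite !(coefD, coefZ, coef_egf) mulrDl mulrA.
Qed.

HB.instance Definition _ := GRing.isLinear.Build C {poly C} {poly C} _ egf egf_is_linear.

Lemma egfD P Q : egf (P + Q) = egf P + egf Q. Proof. exact: linearD. Qed.

Lemma egfB P Q : egf (P - Q) = egf P - egf Q. Proof. exact: linearB. Qed.

Lemma egfZ (c : C) P : egf (c *: P) = c *: egf P. Proof. exact: linearZ. Qed.

Lemma egf_sum (I : Type) (s : seq I) (F : I -> {poly C}) :
  egf (\sum_(i <- s) F i) = \sum_(i <- s) egf (F i).
Proof. exact: linear_sum. Qed.

Lemma fact_neq0 n : n`!%:R != 0 :> C. Proof. by rewrite pnatr_eq0 -lt0n fact_gt0. Qed.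

Definition egf_inv P : {poly C} := \poly_(i < size P) (P`_i * i`!%:R).

Lemma coef_egf_inv P i : (egf_inv P)`_i = P`_i * i`!%:R.
Proof. by rewrite coef_poly; case: ltnP => // /(nth_default 0) ->; rewrite mul0r. Qed.

Lemma egf_invK P : egf (egf_inv P) = P.
Proof. by apply/polyP => i; rewrite coef_egf coef_egf_inv mulfK// fact_neq0. Qed.

Lemma deriv_egfMX P : (egf (P * 'X))^`() = egf P.
Proof.
apply/polyP => i; rewrite coef_deriv !coef_egf coefMX/= -[LHS]mulr_natr.
have -> : (i.+1)`!%:R = i.+1%:R * i`!%:R :> C by rewrite factS natrM.
by rewrite invfM mulrA mulrAC divfK ?pnatr_eq0.
Qed.

Lemma egfMX_0 P : (egf (P * 'X)).[0] = 0.
Proof. by rewrite horner_coef0 coef_egf coefMX mul0r. Qed.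

Lemma derivn_egf_0 P n : (egf P)^`(n).[0] = P`_n.
Proof.
by rewrite horner_coef0 coef_derivn addn0 ffactnn coef_egf -[LHS]mulr_natr divfK// fact_neq0.
Qed.

Lemma derivn_egf_eq0 P n : (size P <= n)%N -> (egf P)^`(n) = 0.
Proof. by move=> h; apply: derivn_poly0; rewrite (leq_trans (size_poly _ _)). Qed.

Definition disc_poly P : C -> C := fun z => if normc z < 1 then P.[z] else 0.

Lemma disc_polyE P z : disc z -> disc_poly P z = P.[z].
Proof. by rewrite /disc/= /disc_poly => ->. Qed.

Lemma holomorphic_disc_poly P : holomorphic_disc (disc_poly P).
Proof.
split=> z z1; last by rewrite /disc_poly; case: ifP.
have : has_deriv (disc_poly P) z P^`().[z].
  move=> e e0; have [d d0 hd] := horner_has_deriv P z e0.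
  exists (Num.min d (1 - normc z)); first by rewrite lt_min d0 subr_gt0.
  move=> w; rewrite lt_min => /andP[/hd h wz]; rewrite !disc_polyE//.
  by rewrite /disc/=; have := normcD (w - z) z; rewrite subrK; lra.
by move/has_deriv_derivable => [].
Qed.

Lemma scaled_disc z (t : R) : 0 <= t <= 1 -> disc z -> disc (rc t * z).
Proof.
move=> /andP[t0 t1] z1; rewrite /disc/= Normc.normcM normc_real_ge0//.
by apply: le_lt_trans z1; rewrite ler_piMl ?normc_ge0.
Qed.

Lemma integration_egf P : integration (disc_poly (egf P)) = disc_poly (egf (P * 'X)).
Proof.
apply/funext => z; rewrite /integration /disc_poly; case: ifP => // z1.
rewrite -[RHS]subr0 -[X in _ - X](egfMX_0 P) horner_ftc deriv_egfMX; congr (_ * _).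
by apply: eq_cintegral => t t01; have := scaled_disc t01 z1; rewrite /disc/= => ->.
Qed.

Lemma normc_integration_le f z m : cts_disc f -> disc z ->
  (forall t, 0 <= t <= 1 -> normc (f (rc t * z)) <= m) ->
  normc (integration f z) <= normc z * m.
Proof.
move=> cf z1 h; rewrite /integration z1 Normc.normcM ler_wpM2l ?normc_ge0//.
apply: normc_cintegral_le => //.
have := ccts_seg cf (@disc0 R) z1; congr ccts.
by apply/funext => t; rewrite add0r subr0.
Qed.

Lemma holomorphic_cts f : holomorphic_disc f -> cts_disc f.
Proof. by move=> hf z /(holomorphic_has_deriv hf)[L]; exact: has_deriv_cts. Qed.

Lemma ccts_ray f z : cts_disc f -> disc z -> ccts (fun t => f (rc t * z)).
Proof.
move=> cf z1; have := ccts_seg cf (@disc0 R) z1; congr ccts.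
by apply/funext => t; rewrite add0r subr0.
Qed.

Lemma integration_linear (c : C) f g : cts_disc f -> cts_disc g ->
  integration (c *: f + g) = c *: integration f + integration g.
Proof.
move=> cf cg; apply/funext => z.
rewrite [RHS](_ : _ = c * integration f z + integration g z)//.
rewrite /integration; case: ifP => [z1|_]; last by rewrite mulr0 addr0.
rewrite mulrCA -mulrDr; congr (_ * _); rewrite -cintegralZ; last exact: ccts_ray.
rewrite -cintegralD//; last exact: ccts_ray.
by apply: cctsZ; exact: ccts_ray.
Qed.

End PolynomialIntegration.

(** * Polynomials and integration in one weighted space *)

Section WeightedPolynomials.
Context {R : realType} (v : weight R).
Local Notation C := (Cplx R).
Local Notation rc := (real_complex R).
Implicit Types (f g : C -> C) (P Q : {poly C}) (z w : C).

Lemma weight_pos z : disc z -> 0 < v (normc z).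
Proof. by move=> z1; apply: weight_gt0; rewrite normc_ge0. Qed.

Lemma weight_le z w : normc w <= normc z -> disc z -> v (normc z) <= v (normc w).
Proof. by move=> wz z1; apply: weight_decreasing; rewrite ?normc_ge0. Qed.

Lemma weight_le0 z : disc z -> v (normc z) <= v 0.
Proof. by move=> z1; apply: weight_decreasing; rewrite ?normc_ge0. Qed.

Lemma weight_near0 e : 0 < e -> \forall r \near (1 : R)^'-, v r <= e.
Proof.
move=> e0; have /cvgrPdist_lt/(_ (e / 2)) h := @weight_cvg0 R v 1 isT.
have {}h := h (divr_gt0 e0 (ltr0n _ 2)); near=> r.
have r2 : 1 / 2 < r by near: r; apply: nbhs_left_gt; lra.
have /andP[r0 r1] : 0 < r < 1 by near: r; exact: near_left1.
have vr : 0 < v r by apply: weight_gt0; rewrite (ltW r0).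
have : `|0 - r ^+ 1 * v r| < e / 2 by near: r; exact: h.
have h0 : 0 <= r * v r by rewrite mulr_ge0// ltW.
by rewrite sub0r normrN expr1 ger0_norm//; nra.
Unshelve. all: by end_near. Qed.

Lemma near_left1P (A : R -> Prop) : (\forall r \near (1 : R)^'-, A r) ->
  exists2 s, 0 <= s < 1 & forall r, s < r -> r < 1 -> A r.
Proof.
rewrite near_withinE => /nbhs_ballP [d /= d0 hd].
exists (Num.max 0 (1 - d)); first by rewrite le_max lexx gt_max ltr01/=; lra.
move=> r; rewrite gt_max => /andP[r0 rd] r1; apply: hd => //.
by rewrite /ball/= ger0_norm ?subr_ge0 1?ltW//; lra.
Qed.

Lemma near_left1I (A : R -> Prop) s : s < 1 -> (forall r, s < r -> r < 1 -> A r) ->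
  \forall r \near (1 : R)^'-, A r.
Proof.
move=> s1 h; near=> r; apply: h; near: r; first exact: nbhs_left_gt.
exact: nbhs_left_lt.
Unshelve. all: by end_near. Qed.

Lemma H0_poly P : H0_set v (disc_poly P).
Proof.
apply/H0_setP; split; first exact: holomorphic_disc_poly.
move=> e e0; have [B B0 hB] := horner_bounded P 1.
have B1 : 0 < B + 1 by lra.
have /near_left1P[s /andP[s0 s1] hs] := weight_near0 (divr_gt0 e0 B1).
apply: (near_left1I s1) => r sr r1 z zr.
have z1 : disc z by rewrite /disc/= zr.
rewrite disc_polyE// -zr in r1 sr *.
have := hs _ sr r1; rewrite ler_pdivlMr// => h; apply: le_trans h.
rewrite ler_wpM2l//; first exact/ltW/weight_pos.
by apply: le_trans (hB z _) _; rewrite ?ltW//; lra.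
Qed.

Lemma wnorm_ge0 f : H0_set v f -> 0 <= wnorm v f.
Proof.
move=> hf; apply: le_trans (wnorm_ge hf (@disc0 R)).
by rewrite mulr_ge0 ?normc_ge0// ltW// weight_pos//; exact: disc0.
Qed.

(** The weight decreases along the ray, so a weighted bound at the points t z stays valid with the
    smaller weight at [z]; the remaining factor |z| is below 1. Thus integration does not increase
    weighted bounds. *)
Lemma integration_weight_le f z m : cts_disc f -> disc z ->
  (forall t, 0 <= t <= 1 -> v (normc (rc t * z)) * normc (f (rc t * z)) <= m) ->
  v (normc z) * normc (integration f z) <= m.
Proof.
move=> cf z1 h; have vz := weight_pos z1.
rewrite mulrC -ler_pdivlMr//; have m0 : 0 <= m / v (normc z).
  rewrite divr_ge0 ?(ltW vz)//; apply: le_trans (h 0 _); last by rewrite lexx ler01.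
  have z0 : disc (rc 0 * z) by apply: scaled_disc => //; rewrite lexx ler01.
  by rewrite mulr_ge0 ?normc_ge0// ltW// weight_pos.
apply: (@le_trans _ _ (normc z * (m / v (normc z)))); last by rewrite ler_piMl// ltW.
apply: normc_integration_le => // t t01; rewrite ler_pdivlMr// mulrC.
apply: le_trans (h t t01); rewrite ler_wpM2r ?normc_ge0// weight_le//.
case/andP: t01 => t0 t1; rewrite Normc.normcM normc_real_ge0// ler_piMl ?normc_ge0//.
Qed.

Lemma wnorm_integration_le f : H0_set v f -> wnorm v (integration f) <= wnorm v f.
Proof.
move=> hf; apply: wnorm_le => z z1; apply: integration_weight_le => //.
  by case: hf => /holomorphic_cts.
by move=> t t01; apply: wnorm_ge => //; exact: scaled_disc.
Qed.

(** On the part of the ray outside radius s the little-o condition for [f] applies directly; inside,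
    [f] is bounded by a fixed [m] and the weight at [z] itself is small. *)
Lemma H0_integration f : H0_set v f -> H0_set v (integration f).
Proof.
move=> /H0_setP[hf fo]; have cf := holomorphic_cts hf.
apply/H0_setP; split; first exact: holomorphic_integration.
move=> e e0; have /near_left1P[s /andP[s0 s1] hs] := fo e e0.
have [m0 hm0] := holomorphic_bounded hf s1.
pose m := `|m0| + 1; have mp : 0 < m by rewrite /m ltr_wpDl.
have hm z : normc z <= s -> normc (f z) <= m.
  move=> /hm0 h; apply: le_trans h _; rewrite /m.
  by apply: le_trans (ler_norm _) _; rewrite lerDl.
have /near_left1P[s' /andP[s'0 s'1] hs'] := weight_near0 (divr_gt0 e0 mp).
apply: (near_left1I s'1) => r sr r1 z zr.
have z1 : disc z by rewrite /disc/= zr.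
have vz := weight_pos z1; rewrite -zr in r1 sr *.
rewrite mulrC -ler_pdivlMr//.
apply: (@le_trans _ _ (normc z * (e / v (normc z)))); last first.
  by rewrite ler_piMl ?(ltW r1)// divr_ge0 ?ltW.
apply: normc_integration_le => // t t01; rewrite ler_pdivlMr// mulrC.
have w1 := scaled_disc t01 z1.
have wz : normc (rc t * z) <= normc z.
  by case/andP: t01 => t0 t1; rewrite Normc.normcM normc_real_ge0// ler_piMl ?normc_ge0.
have [ws|sw] := leP (normc (rc t * z)) s.
  have := hs' _ sr r1; rewrite ler_pdivlMr// => h; apply: le_trans h.
  by rewrite ler_wpM2l ?(ltW vz)// hm.
by apply: le_trans (hs _ sw w1 _ erefl); rewrite ler_wpM2r ?normc_ge0// weight_le.
Qed.

Lemma H0_iter_integration f n : H0_set v f -> H0_set v (iter n integration f).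
Proof. by move=> hf; elim: n => //= n IH; exact: H0_integration. Qed.

Definition nrm P : R := wnorm v (disc_poly P).

Lemma nrm_ge0 P : 0 <= nrm P. Proof. exact/wnorm_ge0/H0_poly. Qed.

Lemma nrm_ge P z : disc z -> v (normc z) * normc P.[z] <= nrm P.
Proof. by move=> z1; rewrite -(disc_polyE P z1); apply: wnorm_ge => //; exact: H0_poly. Qed.

Lemma nrm_le P m : (forall z, disc z -> v (normc z) * normc P.[z] <= m) -> nrm P <= m.
Proof. by move=> h; apply: wnorm_le => z z1; rewrite disc_polyE//; exact: h. Qed.

Lemma nrmD P Q : nrm (P + Q) <= nrm P + nrm Q.
Proof.
apply: nrm_le => z z1; apply: le_trans (lerD (nrm_ge P z1) (nrm_ge Q z1)).
by rewrite -mulrDr hornerD ler_wpM2l ?normcD// ltW// weight_pos.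
Qed.

Lemma nrmZ (c : C) P : nrm (c *: P) <= normc c * nrm P.
Proof.
apply: nrm_le => z z1; rewrite hornerZ Normc.normcM mulrCA.
by rewrite ler_wpM2l ?normc_ge0// nrm_ge.
Qed.

Lemma nrm_sum (I : Type) (s : seq I) (F : I -> {poly C}) :
  nrm (\sum_(i <- s) F i) <= \sum_(i <- s) nrm (F i).
Proof.
elim: s => [|i s IH]; last by rewrite !big_cons; apply: le_trans (nrmD _ _) _; rewrite lerD2l.
by rewrite !big_nil; apply: nrm_le => z _; rewrite horner0 Normc.normc0 mulr0.
Qed.

Lemma nrmXn n : nrm 'X^n <= v 0.
Proof.
apply: nrm_le => z z1; rewrite hornerXn normcX; apply: le_trans (weight_le0 z1).
by rewrite ler_piMr ?exprn_ile1 ?normc_ge0// ltW// weight_pos.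
Qed.

(** Each derivative costs one Cauchy estimate between [rho] and the midpoint of [rho] and 1. On
    compact discs the weight is bounded below, which starts the induction. *)
Lemma derivn_nrm n (rho : R) : 0 <= rho -> rho < 1 -> exists2 K, 0 <= K &
  forall P w, normc w <= rho -> normc (P^`(n)).[w] <= K * nrm P.
Proof.
elim: n rho => [|n IH] rho rho0 rho1.
  have vr : 0 < v rho by apply: weight_gt0; rewrite rho0.
  exists (v rho)^-1; first by rewrite invr_ge0 ltW.
  move=> P w wr; have w1 : disc w by exact: le_lt_trans rho1.
  rewrite derivn0 mulrC ler_pdivlMr// mulrC; apply: le_trans (nrm_ge P w1).
  by rewrite ler_wpM2r ?normc_ge0// weight_decreasing ?normc_ge0.
pose r := (rho + 1) / 2; have [rr r1] : rho < r /\ r < 1 by rewrite /r; split; lra.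
have [K K0 hK] := IH r (le_trans rho0 (ltW rr)) r1.
have [K' K'0 hK'] := @cauchy_estimate R rho r rho0 rr.
exists (K' * K); first exact: mulr_ge0.
move=> P w wr; rewrite derivnS -mulrA.
have hM z : normc z = r -> normc (P^`(n)).[z] <= K * nrm P.
  by move=> zr; apply: hK; rewrite zr.
by have [_ ->] := hK' _ _ hM.
Qed.

Lemma derivn_nrm_upto n : exists2 K, 0 <= K & forall P i w, (i <= n)%N ->
  normc w <= 1 / 2 -> normc (P^`(i)).[w] <= K * nrm P.
Proof.
elim: n => [|n [K K0 hK]].
  have [K K0 hK] := @derivn_nrm 0 (1/2) ltac:(lra) ltac:(lra).
  by exists K => // P i w; rewrite leqn0 => /eqP ->; exact: hK.
have [K' K'0 hK'] := @derivn_nrm n.+1 (1/2) ltac:(lra) ltac:(lra).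
exists (K + K'); first exact: addr_ge0.
move=> P i w; rewrite leq_eqVlt mulrDl => /predU1P[-> wr|].
  by apply: le_trans (hK' P w wr) _; rewrite lerDr mulr_ge0// nrm_ge0.
rewrite ltnS => hi wr; apply: le_trans (hK P i w hi wr) _.
by rewrite lerDl mulr_ge0// nrm_ge0.
Qed.

End WeightedPolynomials.

(** * Convolution and integration by parts through explicit antiderivatives *)

Section Duhamel.
Context {R : realType}.
Local Notation C := (Cplx R).
Local Notation rc := (real_complex R).
Implicit Types (P Q A B F G : {poly C}) (z w : C).

Lemma deriv_reflect P (z : C) : (P \Po (z%:P - 'X))^`() = - (P^`() \Po (z%:P - 'X)).
Proof. by rewrite deriv_comp derivB derivC derivX sub0r mulrN1. Qed.

Lemma horner_reflect P (z t : C) : (P \Po (z%:P - 'X)).[t] = P.[z - t].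
Proof. by rewrite horner_comp hornerD hornerN hornerC hornerX. Qed.

(** The convolution of A(J)1 and B(J)1 is J A(J) B(J) 1. The antiderivative [W] comes from moving
    all derivatives off the B factor by parts: the terms telescope, and the derivatives of [egf A]
    at 0, which appear at t = z, are the coefficients of [A]. *)
Lemma egf_convolution A B z : exists W : {poly C}, [/\
  forall t, W^`().[t] = (egf A).[z - t] * (egf B).[t], W.[0] = 0 &
  W.[z] = (egf (A * B * 'X)).[z]].
Proof.
pose T l : {poly C} := ((egf A)^`(l) \Po (z%:P - 'X)) * egf (B * 'X^l).
pose W := \sum_(l < size A) ((egf A)^`(l) \Po (z%:P - 'X)) * egf (B * 'X ^+ l.+1).
have dW : W^`() = T 0%N - T (size A).
  rewrite -[RHS]opprB -(telescope_sumr T (leq0n _)) big_mkord -sumrN /W raddf_sum/=.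
  apply: eq_bigr => l _; rewrite /T derivM deriv_reflect -derivnS.
  have -> : (egf (B * 'X ^+ l.+1))^`() = egf (B * 'X^l) by rewrite exprSr mulrA deriv_egfMX.
  by rewrite mulNr opprB addrC.
exists W; split.
- move=> t; rewrite dW /T derivn0 expr0 mulr1 derivn_egf_eq0// comp_poly0 mul0r subr0.
  by rewrite hornerM horner_reflect.
- rewrite /W horner_sum big1// => l _; rewrite hornerM.
  by rewrite exprSr mulrA egfMX_0 mulr0.
rewrite /W horner_sum; transitivity (\sum_(l < size A) (A`_l *: egf (B * 'X ^+ l.+1)).[z]).
  by apply: eq_bigr => l _; rewrite hornerM horner_reflect subrr derivn_egf_0 hornerZ.
rewrite -horner_sum; congr (_.[z]); rewrite -[A in RHS]coefK poly_def !mulr_suml egf_sum.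
apply: eq_bigr => l _; rewrite -egfZ; congr egf.
by rewrite -!scalerAl exprSr mulrA [B * 'X^l]mulrC.
Qed.

(* Integrating by parts [n.+1] times moves the derivatives from [G] to [F]. *)
Lemma parts_polynomial n F G z : exists U : {poly C},
  (forall t, U^`().[t] = F^`(n.+1).[t] * G.[z - t] - F.[t] * G^`(n.+1).[z - t]) /\
  (forall t, U.[t] = \sum_(i < n.+1) F^`(i).[t] * G^`(n - i).[z - t]).
Proof.
pose T l : {poly C} := F^`(l) * (G^`(n.+1 - l) \Po (z%:P - 'X)).
exists (\sum_(i < n.+1) F^`(i) * (G^`(n - i) \Po (z%:P - 'X))); split=> t; last first.
  by rewrite horner_sum; apply: eq_bigr => i _; rewrite hornerM horner_reflect.
have -> : (\sum_(i < n.+1) F^`(i) * (G^`(n - i) \Po (z%:P - 'X)))^`() = T n.+1 - T 0%N.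
  rewrite -(telescope_sumr T (leq0n _)) big_mkord raddf_sum/=; apply: eq_bigr => i _.
  rewrite /T derivM deriv_reflect -!derivnS subSS mulrN.
  by rewrite subSn// -ltnS ltn_ord.
by rewrite /T subnn subn0 derivn0 hornerD hornerN !hornerM !horner_reflect.
Qed.

End Duhamel.

(** * Submultiplicativity of [nu] up to a constant *)

Section DuhamelNorm.
Context {R : realType} (v : weight R) (K : nat).
Local Notation C := (Cplx R).
Local Notation rc := (real_complex R).
Local Notation nrm := (nrm v).
Implicit Types (f g : C -> C) (P Q A B F G : {poly C}) (z w : C).

Lemma derivn_egfMXn B n : (egf (B * 'X^n))^`(n) = egf B.
Proof.
elim: n => [|n IH]; first by rewrite expr0 mulr1.
by rewrite derivSn exprSr mulrA deriv_egfMX.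
Qed.

Lemma poly_headE Q : Q = drop_poly 1 Q * 'X + (Q`_0)%:P.
Proof.
apply/polyP => i; rewrite coefD coefMX coefC coef_drop_poly.
by case: i => [|i] /=; rewrite ?add0r// addr0 addn1.
Qed.

Lemma egfC (c : C) : egf c%:P = c%:P.
Proof. by apply/polyP => -[|i]; rewrite coef_egf !coefC/= ?divr1// mul0r. Qed.

Lemma derivn_egfMXn1 Q : (egf (Q * 'X^K))^`(K.+1) = egf (drop_poly 1 Q).
Proof.
rewrite derivnS derivn_egfMXn {1}(poly_headE Q) egfD egfC derivD derivC addr0.
exact: deriv_egfMX.
Qed.

Definition nu P := nrm (egf (P * 'X^K)).

Lemma half_point z (t : R) : 0 <= t <= 1 -> disc z ->
  normc (rc t * (2^-1 * z)) <= 1 / 2 /\ normc (z - rc t * (2^-1 * z)) <= normc z.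
Proof.
rewrite /disc/= => /andP[t0 t1] z1; have n0 := normc_ge0 z; split.
  by rewrite !Normc.normcM -rc2V !normc_real_ge0 ?invr_ge0//; nra.
have -> : z - rc t * (2^-1 * z) = rc (1 - t * 2^-1) * z by rewrite rcB rcM rc2V rmorph1; ring.
by rewrite Normc.normcM normc_real_ge0; nra.
Qed.

Lemma normc_half z : disc z -> normc (2^-1 * z) <= 1 / 2.
Proof.
by rewrite /disc/= => z1; rewrite Normc.normcM -rc2V normc_real_ge0 ?invr_ge0//; lra.
Qed.

(** The factor [x] is meant for the far point z - t, where the weight at [z] is admissible, and [y]
    for the near point t, where Cauchy's estimates apply. *)
Lemma weighted_half_increment W (z : C) a b : disc z -> 0 <= a -> 0 <= b ->
  (forall t, 0 <= t <= 1 -> exists x y : C, [/\ W^`().[rc t * (2^-1 * z)] = x * y,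
     v (normc z) * normc x <= a & normc y <= b]) ->
  v (normc z) * normc (W.[2^-1 * z] - W.[0]) <= a * b.
Proof.
move=> z1 a0 b0 h; have vz := weight_pos v z1; have ab0 := mulr_ge0 a0 b0.
rewrite mulrC -ler_pdivlMr//; have m0 : 0 <= a * b / v (normc z) by rewrite divr_ge0// ltW.
apply: (@le_trans _ _ (normc (2^-1 * z) * (a * b / v (normc z)))); last first.
  by rewrite ler_piMl//; apply: le_trans (normc_half z1) _; lra.
apply: horner_increment_le => t /h [x [y [-> hx hy]]].
rewrite ler_pdivlMr// mulrC Normc.normcM mulrA.
by apply: ler_pM; rewrite ?normc_ge0// mulr_ge0 ?normc_ge0// ltW.
Qed.

(* Of the two arguments [t] and [z - t] in the convolution integral from 0 to z, one lies in
   the half [ |t| <= |z|/2 ] where derivatives are controlled by Cauchy's estimates;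
   the derivatives are moved onto that factor by parts. *)
Lemma nu_mul_le : exists2 c, 0 <= c & forall P Q, nu (P * Q) <= c * nu P * nu Q.
Proof.
have [k k0 hk] := derivn_nrm_upto v K.+1.
have v0 : 0 < v 0 by apply: weight_gt0; rewrite lexx ltr01.
(* One [k] for each of the terms [a], [b], [c], [d] below; the last summand is the boundary term at
   the midpoint, a sum of K + 1 products of derivatives. *)
exists (4 * k + v 0 * (K.+1%:R * k ^+ 2)).
  by rewrite addr_ge0 ?mulr_ge0 ?sqr_ge0// ltW.
move=> P Q; rewrite /nu; set F := egf (P * 'X^K); set G := egf (Q * 'X^K).
have F0 := nrm_ge0 v F; have G0 := nrm_ge0 v G.
apply: nrm_le => z z1; have vz := weight_pos v z1; have vz0 := weight_le0 v z1.
have [W [dW W0 Wz]] := egf_convolution (P * 'X^K) (drop_poly 1 Q) z.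
have [U [dU UE]] := parts_polynomial K F G z.
(* The constant term of [Q] is split off. The rest contributes the convolution of [F] with the
   derivative of order K + 1 of [G], whose antiderivative is [W]. *)
have E : egf (P * Q * 'X^K) = Q`_0 *: F + egf (P * 'X^K * drop_poly 1 Q * 'X).
  rewrite /F -egfZ -egfD {1}(poly_headE Q); congr egf.
  by rewrite -mul_polyC; ring.
pose h := 2^-1 * z.
have zh : z - h = h by rewrite /h; field.
(* Reflecting t to z - t carries the far half of the integral to the segment from 0 to h.
   Subtracting V from U cancels the term with derivatives of [G] at far points. *)
pose V := W \Po (z%:P - 'X).
have dUV t : (U - V)^`().[t] = F^`(K.+1).[t] * G.[z - t].
  rewrite derivB hornerD hornerN dU /V deriv_reflect hornerN horner_reflect dW.
  by rewrite (derivn_egfMXn1 Q) opprK subKr -/F subrK.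
have Q0 : normc Q`_0 <= k * nrm G.
  have -> : Q`_0 = G^`(K).[0] by rewrite derivn_egfMXn horner_coef0 coef_egf divr1.
  by apply: hk => //; rewrite Normc.normc0; lra.
(* [F] vanishes to order K at 0, so only i = K survives; the lost terms are those with derivatives
   of [G] at [z]. *)
have U0 : U.[0] = P`_0 * G.[z].
  rewrite UE big_ord_recr/= big1 ?add0r => [|i _].
    by rewrite subnn derivn0 subr0 derivn_egfMXn horner_coef0 coef_egf divr1.
  by rewrite derivn_egf_0 coefMXn ltn_ord mul0r.
have P0 : normc P`_0 <= k * nrm F.
  have -> : P`_0 = F^`(K).[0] by rewrite derivn_egfMXn horner_coef0 coef_egf divr1.
  by apply: hk => //; rewrite Normc.normc0; lra.
(* At the midpoint both arguments equal h, of modulus at most 1/2, so all derivatives are under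
   control. *)
have Uh : normc U.[h] <= K.+1%:R * (k * nrm F * (k * nrm G)).
  rewrite UE zh; apply: le_trans (normc_sum _ _ _) _.
  rewrite mulr_natl -[X in _ *+ X](card_ord K.+1) -sumr_const; apply: ler_sum => i _.
  rewrite Normc.normcM; apply: ler_pM; rewrite ?normc_ge0//; apply: hk; rewrite ?normc_half//.
    by rewrite ltnW// ltn_ord.
  by rewrite (leq_trans (leq_subr _ _)).
have I1 : v (normc z) * normc (W.[h] - W.[0]) <= nrm F * (k * nrm G).
  apply: weighted_half_increment => //; first exact: mulr_ge0.
  move=> t t01; exists F.[z - rc t * h], G^`(K.+1).[rc t * h]; split.
  - by rewrite dW derivn_egfMXn1.
  - have [_ zt] := half_point t01 z1; have zt1 := le_lt_trans zt z1.
    by apply: le_trans (nrm_ge v F zt1); rewrite ler_wpM2r ?normc_ge0// weight_le.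
  - by apply: hk => //; have [] := half_point t01 z1.
have I2 : v (normc z) * normc ((U - V).[h] - (U - V).[0]) <= nrm G * (k * nrm F).
  apply: weighted_half_increment => //; first exact: mulr_ge0.
  move=> t t01; exists G.[z - rc t * h], F^`(K.+1).[rc t * h]; split.
  - by rewrite dUV mulrC.
  - have [_ zt] := half_point t01 z1; have zt1 := le_lt_trans zt z1.
    by apply: le_trans (nrm_ge v G zt1); rewrite ler_wpM2r ?normc_ge0// weight_le.
  - by apply: hk => //; have [] := half_point t01 z1.
have -> : (egf (P * Q * 'X^K)).[z] = Q`_0 * F.[z] + (W.[h] - W.[0]) +
    ((U - V).[h] - (U - V).[0]) + P`_0 * G.[z] - U.[h].
  rewrite E [LHS]hornerD [X in X + _]hornerZ -Wz -U0 W0.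
  rewrite !hornerD !hornerN /V !horner_reflect zh !subr0.
  by ring.
have n1 := nrm_ge v F z1; have n2 := nrm_ge v G z1.
set a := Q`_0 * F.[z]; set b := W.[h] - W.[0]; set c := (U - V).[h] - _.
set d := P`_0 * G.[z].
have tri : normc (a + b + c + d - U.[h]) <= normc a + normc b + normc c + normc d + normc U.[h].
  apply: le_trans (normcD _ _) _; rewrite normcN lerD2r.
  apply: le_trans (normcD _ _) _; rewrite lerD2r.
  by apply: le_trans (normcD _ _) _; rewrite lerD2r normcD.
apply: le_trans (ler_wpM2l (ltW vz) tri) _; rewrite !mulrDr.
have A1 : v (normc z) * normc a <= k * nrm G * nrm F.
  by rewrite Normc.normcM mulrCA; apply: ler_pM; rewrite ?normc_ge0 ?mulr_ge0 ?normc_ge0// ltW.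
have A2 : v (normc z) * normc d <= k * nrm F * nrm G.
  by rewrite Normc.normcM mulrCA; apply: ler_pM; rewrite ?normc_ge0 ?mulr_ge0 ?normc_ge0// ltW.
have A3 : v (normc z) * normc U.[h] <= v 0 * (K.+1%:R * (k * nrm F * (k * nrm G))).
  by apply: ler_pM => //; rewrite ?normc_ge0// ltW.
apply: le_trans (lerD (lerD (lerD (lerD A1 I1) I2) A2) A3) _.
by rewrite le_eqVlt; apply/orP; left; apply/eqP; ring.
Qed.

End DuhamelNorm.

(** * Decay of powers of polynomials without constant term *)

Section Radical.
Context {R : realType} (v : weight R) (K : nat).
Local Notation C := (Cplx R).
Local Notation rc := (real_complex R).
Local Notation nu := (nu v K).
Implicit Types (f g : C -> C) (P Q A B F G : {poly C}) (z w : C).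

(** Once the index exceeds [x] the terms no longer increase, so the sum of the first ones is a
    bound. *)
Lemma pow_fact_bounded (x : R) : 0 <= x -> exists2 D, 0 <= D & forall k, x ^+ k / k`!%:R <= D.
Proof.
move=> x0; pose T k : R := x ^+ k / k`!%:R.
have T0 k : 0 <= T k by rewrite divr_ge0// exprn_ge0.
pose N := (Num.truncn x).+1.
have xN : x <= N%:R by rewrite ltW// /N truncnS_gt.
exists (\sum_(i < N.+1) T i); first by rewrite sumr_ge0.
have small k : (k <= N)%N -> T k <= \sum_(i < N.+1) T i.
  move=> kN; rewrite (bigD1 (Ordinal (kN : (k < N.+1)%N)))//= lerDl sumr_ge0//.
elim=> [|k IH]; first exact: (small 0%N).
have [kN|Nk] := leqP k.+1 N; first exact: (small k.+1).
apply: le_trans IH; rewrite -/(T k) exprS factS natrM invfM mulrACA.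
rewrite -[leRHS]mul1r; apply: ler_wpM2r; first exact: T0.
by rewrite ler_pdivrMr ?ltr0n// mul1r (le_trans xN)// ler_nat ltnW.
Qed.

Lemma nu_ge0 P : 0 <= nu P. Proof. exact: nrm_ge0. Qed.

Lemma nuD P Q : nu (P + Q) <= nu P + nu Q.
Proof. by rewrite /nu mulrDl egfD; exact: nrmD. Qed.

Lemma nu_sum (I : Type) (s : seq I) (F : I -> {poly C}) :
  nu (\sum_(i <- s) F i) <= \sum_(i <- s) nu (F i).
Proof. by rewrite /nu mulr_suml egf_sum; exact: nrm_sum. Qed.

Lemma nuZ (c : C) P : nu (c *: P) <= normc c * nu P.
Proof. by rewrite /nu -scalerAl egfZ; exact: nrmZ. Qed.

Lemma nuXn k : nu 'X^k <= v 0 / k`!%:R.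
Proof.
have -> : nu 'X^k = nrm v (((k + K)`!%:R : C)^-1 *: 'X^(k + K)).
  rewrite /nu -exprD; congr nrm; apply/polyP => i.
  by rewrite coef_egf coefZ coefXn; case: eqP => [->|_]; rewrite ?mul1r ?mulr1// mul0r mulr0.
apply: le_trans (nrmZ _ _ _) _; rewrite Normc.normcV normc_nat mulrC.
apply: ler_pM; rewrite ?nrm_ge0 ?invr_ge0//; first exact: nrmXn.
rewrite lef_pV2 ?posrE ?ltr0n ?fact_gt0// ler_nat leq_fact//.
by rewrite leq_addr.
Qed.

(** Write A0 = A1 X. In nu(A1^k X^k) the factorial from X^k beats any geometric growth of A1^k, so
    the powers of A0 decay like 4^-k. Adding a perturbation of size 1/4 and expanding binomially
    gives (1/4 + 1/4)^n. The radius [c] does not depend on [A0]; only [D] does. *)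
Lemma quasinilpotent : exists2 c, 0 < c & forall A0, A0`_0 = 0 -> exists2 D, 0 <= D &
  forall A n, nu (A - A0) <= c -> nu (A ^+ n) <= D / 2 ^+ n.
Proof.
have [c0 c00 hc] := nu_mul_le v K; pose c := c0 + 1.
have cp : 0 < c by rewrite /c; lra.
pose mu P := c * nu P.
have mu0 P : 0 <= mu P by rewrite mulr_ge0 ?nu_ge0// ltW.
have muM P Q : mu (P * Q) <= mu P * mu Q.
  have := hc P Q; have := nu_ge0 P; have := nu_ge0 Q; rewrite /mu => h1 h2 h3.
  have h4 := mulr_ge0 h2 h1.
  have -> : c * nu P * (c * nu Q) = c * (c0 * nu P * nu Q + nu P * nu Q) by rewrite /c; ring.
  by rewrite ler_pM2l//; lra.
(* [mu] is submultiplicative but the unit may have [mu 1] above 1, so the empty power needs a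
   constant. *)
pose m1 := 1 + mu 1; have m11 : 1 <= m1 by rewrite lerDl.
have muX P n : mu (P ^+ n) <= m1 * mu P ^+ n.
  elim: n => [|n IH]; first by rewrite !expr0 mulr1 lerDr.
  rewrite !exprS; apply: le_trans (muM _ _) _; rewrite [leRHS]mulrCA.
  by rewrite ler_wpM2l.
exists (1 / 4 / c); first by rewrite divr_gt0//; lra.
move=> A0 A00; pose A1 := drop_poly 1 A0.
have A0E : A0 = A1 * 'X by rewrite [LHS]poly_headE A00 polyC0 addr0.
have [D' D'0 hD'] := pow_fact_bounded (mulr_ge0 (ler0n R 4) (mu0 A1)).
pose D := c * v 0 * m1 * D'.
have v0 : 0 < v 0 by apply: weight_gt0; rewrite lexx ltr01.
have m10 : 0 <= m1 by lra.
have cv0 : 0 <= c * v 0 * m1 by rewrite mulr_ge0// mulr_ge0// ltW.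
have D0 : 0 <= D by rewrite mulr_ge0.
have q0 : 0 <= 1 / 4 :> R by lra.
have hA0 k : mu (A0 ^+ k) <= D * (1 / 4) ^+ k.
  rewrite A0E exprMn; apply: le_trans (muM _ _) _.
  have h1 := muX A1 k; have h2 : mu 'X^k <= c * (v 0 / k`!%:R).
    by rewrite ler_pM2l// nuXn.
  apply: le_trans (ler_pM (mu0 _) (mu0 _) h1 h2) _.
  have -> : m1 * mu A1 ^+ k * (c * (v 0 / k`!%:R)) =
     c * v 0 * m1 * ((4 * mu A1) ^+ k / k`!%:R) * (1 / 4) ^+ k.
    (* The decay 4^-k is borrowed here and repaid by the bound [D'] on (4 mu A1)^k / k!. *)
    have -> : mu A1 ^+ k = (4 * mu A1) ^+ k * (1 / 4) ^+ k.
      by rewrite -exprMn; congr (_ ^+ _); field.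
    by ring.
  rewrite ler_wpM2r ?exprn_ge0//.
  by rewrite ler_wpM2l.
exists (D * m1 / c); first by apply: divr_ge0; [exact: mulr_ge0|exact: ltW].
move=> A n hB; set B := A - A0 in hB.
have {}hB : mu B <= 1 / 4 by rewrite /mu mulrC -ler_pdivlMr.
suff : mu (A ^+ n) <= D * m1 / 2 ^+ n.
  by rewrite /mu mulrC -ler_pdivlMr// mulrAC.
have -> : A = A0 + B by rewrite addrC subrK.
rewrite exprDn.
apply: (@le_trans _ _ (\sum_(i < n.+1) mu (A0 ^+ (n - i) * B ^+ i *+ 'C(n, i)))).
  by rewrite /mu -mulr_sumr ler_wpM2l ?(ltW cp)//; exact: nu_sum.
apply: (@le_trans _ _ (\sum_(i < n.+1) D * m1 * ((1 / 4) ^+ (n - i) * (1 / 4) ^+ i *+ 'C(n, i)))).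
  apply: ler_sum => i _.
  have h1 : mu (A0 ^+ (n - i) * B ^+ i *+ 'C(n, i)) <= mu (A0 ^+ (n - i) * B ^+ i) *+ 'C(n, i).
    rewrite -scaler_nat /mu -mulrnAr ler_wpM2l ?(ltW cp)//.
    by apply: le_trans (nuZ _ _) _; rewrite normc_nat mulr_natl.
  apply: le_trans h1 _; rewrite mulrnAr lerMn2r; apply/orP; right.
  apply: le_trans (muM _ _) _.
  have -> : D * m1 * ((1 / 4) ^+ (n - i) * (1 / 4) ^+ i) =
    D * (1 / 4) ^+ (n - i) * (m1 * (1 / 4) ^+ i) by ring.
  apply: ler_pM => //; apply: le_trans (muX _ _) _; rewrite ler_wpM2l//.
  by rewrite lerXn2r ?nnegrE ?mu0.
rewrite -mulr_sumr -exprDn; have -> : 1 / 4 + 1 / 4 = 2^-1 :> R by lra.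
by rewrite exprVn.
Qed.

End Radical.

(** * Density of polynomials and approximation by P(J) f *)

Section CyclicVectors.
Context {R : realType} (v : weight R).
Local Notation C := (Cplx R).
Local Notation rc := (real_complex R).
Implicit Types (f g : C -> C) (P Q A B F G : {poly C}) (z w : C).

Definition near_poly e f P := forall z, disc z -> v (normc z) * normc (f z - P.[z]) <= e.

Lemma scaled_poly (rho : R) P : exists Q : {poly C},
  (forall j, Q`_j = P`_j * rc rho ^+ j) /\ forall z, Q.[z] = P.[rc rho * z].
Proof.
exists (\poly_(i < size P) (P`_i * rc rho ^+ i)); split=> [j|z].
  by rewrite coef_poly; case: ltnP => // /(nth_default 0) ->; rewrite mul0r.
by rewrite horner_poly horner_coef; apply: eq_bigr => i _; rewrite exprMn mulrA.
Qed.

(* The approximants are polynomials close to the dilations [f (rho z)], [rho < 1]. *)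
Lemma H0_dense f n e : H0_set v f -> (forall j, (j < n)%N -> derive1n j f 0 = 0) -> 0 < e ->
  exists2 P : {poly C}, (forall j, (j < n)%N -> P`_j = 0) & near_poly e f P.
Proof.
move=> /H0_setP[hf fo] fn e0; have lf := holomorphic_poly_limit hf.
have v0 : 0 < v 0 by apply: weight_gt0; rewrite lexx ltr01.
(* The approximant [P] on the dilated disc costs [e'], the dilation of [f] at most 2 e'. *)
pose e' := e / 4; have e'0 : 0 < e' by rewrite /e'; lra.
have /near_left1P[s0 /andP[s00 s01] hs] := fo e' e'0.
pose s := (1 + s0) / 2; have [ss s1] : s0 < s /\ s < 1 by rewrite /s; split; lra.
pose e2 := e' / v 0; have e20 : 0 < e2 by rewrite divr_gt0.
have ve2 : v 0 * e2 = e' by rewrite /e2 mulrC divfK// gt_eqF.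
have [d d0 hd] := uniformly_cts (holomorphic_cts hf) s1 e20.
(* With rho = 1 - m, the first bound keeps rho z within d of z; the second keeps rho |z| above s0
   whenever |z| > s, so that both [f z] and its dilation are small there in weight. *)
pose m := Num.min (d / 2) ((s - s0) / 2).
have m0 : 0 < m by rewrite /m lt_min !divr_gt0// subr_gt0.
have [md ms] : m <= d / 2 /\ m <= (s - s0) / 2 by rewrite /m; split; rewrite ge_min lexx ?orbT.
pose rho := 1 - m; have [rho0 rho1] : 0 < rho /\ rho < 1 by rewrite /rho /s in ms *; split; lra.
have [P Pn hP] := @poly_limit_vanish R f n rho e2 lf fn rho0 rho1 e20.
have [Q [Qj Qz]] := scaled_poly rho P.
exists Q => [j jn|z z1]; first by rewrite Qj Pn// mul0r.
have vz := weight_pos v z1; have vz0 := weight_le0 v z1; rewrite Qz.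
rewrite /disc/= in z1; have n0 := normc_ge0 z.
have nw : normc (rc rho * z) = rho * normc z by rewrite Normc.normcM normc_real_ge0// ltW.
have wr : normc (rc rho * z) <= rho by rewrite nw ler_piMr// ltW.
have w1 : disc (rc rho * z) by exact: le_lt_trans rho1.
have h1 : normc (P.[rc rho * z] - f (rc rho * z)) <= e2 by exact: hP.
have h1v : v (normc z) * normc (P.[rc rho * z] - f (rc rho * z)) <= e'.
  rewrite -ve2; apply: ler_pM => //; rewrite ?normc_ge0//; exact: ltW.
have tri : normc (f z - P.[rc rho * z]) <=
    normc (f z - f (rc rho * z)) + normc (P.[rc rho * z] - f (rc rho * z)).
  have := normcD (f z - f (rc rho * z)) (f (rc rho * z) - P.[rc rho * z]).
  by rewrite addrA subrK (normcB (f (rc rho * z)) P.[rc rho * z]).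
apply: le_trans (ler_wpM2l (ltW vz) tri) _; rewrite mulrDr.
suff h2 : v (normc z) * normc (f z - f (rc rho * z)) <= 2 * e' by rewrite /e' in h2 h1v *; lra.
have [zs|sz] := leP (normc z) s.
  have : normc (f (rc rho * z) - f z) <= e2.
    apply: hd => //; have -> : rc rho * z - z = - (rc m * z) by rewrite /rho rcB rmorph1; ring.
    by rewrite normcN Normc.normcM normc_real_ge0 ?ltW//; nra.
  rewrite normcB => h; have : v (normc z) * normc (f z - f (rc rho * z)) <= v 0 * e2.
    by apply: ler_pM => //; rewrite ?normc_ge0//; exact: ltW.
  by rewrite ve2; lra.
have h3 : v (normc z) * normc (f z) <= e' by apply: (hs (normc z)) => //; lra.
have h4 : v (normc (rc rho * z)) * normc (f (rc rho * z)) <= e'.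
  by apply: (hs (normc (rc rho * z))) => //; rewrite nw /rho; nra.
have h5 : v (normc z) * normc (f (rc rho * z)) <= e'.
  apply: le_trans h4; rewrite ler_wpM2r ?normc_ge0// weight_le//.
  by rewrite nw ler_piMl// ltW.
have := ler_wpM2l (ltW vz) (normcD (f z) (- f (rc rho * z))).
by rewrite normcN mulrDr; lra.
Qed.

Definition poly_action P f : C -> C := \sum_(i < size P) P`_i *: iter i (@integration R) f.

Lemma poly_actionE P f z : poly_action P f z = \sum_(i < size P) P`_i * iter i (@integration R) f z.
Proof. by rewrite /poly_action fct_sumE. Qed.

Lemma holomorphic_iter_integration f n : holomorphic_disc f ->
  holomorphic_disc (iter n (@integration R) f).
Proof. by move=> hf; elim: n => //= n IH; exact: holomorphic_integration. Qed.

Lemma iter_integration_near e f Q n : holomorphic_disc f -> near_poly e f (egf Q) ->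
  near_poly e (iter n (@integration R) f) (egf (Q * 'X^n)).
Proof.
move=> hf h; elim: n => [|n IH]; first by rewrite expr0 mulr1.
have cn := holomorphic_cts (holomorphic_iter_integration n hf).
have cp := holomorphic_cts (holomorphic_disc_poly (egf (Q * 'X^n))).
move=> z z1 /=; rewrite exprSr mulrA -(disc_polyE _ z1) -integration_egf.
have -> : integration (iter n (@integration R) f) z - integration (disc_poly (egf (Q * 'X^n))) z =
   integration (-1 *: disc_poly (egf (Q * 'X^n)) + iter n (@integration R) f) z.
  by rewrite integration_linear// !fctE /= scaleN1r addrC.
apply: integration_weight_le => //.
  have [_] := @holomorphic_submod R.
  move=> /(_ (-1) (disc_poly (egf (Q * 'X^n))) (iter n (@integration R) f)).
  rewrite !inE => hD; apply/holomorphic_cts/hD; first exact: holomorphic_disc_poly.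
  exact: holomorphic_iter_integration.
move=> t t01; have w1 := scaled_disc t01 z1; apply: le_trans (IH _ w1).
by rewrite !fctE scaleN1r disc_polyE// addrC.
Qed.

(** Each power of J preserves the error [e], and the coefficients are simply summed. This crude
    factor is not bounded by [nu P], so the approximant of [f] has to be refined after [P] is
    known. *)
Lemma poly_action_near e f P Q : holomorphic_disc f -> near_poly e f (egf Q) ->
  near_poly ((\sum_(i < size P) normc P`_i) * e) (poly_action P f) (egf (P * Q)).
Proof.
move=> hf h z z1; rewrite poly_actionE.
have -> : (egf (P * Q)).[z] = \sum_(i < size P) P`_i * (egf (Q * 'X^i)).[z].
  rewrite -[in LHS](coefK P) poly_def mulr_suml egf_sum horner_sum.
  by apply: eq_bigr => i _; rewrite -scalerAl egfZ hornerZ [_ * Q]mulrC.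
rewrite -sumrB; have vz := weight_pos v z1.
apply: le_trans (ler_wpM2l (ltW vz) (normc_sum _ _ _)) _.
rewrite mulr_sumr mulr_suml; apply: ler_sum => i _.
rewrite -mulrBr Normc.normcM mulrCA ler_wpM2l ?normc_ge0//.
exact: (iter_integration_near _ hf h).
Qed.

Lemma near_poly_nrm e f P Q : near_poly e f P -> near_poly e f Q -> nrm v (P - Q) <= e + e.
Proof.
move=> hP hQ; apply: nrm_le => z z1; have vz := weight_pos v z1.
apply: le_trans (lerD (hP z z1) (hQ z z1)); rewrite -mulrDr ler_wpM2l ?(ltW vz)//.
rewrite hornerD hornerN (normcB (f z) P.[z]).
by have := normcD (P.[z] - f z) (f z - Q.[z]); rewrite addrA subrK.
Qed.

Lemma near_poly_trans e d f P Q : near_poly e f P -> nrm v (P - Q) <= d -> near_poly (e + d) f Q.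
Proof.
move=> hP hd z z1; have vz := weight_pos v z1.
apply: le_trans (lerD (hP z z1) (le_trans (nrm_ge v (P - Q) z1) hd)).
rewrite -mulrDr ler_wpM2l ?(ltW vz)// hornerD hornerN.
by have := normcD (f z - P.[z]) (P.[z] - Q.[z]); rewrite addrA subrK.
Qed.

(* Neumann series for the Duhamel inverse of [f]. *)
Lemma poly_action_dense K f G e : H0_set v f ->
  (forall d, 0 < d -> exists2 A : {poly C}, A`_0 = 0 & near_poly d f (egf ((1 - A) * 'X^K))) ->
  0 < e -> exists P, near_poly e (poly_action P f) (egf (G * 'X^K)).
Proof.
move=> hf hA e0; have hol : holomorphic_disc f by case: hf.
have [c c0 hc] := nu_mul_le v K; have [q q0 hq] := quasinilpotent v K.
have [A0 A00 nA0] := hA (q / 2) (divr_gt0 q0 (ltr0n _ 2)).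
have [D D0 hD] := hq A0 A00.
have diff d A A' : near_poly d f (egf ((1 - A) * 'X^K)) ->
    near_poly d f (egf ((1 - A') * 'X^K)) -> nu v K (A - A') <= d + d.
  move=> h h'; have := near_poly_nrm h' h; rewrite -egfB -mulrBl.
  by have -> : 1 - A' - (1 - A) = A - A' by ring.
have pw A n : near_poly (q / 2) f (egf ((1 - A) * 'X^K)) -> nu v K (A ^+ n) <= D / 2 ^+ n.
  by move=> h; apply: hD; apply: le_trans (diff _ _ _ h nA0) _; lra.
have G0 := nu_ge0 v K G.
(* L bounds [nu P] for any admissible [A], since the series of D / 2^i sums to 2 D. Being
   independent of [A], it may enter the choice of [d1]. *)
pose L := c * nu v K G * (D * 2); have L0 : 0 <= L by rewrite !mulr_ge0.
pose d1 := Num.min (q / 2) (e / (8 * (c * L + 1))).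
have cL : 0 < 8 * (c * L + 1) by have := mulr_ge0 c0 L0; lra.
have d10 : 0 < d1 by rewrite lt_min !divr_gt0.
have [A A00' nA] := hA d1 d10.
have nAq : near_poly (q / 2) f (egf ((1 - A) * 'X^K)).
  by move=> z z1; apply: le_trans (nA z z1) _; rewrite ge_min lexx.
have [n hn] : exists n, c * nu v K G * D / 2 ^+ n <= e / 4.
  have := @cvg_geometric R (c * nu v K G * D) 2^-1.
  rewrite ger0_norm ?invr_ge0// invf_lt1 ?ltr1n// => /(_ isT) /cvgrPdist_lt/(_ (e / 4)).
  rewrite divr_gt0// => /(_ isT) [n _ /(_ n (leqnn n))].
  rewrite sub0r normrN /geometric/= exprVn => h.
  by exists n; apply: ltW; apply: le_lt_trans (ler_norm _) h.
pose P := G * \sum_(i < n) A ^+ i; exists P.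
have PE : (1 - A) * P = G - G * A ^+ n.
  have -> : (1 - A) * P = G * ((1 - A) * \sum_(i < n) A ^+ i) by rewrite /P; ring.
  by rewrite -[1 - A]opprB mulNr -subrX1; ring.
have nuP : nu v K P <= L.
  apply: le_trans (hc _ _) _; rewrite /L ler_wpM2l ?mulr_ge0//.
  apply: le_trans (nu_sum _ _ _ _) _.
  apply: (@le_trans _ _ (\sum_(i < n) D * 2^-1 ^+ i)).
    by apply: ler_sum => i _; rewrite exprVn; exact: pw.
  rewrite -mulr_sumr ler_wpM2l//; have h2 : (1 - 2^-1)^-1 = 2 :> R by field.
  have h3 := @geometric_sum_le R 2^-1 n ltac:(lra) ltac:(lra).
  by rewrite h2 in h3.
pose S := \sum_(i < size P) normc P`_i.
have S0 : 0 <= S by rewrite sumr_ge0// => i _; rewrite normc_ge0.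
have S1 : 0 < 4 * (S + 1) by lra.
(* [P] is now fixed, so the error of the second approximant [A'] can be made small against the sum
   [S] of its coefficients, while [A'] stays d1-close to [f] and hence near [A]. *)
pose d2 := Num.min d1 (e / (4 * (S + 1))).
have d20 : 0 < d2 by rewrite lt_min d10 divr_gt0.
have [A' _ nA'] := hA d2 d20.
have nA'1 : near_poly d1 f (egf ((1 - A') * 'X^K)).
  by move=> z z1; apply: le_trans (nA' z z1) _; rewrite ge_min lexx.
have h1 := poly_action_near P hol nA'.
have h2 : nrm v (egf (P * ((1 - A') * 'X^K)) - egf (G * 'X^K)) <= c * L * (d1 + d1) + e / 4.
  rewrite -egfB mulrA -mulrBl -/(nu v K _).
  (* The first term is the change of approximant, the second the truncated tail of the Neumann
     series. *)
  have -> : P * (1 - A') - G = P * (A - A') + (-1) *: (G * A ^+ n).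
    rewrite scaleN1r; have -> : P * (1 - A') - G = P * (A - A') + ((1 - A) * P - G) by ring.
    by rewrite PE; ring.
  apply: le_trans (nuD _ _ _ _) _; apply: lerD.
    apply: le_trans (hc _ _) _; apply: ler_pM; rewrite ?mulr_ge0 ?nu_ge0//.
      by rewrite ler_wpM2l.
    exact: diff.
  apply: le_trans (nuZ _ _ _ _) _; rewrite normcN Normc.normc1 mul1r.
  apply: le_trans (hc _ _) _; apply: le_trans hn; rewrite -[leRHS]mulrA.
  by rewrite ler_wpM2l ?mulr_ge0//; exact: pw.
have h3 := near_poly_trans h1 h2.
move=> z z1; apply: le_trans (h3 z z1) _; rewrite -/S.
have b1 : S * d2 <= e / 4.
  apply: (@le_trans _ _ (S * (e / (4 * (S + 1))))).
    by rewrite ler_wpM2l// ge_min lexx orbT.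
  by rewrite mulrA ler_pdivrMr//; nra.
have b2 : c * L * (d1 + d1) <= e / 4.
  apply: (@le_trans _ _ (c * L * (2 * (e / (8 * (c * L + 1)))))).
    rewrite ler_wpM2l ?mulr_ge0// mulr_natl mulr2n.
    by apply: lerD; rewrite ge_min lexx orbT.
  have := mulr_ge0 c0 L0; set x := c * L => x0; have x1 : 0 < x + 1 by lra.
  have -> : x * (2 * (e / (8 * (x + 1)))) = e / 4 * (x / (x + 1)) by field; rewrite gt_eqF.
  by rewrite ler_piMr//; [lra|rewrite ler_pdivrMr//; lra].
lra.
Qed.

Lemma iter_integrationZ (c : C) f n : holomorphic_disc f ->
  iter n (@integration R) (c *: f) = c *: iter n (@integration R) f.
Proof.
move=> hf; elim: n => //= n ->; have cf := holomorphic_cts (holomorphic_iter_integration n hf).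
have c0 : cts_disc (0 : C -> C).
  by move=> z _ e e0; exists 1 => // w _; rewrite subrr Normc.normc0.
have i0 : integration (0 : C -> C) = 0.
  apply/funext => z; rewrite /integration; case: ifP => // _.
  by rewrite (cintegral_cst 0) mulr0.
by have := integration_linear c cf c0; rewrite i0 !addr0.
Qed.

Lemma poly_actionZ (c : C) P f : c != 0 -> holomorphic_disc f ->
  poly_action P (c *: f) = poly_action (c *: P) f.
Proof.
move=> c0 hf; rewrite /poly_action size_scale//; apply: eq_bigr => i _.
by rewrite iter_integrationZ// coefZ scalerA mulrC.
Qed.

(** Dividing [f] by its derivative c of order K makes its approximants of the form (1 - A)(J) J^K 1
    with A(0) = 0, so the Neumann series applies. The target [g] is first replaced by a polynomial
    with a zero of order K. *)
Lemma cyclic_vector K f g e : H0_set v f -> H0_set v g ->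
  (forall j, (j < K)%N -> derive1n j f 0 = 0) -> derive1n K f 0 <> 0 ->
  (forall j, (j < K)%N -> derive1n j g 0 = 0) -> 0 < e ->
  exists P, forall z, disc z -> v (normc z) * normc (poly_action P f z - g z) <= e.
Proof.
move=> hf hg fK /eqP cn0 gK e0; set c := derive1n K f 0 in cn0.
have hol : holomorphic_disc f by case: hf.
have v0 : 0 < v 0 by apply: weight_gt0; rewrite lexx ltr01.
have shape P : (forall j, (j < K)%N -> P`_j = 0) -> exists2 B : {poly C},
    P = egf (B * 'X^K) & B`_0 = P`_K * K`!%:R.
  move=> Pj; exists (drop_poly K (egf_inv P)); last by rewrite coef_drop_poly add0n coef_egf_inv.
  rewrite -[LHS]egf_invK -[in LHS](poly_take_drop K (egf_inv P)).
  suff -> : take_poly K (egf_inv P) = 0 by rewrite add0r.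
  apply/polyP => i; rewrite coef_take_poly coef0; case: ifP => // iK.
  by rewrite coef_egf_inv Pj// mul0r.
have hA d : 0 < d -> exists2 A : {poly C}, A`_0 = 0 &
    near_poly d (c^-1 *: f) (egf ((1 - A) * 'X^K)).
  move=> d0; have [r [k [r0 r1 k0 hk]]] := coef_close (R := R) K.
  have vr : 0 < v r by apply: weight_gt0; rewrite ltW.
  have nc : 0 < normc c by rewrite normc_gt0.
  (* An approximation with weighted error d' is within d' / v r of [f] on the disc of radius r, so
     its normalised coefficient of order K misses c by at most k d' / v r. Correcting it costs that
     times the norm of J^K 1, which is at most [v 0]. *)
  pose M := 1 + k / v r * v 0.
  have M0 : 0 < M by rewrite /M ltr_wpDr// mulr_ge0 ?divr_ge0// ltW.
  pose d' := d * normc c / M; have d'0 : 0 < d' by rewrite !divr_gt0// mulr_gt0.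
  have [P Pj hP] := H0_dense hf fK d'0; have [B PB B0] := shape P Pj.
  have hB : normc (B`_0 - c) <= k * (d' / v r).
    rewrite B0 mulr_natr; apply: hk; first exact: holomorphic_poly_limit.
    move=> z zr; have z1 : disc z by exact: le_lt_trans r1.
    rewrite normcB ler_pdivlMr// mulrC; apply: le_trans (hP z z1).
    by rewrite ler_wpM2r ?normc_ge0// weight_decreasing ?normc_ge0.
  (* The constant coefficient of [B] is reset to exactly c, which forces A(0) = 0. *)
  exists (1 - c^-1 *: (B - (B`_0 - c)%:P)).
    have one0 : (1 : {poly C})`_0 = 1 by rewrite coef1.
    by rewrite coefB one0 coefZ coefB coefC eqxx opprB addrCA subrr addr0 mulVf// subrr.
  move=> z z1; have vz := weight_pos v z1.
  have -> : (c^-1 *: f) z = c^-1 * f z by [].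
  rewrite opprB addrCA subrr addr0 -scalerAl egfZ hornerZ -mulrBr Normc.normcM Normc.normcV.
  rewrite mulrCA ler_pdivrMl//.
  have -> : f z - (egf ((B - (B`_0 - c)%:P) * 'X^K)).[z] =
     (f z - P.[z]) + (B`_0 - c) * (egf 'X^K).[z].
    by rewrite mulrBl egfB -PB hornerD hornerN mul_polyC egfZ hornerZ; ring.
  apply: le_trans (ler_wpM2l (ltW vz) (normcD _ _)) _; rewrite mulrDr.
  have h1 := hP z z1.
  have h2 : v (normc z) * normc (egf 'X^K).[z] <= v 0.
    have -> : (egf 'X^K : {poly C}) = egf ('X^0 * 'X^K) by rewrite expr0 mul1r.
    apply: le_trans (nrm_ge v _ z1) _; apply: le_trans (nuXn v K 0) _.
    by rewrite fact0 divr1.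
  have h3 : v (normc z) * normc ((B`_0 - c) * (egf 'X^K).[z]) <= k * (d' / v r) * v 0.
    rewrite Normc.normcM mulrCA; apply: ler_pM; rewrite ?normc_ge0//.
    by rewrite mulr_ge0 ?normc_ge0// ltW.
  apply: le_trans (lerD h1 h3) _.
  have -> : d' + k * (d' / v r) * v 0 = d' * M by rewrite /M; ring.
  by rewrite /d' divfK ?gt_eqF// mulrC.
have [Q Qj hQ] := H0_dense hg gK (divr_gt0 e0 (ltr0n _ 2)); have [G QG _] := shape Q Qj.
have c10 : c^-1 != 0 by rewrite invr_eq0.
have hcf : H0_set v (c^-1 *: f).
  have [_ /(_ c^-1 f 0)] := H0_submod v; have [+ _] := H0_submod v.
  by rewrite !inE addr0 => h0; apply.
have [P hP] := @poly_action_dense K _ G (e / 2) hcf hA (divr_gt0 e0 (ltr0n _ 2)).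
exists (c^-1 *: P) => z z1; rewrite -poly_actionZ//.
have h1 := hP z z1; have h2 := hQ z z1; rewrite -QG in h1.
rewrite (normcB (g z)) in h2; have vz := weight_pos v z1.
have -> : e = e / 2 + e / 2 by field.
apply: le_trans (lerD h1 h2); rewrite -mulrDr ler_wpM2l ?(ltW vz)//.
by have := normcD (poly_action P (c^-1 *: f) z - Q.[z]) (Q.[z] - g z); rewrite addrA subrK.
Qed.

End CyclicVectors.

(** * From cyclic vectors to the form of invariant subspaces *)

Section InvariantSubspaces.
Context {R : realType}.
Local Notation C := (Cplx R).
Local Notation rc := (real_complex R).

(** Common to both spaces, with [ev] the underlying function. K is the least order of a zero at 0
    occurring in [M]; it exists by the identity theorem. The last hypothesis is where closedness,
    invariance and cyclicity enter. *)
Lemma vanishing_form (E : Type) (ev : E -> C -> C) (x0 : E) (M : set E) :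
  (forall f, holomorphic_disc (ev f)) -> (forall f, ev f = 0 -> f = x0) ->
  M x0 -> M <> [set x0] -> M <> setT ->
  (forall K f g, M f -> (forall j, (j < K)%N -> derive1n j (ev f) 0 = 0) ->
     derive1n K (ev f) 0 <> 0 -> (forall j, (j < K)%N -> derive1n j (ev g) 0 = 0) -> M g) ->
  exists2 K : nat, (0 < K)%N &
    M = [set f | forall j, (j < K)%N -> derive1n j (ev f) 0 = 0].
Proof.
move=> hol ev0 Mx0 Mnz MnT HM.
have [f Mf fn0] : exists2 f, M f & f <> x0.
  apply: contrapT => h; apply: Mnz; apply/seteqP; split=> [f Mf|_ ->//].
  by apply: contrapT => fx; apply: h; exists f.
pose p := [pred j | `[< exists2 f, M f & derive1n j (ev f) 0 <> 0 >]].
have pex : exists j, p j.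
  apply: contrapT => h; apply: fn0; apply: ev0; apply/funext => z.
  have [z1|z1] := pselect (disc z); last by rewrite (hol f).2.
  apply: poly_limit_eq0 z1; first exact: holomorphic_poly_limit.
  move=> j; apply: contrapT => fj; apply: h; exists j; apply/asboolP.
  by exists f.
case: (ex_minnP pex) => K /asboolP[g Mg gK] minK.
have below h j : M h -> (j < K)%N -> derive1n j (ev h) 0 = 0.
  move=> Mh jK; apply: contrapT => hj; have := minK j.
  by rewrite leqNgt jK => /(_ _)/negP; apply => //; apply/asboolP; exists h.
have ME : M = [set f | forall j, (j < K)%N -> derive1n j (ev f) 0 = 0].
  apply/seteqP; split=> [h Mh j jK|h hh]; first exact: below.
  by apply: (HM K g h) => // j jK; exact: below.
(* K = 0 would impose no condition and make [M] the whole space. *)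
exists K => //; rewrite lt0n; apply/negP => /eqP K0; apply: MnT.
by rewrite ME K0; apply/seteqP; split.
Qed.

Lemma poly_action_mem (E : lmodType C) (ev : {linear E -> (C -> C)}) (J : {linear E -> E})
  (M : set E) P f : (forall f, ev (J f) = integration (ev f)) ->
  submod_closed (mem M) -> invariant_subset J M -> M f ->
  exists2 h, M h & ev h = poly_action P (ev f).
Proof.
move=> evJ [M0 MD] JM Mf; rewrite !inE in M0.
have Miter i : M (iter i J f) by elim: i => //= i IH; apply: JM; exists (iter i J f).
have evi i : ev (iter i J f) = iter i (@integration R) (ev f).
  by elim: i => //= i IH; rewrite evJ IH.
exists (\sum_(i < size P) P`_i *: iter i J f); last first.
  by rewrite linear_sum; apply: eq_bigr => i _; rewrite linearZ evi.
elim/big_ind : _ => [//|x y Mx My|i _].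
  by have := MD 1 x y; rewrite !inE scale1r; apply.
by have := MD P`_i (iter i J f) 0; rewrite !inE addr0; apply.
Qed.

End InvariantSubspaces.

(** * Integration and convergence in one weighted Banach space *)

Section BanachStep.
Context {R : realType} (v : weight R).
Local Notation C := (Cplx R).
Local Notation rc := (real_complex R).

Lemma H0_normE (f : H0 v) : `|f| = rc (wnorm v (val f)).
Proof. by []. Qed.

Lemma H0_integration_subproof (f : H0 v) : integration (val f) \in H0_pred v.
Proof. by rewrite inE; apply: H0_integration; exact: H0P. Qed.

Definition H0_J (f : H0 v) : H0 v := Sub (integration (val f)) (H0_integration_subproof f).

Lemma H0_J_linear : linear H0_J.
Proof.
move=> c f g; apply: val_inj => /=.
by rewrite integration_linear//; apply: holomorphic_cts; case: (H0P f) (H0P g) => ? _ [].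
Qed.

HB.instance Definition _ := GRing.isLinear.Build C (H0 v) (H0 v) _ H0_J H0_J_linear.

Lemma H0_J_continuous : continuous H0_J.
Proof.
move=> f; apply/(@cvgrPdist_lt _ (H0 v) _ (nbhs f) (nbhs_filter f) H0_J) => e e0; near=> g.
rewrite -linearB; apply: (@le_lt_trans _ _ `|f - g|).
  by rewrite !H0_normE lecE_real; apply: wnorm_integration_le; exact: H0P.
near: g; exact: (cvgr_dist_lt (FF := nbhs_filter f) id f).
Unshelve. all: by end_near. Qed.

Lemma H0_cvg_seq (u : nat -> H0 v) (g : H0 v) n0 :
  (forall k, (n0 <= k)%N -> forall z, disc z ->
     v (normc z) * normc (val (u k) z - val g z) <= 2 ^- k) -> u @ \oo --> g.
Proof.
move=> h; apply/cvgrPdist_lt => _ /Cplx_gt0P[e e0 ->].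
have := @cvg_geometric R 1 2^-1.
rewrite ger0_norm ?invr_ge0// invf_lt1 ?ltr1n// => /(_ isT) /cvgrPdist_lt/(_ e e0) he.
near=> k; rewrite distrC H0_normE ltcE_real.
apply: (@le_lt_trans _ _ (2 ^- k)).
  apply: wnorm_le => z z1; apply: h => //; near: k; exact: nbhs_infty_ge.
have : `|0 - geometric 1 2^-1 k| < e by near: k; exact: he.
rewrite sub0r normrN /geometric/= mul1r exprVn; apply: le_lt_trans; exact: ler_norm.
Unshelve. all: by end_near. Qed.

End BanachStep.

(** * The projective limit *)

Section Projective.
Context {R : realType} (a : nat -> weight R).
Local Notation C := (Cplx R).
Local Notation rc := (real_complex R).

Lemma A0H_P (f : A0H a) n : H0_set (a n) (val f).
Proof. by have := valP f; rewrite inE => /(_ n I). Qed.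

Lemma A0H_integration_subproof (f : A0H a) : integration (val f) \in A0H_pred a.
Proof. by rewrite inE => n _; apply: H0_integration; exact: A0H_P. Qed.

Definition A0H_J (f : A0H a) : A0H a := Sub (integration (val f)) (A0H_integration_subproof f).

Lemma A0H_J_linear : linear A0H_J.
Proof.
move=> c f g; apply: val_inj => /=.
by rewrite integration_linear//; apply: holomorphic_cts; case: (A0H_P f 0) (A0H_P g 0) => ? _ [].
Qed.

HB.instance Definition _ := GRing.isLinear.Build C (A0H a) (A0H a) _ A0H_J A0H_J_linear.

Lemma A0H_cvgP (F : set_system (A0H a)) (g : A0H a) : Filter F ->
  (forall n, (@A0H_incl R a n) @ F --> (@A0H_incl R a n g : H0 (a n))) -> F --> g.
Proof.
move=> FF h; apply/cvg_sup => n A /= [_ [[B Bo <-] Bg] BA].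
apply: filterS BA _; apply: (h n B); exact: open_nbhs_nbhs.
Qed.

Lemma A0H_incl_continuous n : continuous (@A0H_incl R a n : A0H a -> H0 (a n)).
Proof.
move=> g; have /cvg_sup/(_ n) h : nbhs g --> g by [].
by apply: cvg_trans (@initial_continuous _ _ (@A0H_incl R a n) g); apply: cvg_app.
Qed.

Lemma A0H_J_continuous : continuous A0H_J.
Proof.
move=> f; apply: (@A0H_cvgP (A0H_J @ f)) => [|n].
  exact: (@fmap_filter _ _ _ _ (nbhs_filter f)).
have E g : @A0H_incl R a n (A0H_J g) = H0_J (@A0H_incl R a n g) by exact: val_inj.
have := cvg_comp _ _ (@A0H_incl_continuous n f) (@H0_J_continuous R (a n) (@A0H_incl R a n f)).
rewrite /= -E; apply: cvg_trans => A hA.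
by move: hA; rewrite /= !nbhs_simpl/=; apply: filterS => y; rewrite /= -E.
Qed.

Lemma increasing_weights_le m n r : increasing_weights a -> (m <= n)%N -> 0 <= r < 1 ->
  a m r <= a n r.
Proof.
move=> ha mn r01; elim: n mn => [|n IH]; first by rewrite leqn0 => /eqP ->.
rewrite leq_eqVlt => /predU1P[-> //|]; rewrite ltnS => /IH h; exact: le_trans h (ha n r r01).
Qed.

(** A diagonal choice: the k-th element of [M] is 2^-k close to [g] in the norm of [a k]. As the
    weights increase, it is at least as close in the norm of [a n] for every n up to k, so the
    sequence converges to [g] in every norm. *)
Lemma A0H_invariant (M : set (A0H a)) : increasing_weights a ->
  proper_subspace M -> closed M -> invariant_subset A0H_J M ->
  exists2 K : nat, (0 < K)%N &
    M = [set f | forall j : nat, (j < K)%N -> derive1n j (val f) 0 = 0].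
Proof.
move=> ha [Msub Mnz MnT] Mcl JM.
apply: (@vanishing_form R (A0H a) val 0) => //.
- by move=> f; case: (A0H_P f 0).
- by move=> f f0; apply: val_inj.
- by have [] := Msub; rewrite inE.
move=> K f g Mf fK fnK gK.
have /choice[u hu] k : exists h : A0H a, M h /\ forall z, disc z ->
    a k (normc z) * normc (val h z - val g z) <= 2 ^- k.
  have e0 : 0 < 2 ^- k :> R by rewrite invr_gt0 exprn_gt0.
  have [P hP] := cyclic_vector (A0H_P f k) (A0H_P g k) fK fnK gK e0.
  have [h Mh hE] := @poly_action_mem R (A0H a) val A0H_J M P f (fun=> erefl) Msub JM Mf.
  by exists h; split=> // z /hP; rewrite -hE.
apply: (@closed_cvg _ _ \oo _ u M Mcl _ g).
  by apply: nearW => k; case: (hu k).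
apply: A0H_cvgP => n.
apply: (@H0_cvg_seq R (a n) (fun k => @A0H_incl R a n (u k)) (@A0H_incl R a n g) n) => k nk z z1.
apply: le_trans ((hu k).2 z z1); rewrite ler_wpM2r ?normc_ge0//.
by apply: increasing_weights_le => //; rewrite normc_ge0.
Qed.

End Projective.

(** * Pulling back locally convex topologies along a linear map *)

Section PullbackTopology.
Context {R : realType} (E : lmodType (Cplx R)) (J : {linear E -> E}).
Local Notation TV t := (@Topological.Pack E t).

(** Continuity into the finest admissible topology is proved with this: if the pullback of every
    admissible topology is admissible, it is coarser than that finest topology, which is continuity
    of [J]. *)
Definition pullback_topology (t : Topological E) : Topological E :=
  Topological.on (initial_topology (J : E -> TV t)).

Lemma nbhs_pullback (t : Topological E) (x : E) (A : set E) :
  nbhs (x : TV (pullback_topology t)) A <->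
  exists2 B, nbhs (J x : TV t) B & J @^-1` B `<=` A.
Proof.
split=> [[_ [[B Bo <-] Bx] BA]|[B]].
  by exists B => //; rewrite (@nbhsE (TV t)); exists B.
rewrite nbhsE => -[W [Wo Wx] WB] BA.
rewrite (@nbhsE (TV (pullback_topology t))); exists (J @^-1` W).
  by split=> //; exists W.
by move=> y Wy; apply: BA; exact: WB.
Qed.

Lemma pullback_locally_convex (t : Topological E) :
  locally_convex_topology t -> locally_convex_topology (pullback_topology t).
Proof.
move=> [tD tZ [B Bc [Bo Bb]]]; split.
- move=> [x y] A /nbhs_pullback[W]; rewrite linearD => /(tD (J x, J y)) [[W1 W2] /= [h1 h2] hW] WA.
  exists (J @^-1` W1, J @^-1` W2) => /=.
    by split; apply/nbhs_pullback; [exists W1|exists W2].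
  move=> [x' y'] [/= hx hy]; apply: WA; rewrite /= linearD; exact: (hW (J x', J y')).
- move=> [k y] A /nbhs_pullback[W]; rewrite linearZ => /(tZ (k, J y)) [[W1 W2] /= [h1 h2] hW] WA.
  exists (W1, J @^-1` W2) => /=.
    by split=> //; apply/nbhs_pullback; exists W2.
  move=> [k' y'] [/= hx hy]; apply: WA; rewrite /= linearZ; exact: (hW (k', J y')).
exists [set J @^-1` b | b in B].
  move=> _ [b Bb' <-] x y l /set_mem hx /set_mem hy; apply/mem_set.
  have /set_mem := Bc b Bb' (J x) (J y) l (mem_set hx) (mem_set hy).
  by congr b; rewrite /conv/= linearD !linearZ.
split=> [_ [b Bb' <-]|x A /nbhs_pullback[W Wx WA]]; first by exists b => //; exact: Bo.
have [b [Bb' bx] bW] := Bb (J x) W Wx.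
exists (J @^-1` b); first by split=> //; exists b.
by apply: subset_trans WA => y; exact: bW.
Qed.

End PullbackTopology.

(** * The inductive limit *)

Section Inductive.
Context {R : realType} (v : nat -> weight R) (hv : decreasing_weights v).
Local Notation C := (Cplx R).
Local Notation rc := (real_complex R).

Lemma V0H_P (f : V0H hv) : exists n, H0_set (v n) (val f).
Proof. by have := valP f; rewrite inE => -[n _ h]; exists n. Qed.

Lemma V0H_holomorphic (f : V0H hv) : holomorphic_disc (val f).
Proof. by have [n []] := V0H_P f. Qed.

Lemma V0H_integration_subproof (f : V0H hv) : integration (val f) \in V0H_pred hv.
Proof. by rewrite inE; have [n h] := V0H_P f; exists n => //; exact: H0_integration. Qed.

Definition V0H_J (f : V0H hv) : V0H hv := Sub (integration (val f)) (V0H_integration_subproof f).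

Lemma V0H_J_linear : linear V0H_J.
Proof.
move=> c f g; apply: val_inj => /=.
by rewrite integration_linear//; apply: holomorphic_cts; exact: V0H_holomorphic.
Qed.

HB.instance Definition _ := GRing.isLinear.Build C (V0H hv) (V0H hv) _ V0H_J V0H_J_linear.

Local Notation TV t := (@Topological.Pack (V0H hv) t).

(** [J] commutes with the inclusions, so after an inclusion it factors through the continuous
    integration operator of the step. *)
Lemma pullback_admissible (t : Topological (V0H hv)) :
  V0H_admissible t -> V0H_admissible (pullback_topology V0H_J t).
Proof.
move=> [tc ti]; split; first exact: pullback_locally_convex.
move=> n f A /nbhs_pullback[W Wf WA].
have E g : V0H_J (V0H_incl hv g) = V0H_incl hv (@H0_J R (v n) g) by exact: val_inj.
have {}Wf : nbhs (V0H_incl hv (H0_J f) : TV t) W by rewrite -E.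
have h := @H0_J_continuous R (v n) f _ (ti n (H0_J f) W Wf).
by apply: (@filterS _ (nbhs f) _ _ _ _ h) => g hg; apply: WA; rewrite /= E.
Qed.

Lemma V0H_J_continuous : continuous V0H_J.
Proof.
move=> f; apply: (@V0H_cvgP R v hv (V0H_J @ f)) => [|t ht A hA].
  exact: (@fmap_filter _ _ _ _ (nbhs_filter f)).
have := @V0H_id_continuous R v hv _ (pullback_admissible ht) f (V0H_J @^-1` A); apply.
by apply/(nbhs_pullback V0H_J); exists A.
Qed.

(** Both [f] and [g] lie in a common step, which integration preserves. The approximation takes
    place in the norm of that step and is carried to the limit space by the continuous inclusion. *)
Lemma V0H_invariant (M : set (V0H hv)) :
  proper_subspace M -> closed M -> invariant_subset V0H_J M ->
  exists2 K : nat, (0 < K)%N &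
    M = [set f | forall j : nat, (j < K)%N -> derive1n j (val f) 0 = 0].
Proof.
move=> [Msub Mnz MnT] Mcl JM.
apply: (@vanishing_form R (V0H hv) val 0) => //.
- exact: V0H_holomorphic.
- by move=> f f0; apply: val_inj.
- by have [] := Msub; rewrite inE.
move=> K f g Mf fK fnK gK.
have [n [fn gn]] : exists n, H0_set (v n) (val f) /\ H0_set (v n) (val g).
  have [[n hf] [m hg]] := (V0H_P f, V0H_P g); exists (maxn n m).
  by split; [apply: H0_set_mono hf|apply: H0_set_mono hg]; rewrite // ?leq_maxl ?leq_maxr.
have /choice[u hu] k : exists h : H0 (v n), M (V0H_incl hv h) /\ forall z, disc z ->
    v n (normc z) * normc (val h z - val g z) <= 2 ^- k.
  have e0 : 0 < 2 ^- k :> R by rewrite invr_gt0 exprn_gt0.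
  have [P hP] := cyclic_vector fn gn fK fnK gK e0.
  have [h Mh hE] := @poly_action_mem R (V0H hv) val V0H_J M P f (fun=> erefl) Msub JM Mf.
  have hn : val h \in H0_pred (v n).
    rewrite hE; apply: rpred_sum => i _; apply: rpredZ; rewrite inE.
    exact: H0_iter_integration.
  exists (Sub (val h) hn : H0 (v n)); split=> [|z /hP]; last by rewrite -hE.
  by rewrite (_ : V0H_incl hv _ = h)//; exact: val_inj.
have gn' : val g \in H0_pred (v n) by rewrite inE.
pose g' : H0 (v n) := Sub (val g) gn'.
have -> : g = V0H_incl hv g' by exact: val_inj.
apply: (@closed_cvg _ _ \oo _ (@V0H_incl R v hv n \o u) M Mcl).
  by apply: nearW => k; case: (hu k).
have [_ /(_ n g') hcont] := @V0H_topology_admissible R v hv.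
have hu' : u @ \oo --> g'.
  by apply: (@H0_cvg_seq R (v n) u g' 0%N) => k _ z z1; exact: (hu k).2.
exact: (cvg_comp _ _ hu' hcont).
Qed.

End Inductive.

Theorem theorem4p1 (R : realType) :
  (forall a : nat -> weight R, increasing_weights a ->
    exists J : {linear A0H a -> A0H a},
      [/\ forall f : A0H a, val (J f) = integration (val f),
          continuous J &
          forall M : set (A0H a),
            proper_subspace M -> closed M -> invariant_subset J M ->
            exists2 K : nat, (0 < K)%N &
              M = [set f | forall j : nat, (j < K)%N ->
                             derive1n j (val f) 0 = 0]]) /\
  (forall (v : nat -> weight R) (hv : decreasing_weights v),
    exists J : {linear V0H hv -> V0H hv},
      [/\ forall f : V0H hv, val (J f) = integration (val f),
          continuous J &
          forall M : set (V0H hv),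
            proper_subspace M -> closed M -> invariant_subset J M ->
            exists2 K : nat, (0 < K)%N &
              M = [set f | forall j : nat, (j < K)%N ->
                             derive1n j (val f) 0 = 0]]).
Proof.
split=> [a ha|v hv].
  exists (@A0H_J R a : {linear A0H a -> A0H a}); split=> //.
    exact: A0H_J_continuous.
  by move=> M; exact: A0H_invariant.
exists (@V0H_J R v hv : {linear V0H hv -> V0H hv}); split=> //.
  exact: V0H_J_continuous.
by move=> M; exact: V0H_invariant.
Qed.
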